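(* The set $\mathcal{L}=\big\{u\in\bigcap_{p<1}h^p : \widetilde{u}\notin h^q \text{ for all } q>0\big\}$ is a $G_\delta$ and dense subset of $\bigcap_{p<1}h^p$.
   Context: $\mathbb{D}$ is the open unit disc in $\mathbb{C}$. For $0<p<+\infty$, $h^p$ is the set of real-valued harmonic functions $u:\mathbb{D}\to\mathbb{R}$ with $\sup_{0<r<1}\frac{1}{2\pi}\int_{-\pi}^{\pi}|u(re^{i\theta})|^p\,d\theta<+\infty$. For $0<p<1$, $h^p$ carries the metric $d_p(u,v)=\sup_{0<r<1}\frac{1}{2\pi}\int_{-\pi}^{\pi}|u(re^{i\theta})-v(re^{i\theta})|^p\,d\theta$. The space $\bigcap_{p<1}h^p$ (intersection over $0<p<1$) carries the metric $d(u,v)=\sum_{n=1}^\infty 2^{-n}\frac{d_{p_n}(u,v)}{1+d_{p_n}(u,v)}$, where $(p_n)$ is any strictly increasing sequence in $(0,1)$ converging to $1$; equivalently, convergence in it is convergence in $h^p$ for every $0<p<1$. For a real harmonic $u$ on $\mathbb{D}$, $\widetilde{u}$ is its harmonic conjugate normalized by $\widetilde{u}(0)=0$, i.e. the unique real harmonic function on $\mathbb{D}$ with $\widetilde{u}(0)=0$ and $u+i\widetilde{u}$ holomorphic. *)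

(* Defs.v *)
From HB Require Import structures.
From mathcomp Require Import all_boot all_order all_algebra.
From mathcomp Require Import complex.
From mathcomp Require Import all_classical all_reals all_analysis.
From mathcomp Require Import measurable_realfun.

Set Implicit Arguments.
Unset Strict Implicit.
Unset Printing Implicit Defensive.

Import Order.TTheory GRing.Theory Num.Theory.
Import numFieldNormedType.Exports.

Local Open Scope classical_set_scope.
Local Open Scope ring_scope.
Local Open Scope complex_scope.

Section harmonic_disc.
Variable R : realType.
Implicit Types (u v w : R[i] -> R) (p q r : R) (U : R * R -> R).

Definition disc : set R[i] := [set z | `|z| < 1].

Definition plane u : R * R -> R := fun xy => u (xy.1 +i* xy.2).

Definition C1_on (A : set (R * R)) U := forall a, A a ->
  [/\ differentiable U a,
      {for a, continuous ('D_(1, 0) U)} &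
      {for a, continuous ('D_(0, 1) U)}].

Definition harmonic_on (A : set (R * R)) U :=
  [/\ C1_on A U, C1_on A ('D_(1, 0) U), C1_on A ('D_(0, 1) U) &
      forall a, A a ->
        'D_(1, 0) ('D_(1, 0) U) a + 'D_(0, 1) ('D_(0, 1) U) a = 0].

(* A real harmonic function on the disc is represented by its extension by 0
   to the whole plane, so that equality of representatives is equality on the
   disc. *)
Definition harmonic_disc : set (R[i] -> R) :=
  [set u | harmonic_on [set a | disc (a.1 +i* a.2)] (plane u) /\
           forall z, ~ disc z -> u z = 0].

Definition holomorphic_on (A : set R[i]) (f : R[i]^o -> R[i]^o) :=
  forall z : R[i]^o, A z -> derivable f z 1.

Definition harmonic_conjugate u v :=
  [/\ harmonic_disc v, v 0 = 0 &
      holomorphic_on disc (fun z => u z +i* v z)].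

(* xget returns the default, here the zero function, only if u has no
   conjugate; zero lies in every h^q, so this case never adds a function to
   the set of functions whose conjugate is in no h^q. *)
Definition harmonic_conj u : R[i] -> R :=
  xget (cst 0) (harmonic_conjugate u).

Definition circle r (t : R) : R[i] := (r * cos t) +i* (r * sin t).

Definition circle_mean p u r : \bar R :=
  (((2 * pi)^-1)%R%:E *
   \int[lebesgue_measure]_(t in `[(- pi)%R, pi%R])
     (`|u (circle r t)| `^ p)%R%:E)%E.

Definition hp_size p u : \bar R :=
  ereal_sup [set circle_mean p u r | r in `]0, 1[].

Definition hp p : set (R[i] -> R) :=
  [set u | harmonic_disc u /\ (hp_size p u < +oo)%E].

Definition hp_dist p u v : R := fine (hp_size p (u \- v)).

Definition cap_hp : set (R[i] -> R) := \bigcap_(p in `]0, 1[) hp p.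

(* The exponents are indexed from 0: (p n) plays the role of p_(n+1). *)
Definition cap_dist (p : nat -> R) u v : R :=
  limn (series (fun n =>
    2^-1 ^+ n.+1 * (hp_dist (p n) u v / (1 + hp_dist (p n) u v)))).

End harmonic_disc.

Section cap_hp_metric.
Variable R : realType.
Implicit Types (u v w : R[i] -> R) (p r t : R).

Let I : set R := `[(- pi)%R, pi%R].

Lemma disc_circle r t : 0 <= r < 1 -> disc (circle r t).
Proof.
case/andP=> r0 r1; rewrite /disc /circle /= normc_def/= !exprMn -mulrDr.
by rewrite cos2Dsin2 mulr1 sqrtr_sqr ger0_norm// (_ : 1 = 1%:C)// ltcR.
Qed.

Lemma harmonic_disc_continuous u (a : R * R) : harmonic_disc u ->
  disc (a.1 +i* a.2) -> {for a, continuous (plane u)}.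
Proof.
move=> [[Cu _ _ _] _] da.
by have [du _ _] := Cu a da; exact: differentiable_continuous.
Qed.

Lemma continuous_circle u r : harmonic_disc u -> 0 <= r < 1 ->
  continuous (fun t => u (circle r t)).
Proof.
move=> hu r01 t.
have H := @harmonic_disc_continuous u (r * cos t, r * sin t) hu
  (disc_circle t r01).
have G : {for t, continuous (fun t => (r * cos t, r * sin t))}.
  have C1 : r * cos s @[s --> t] --> r * cos t.
    by apply: cvgMr; exact: continuous_cos.
  have C2 : r * sin s @[s --> t] --> r * sin t.
    by apply: cvgMr; exact: continuous_sin.
  exact: (cvg_pair C1 C2).
exact: (continuous_comp G H).
Qed.

Lemma continuous_circleB u v r : harmonic_disc u -> harmonic_disc v ->
  0 <= r < 1 -> continuous (fun t => (u \- v) (circle r t)).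
Proof.
move=> hu hv r01 t; apply: cvgB; exact: continuous_circle.
Qed.

Lemma measurable_circle p w r : continuous (fun t => w (circle r t)) ->
  measurable_fun I (fun t => (`|w (circle r t)| `^ p)%R%:E).
Proof.
move=> cw; apply: (@measurable_funS _ _ _ _ setT) => //.
apply/measurable_EFinP; apply: (measurableT_comp (measurable_powR p)).
apply: (measurableT_comp (@normr_measurable R setT)).
exact: continuous_measurable_fun.
Qed.

Lemma pi2_ge0 : (0 <= ((2 * pi)^-1 : R)).
Proof. by rewrite invr_ge0 mulr_ge0// pi_ge0. Qed.

Lemma circle_mean_ge0 p u r : (0 <= circle_mean p u r)%E.
Proof.
apply: mule_ge0; first by rewrite lee_fin pi2_ge0.
by apply: integral_ge0 => t _; rewrite lee_fin powR_ge0.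
Qed.

Lemma hp_size_ge0 p u : (0 <= hp_size p u)%E.
Proof.
apply: (le_trans (circle_mean_ge0 p u 2^-1)); apply: ereal_sup_ubound.
by exists 2^-1 => //=; rewrite in_itv/= invr_gt0 ltr0n/= invf_lt1// ltr1n.
Qed.

Lemma powR_subadd p (x y : R) : 0 < p < 1 -> 0 <= x -> 0 <= y ->
  (x + y) `^ p <= x `^ p + y `^ p.
Proof.
move=> /andP[p0 p1] x0 y0.
have [s0|s0] := eqVneq (x + y) 0.
  by rewrite s0 powR0 ?gt_eqF// addr_ge0// powR_ge0.
have sp : 0 < x + y by rewrite lt_neqAle eq_sym s0 addr_ge0.
have aux z : 0 <= z -> z <= x + y -> z / (x + y) * (x + y) `^ p <= z `^ p.
  rewrite le_eqVlt => /predU1P[<- _|z0 zs].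
    by rewrite !mul0r powR_ge0.
  have -> : z `^ p = (z / (x + y)) `^ p * (x + y) `^ p.
    by rewrite -powRM ?divr_ge0 ?divfK// ltW.
  rewrite ler_wpM2r ?powR_ge0// ger1_powR ?(ltW p1)//.
  by rewrite divr_gt0//= ler_pdivrMr// mul1r.
rewrite -[leLHS]mul1r -{1}(divff s0) [in leLHS]mulrDl mulrDl.
by rewrite lerD// aux// ?lerDl ?lerDr.
Qed.

Lemma circle_mean_le p f g h r : 0 < p < 1 ->
  continuous (fun t => f (circle r t)) ->
  continuous (fun t => g (circle r t)) ->
  continuous (fun t => h (circle r t)) ->
  (forall z, `|h z| <= `|f z| + `|g z|) ->
  (circle_mean p h r <= circle_mean p f r + circle_mean p g r)%E.
Proof.
move=> p01 cf cg ch hfg.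
rewrite /circle_mean -ge0_muleDr; first last.
- by apply: integral_ge0 => t _; rewrite lee_fin powR_ge0.
- by apply: integral_ge0 => t _; rewrite lee_fin powR_ge0.
apply: lee_wpmul2l; first by rewrite lee_fin pi2_ge0.
rewrite -ge0_integralD//; try exact: measurable_circle.
apply: ge0_le_integral => //.
- exact: measurable_circle.
- by apply: emeasurable_funD; exact: measurable_circle.
move=> t _; rewrite -EFinD lee_fin.
apply: le_trans (powR_subadd p01 (normr_ge0 _) (normr_ge0 _)).
by case/andP: p01 => p0 _; apply: ge0_ler_powR; rewrite ?nnegrE ?addr_ge0// ltW.
Qed.

Lemma hp_size_le p f g h : 0 < p < 1 ->
  (forall r, 0 <= r < 1 -> continuous (fun t => f (circle r t))) ->
  (forall r, 0 <= r < 1 -> continuous (fun t => g (circle r t))) ->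
  (forall r, 0 <= r < 1 -> continuous (fun t => h (circle r t))) ->
  (forall z, `|h z| <= `|f z| + `|g z|) ->
  (hp_size p h <= hp_size p f + hp_size p g)%E.
Proof.
move=> p01 cf cg ch hfg; apply: ge_ereal_sup => _ [r rr <-].
have r01 : 0 <= r < 1 by move: rr; rewrite /= in_itv/= => /andP[/ltW-> ->].
apply: (le_trans (circle_mean_le p01 (cf _ r01) (cg _ r01) (ch _ r01) hfg)).
by apply: leeD; apply: ereal_sup_ubound; exists r.
Qed.

Lemma circle_mean_le_size p w r : 0 < r < 1 ->
  (circle_mean p w r <= hp_size p w)%E.
Proof. by move=> r01; apply: ereal_sup_ubound; exists r. Qed.

Lemma hp_sizeBC p u v : hp_size p (u \- v) = hp_size p (v \- u).
Proof.
congr ereal_sup; apply: eq_imagel => r _; congr (_ * _)%E.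
by apply: eq_integral => t _; rewrite /= distrC.
Qed.

Lemma hp_sizeBB p u : 0 < p -> hp_size p (u \- u) = 0%E.
Proof.
move=> p0; apply/eqP; rewrite eq_le hp_size_ge0 andbT.
apply: ge_ereal_sup => _ [r _ <-]; rewrite /circle_mean integral0_eq ?mule0//.
by move=> t _; rewrite /= subrr normr0 powR0// gt_eqF.
Qed.

Local Opaque hp_size.

Lemma hp_sizeB_fin p u v : 0 < p < 1 -> hp p u -> hp p v ->
  hp_size p (u \- v) \is a fin_num.
Proof.
move=> p01 [hu su] [hv sv].
have le : (hp_size p (u \- v)%R <= hp_size p u + hp_size p v)%E.
  apply: hp_size_le => //.
  - by move=> r; exact: continuous_circle.
  - by move=> r; exact: continuous_circle.
  - by move=> r; exact: continuous_circleB.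
  - by move=> z; exact: ler_normB.
rewrite ge0_fin_numE; last exact: hp_size_ge0.
have lt := lte_add_pinfty su sv.
exact: le_lt_trans le lt.
Qed.

Lemma hp_dist_ge0 p u v : 0 <= hp_dist p u v.
Proof. by rewrite /hp_dist fine_ge0// hp_size_ge0. Qed.

Lemma hp_distC p u v : hp_dist p u v = hp_dist p v u.
Proof. by rewrite /hp_dist hp_sizeBC. Qed.

Lemma hp_distxx p u : 0 < p -> hp_dist p u u = 0.
Proof. by move=> p0; rewrite /hp_dist hp_sizeBB. Qed.

Lemma hp_dist_triangle p v u w : 0 < p < 1 -> hp p u -> hp p v -> hp p w ->
  hp_dist p u w <= hp_dist p u v + hp_dist p v w.
Proof.
move=> p01 hu hv hw.
have fuv := hp_sizeB_fin p01 hu hv; have fvw := hp_sizeB_fin p01 hv hw.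
have fuw := hp_sizeB_fin p01 hu hw.
have fs : (hp_size p (u \- v)%R + hp_size p (v \- w)%R)%E \is a fin_num.
  by rewrite fin_numD; apply/andP; split; [exact: fuv|exact: fvw].
have [[hu1 _] [hv1 _]] := (hu, hv); have [hw1 _] := hw.
rewrite /hp_dist -(fineD fuv fvw); apply: (fine_le fuw fs).
apply: hp_size_le p01 _ _ _ _.
- by move=> r; exact: continuous_circleB.
- by move=> r; exact: continuous_circleB.
- by move=> r; exact: continuous_circleB.
- by move=> z /=; exact: ler_distD.
Qed.

Lemma circle_eq0 p w r t : 0 < p -> continuous (fun t => w (circle r t)) ->
  circle_mean p w r = 0%E -> - pi <= t <= pi -> w (circle r t) = 0.
Proof.
move=> p0 cw m0 /andP[pt tp]; apply/eqP/negPn/negP => wt0.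
have pp : 0 < pi :> R := pi_gt0 R.
pose e := `|w (circle r t)| / 2.
have e0 : 0 < e by rewrite divr_gt0// normr_gt0.
have [/= d d0 dw] : exists2 d, 0 < d &
    forall s, `|t - s| < d -> e <= `|w (circle r s)|.
  have /cvgr_dist_lt/(_ _ e0)/nbhs_ballP[d /= d0 dw] := cw t.
  exists d => // s /dw; rewrite /= => /ltW ws.
  rewrite -(lerD2r e) {1}/e -splitr.
  apply: (le_trans _ (lerD (lexx _) ws)).
  by rewrite -{1}(addrNK (w (circle r s)) (w (circle r t))) addrC ler_normD.
pose a := Num.max (- pi) (t - d / 2); pose b := Num.min pi (t + d / 2).
have d2 : 0 < d / 2 by rewrite divr_gt0.
have ab : a < b.
  rewrite /a /b gt_max !lt_min; apply/andP; split; apply/andP; split.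
  - by rewrite (lt_trans _ pp)// oppr_lt0.
  - by rewrite (le_lt_trans pt)// ltrDl.
  - by rewrite (lt_le_trans _ tp)// ltrBlDr ltrDl.
  - by rewrite (@lt_trans _ _ t)// ?ltrDl// ltrBlDr ltrDl.
pose f t := (`|w (circle r t)| `^ p)%R%:E.
have mf : measurable_fun I f by exact: measurable_circle.
have If0 : (\int[lebesgue_measure]_(t in I) `|f t| = 0)%E.
  under eq_integral do rewrite gee0_abs ?lee_fin ?powR_ge0//.
  move: m0 => /eqP; rewrite /circle_mean mule_eq0 => /orP[|/eqP //].
  by rewrite eqe invr_eq0 mulf_eq0 pnatr_eq0/= gt_eqF.
have := @le_integral_abse _ _ _ (@lebesgue_measure R) I (measurable_itv _) f
  (e `^ p) mf (powR_gt0 _ e0).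
rewrite If0 leNgt => /negP; apply.
rewrite mule_gt0// ?lte_fin ?powR_gt0//.
have : (lebesgue_measure `[a, b]%classic <= lebesgue_measure
    (I `&` [set x | ((e `^ p)%:E <= `|f x|)%E]))%E.
  apply: le_measure; rewrite ?inE//.
    apply: emeasurable_fun_c_infty; first exact: measurable_itv.
    exact: (measurableT_comp (@abse_measurable _ setT) mf).
  move=> s /=; rewrite in_itv/= /a /b ge_max le_min.
  move=> /andP[/andP[ps ds] /andP[sp sd]]; split.
    by rewrite /I/= in_itv/= ps sp.
  rewrite lee_fin ger0_norm ?powR_ge0//; apply: ge0_ler_powR.
  - exact: ltW.
  - by rewrite nnegrE ltW.
  - by rewrite nnegrE.
  apply: dw; apply: (@le_lt_trans _ _ (d / 2)).
    by rewrite distrC ler_distl ds.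
  by rewrite ltr_pdivrMr// ltr_pMr// ltr1n.
apply: lt_le_trans; rewrite lebesgue_measure_itv/= lte_fin ab.
by rewrite -EFinB lte_fin subr_gt0.
Qed.

Lemma polar (z : R[i]) : z != 0 -> exists r t,
  [/\ 0 < r, - pi <= t <= pi, z = circle r t & `|z| = r%:C].
Proof.
case: z => x y z0.
pose r := Num.sqrt (x ^+ 2 + y ^+ 2).
have r0 : 0 < r.
  rewrite sqrtr_gt0 lt_neqAle addr_ge0 ?sqr_ge0// andbT eq_sym.
  rewrite paddr_eq0 ?sqr_ge0// !sqrf_eq0; apply: contra z0.
  by move=> /andP[/eqP-> /eqP->].
have r2 : r ^+ 2 = x ^+ 2 + y ^+ 2 by rewrite sqr_sqrtr// addr_ge0 ?sqr_ge0.
have xr : -1 <= x / r <= 1.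
  rewrite -ler_norml normrM normfV (gtr0_norm r0) ler_pdivrMr// mul1r.
  rewrite -(@ler_pXn2r _ 2) ?nnegrE ?normr_ge0 ?(ltW r0)//.
  by rewrite r2 real_normK ?num_real// lerDl sqr_ge0.
have cr : r * cos (acos (x / r)) = x.
  by rewrite acosK ?in_itv//= mulrC divfK// gt_eqF.
have sr : r * sin (acos (x / r)) = `|y|.
  rewrite sin_acos// -{1}(gtr0_norm r0) -sqrtr_sqr -sqrtrM ?sqr_ge0//.
  rewrite mulrBr mulr1 -exprMn mulrC divfK ?gt_eqF// r2 addrC addKr.
  by rewrite sqrtr_sqr.
have a0 := acos_ge0 xr; have api := acos_lepi xr.
have [y0|y0] := leP 0 y.
  exists r, (acos (x / r)); split => //.
  - by rewrite api andbT (le_trans _ a0)// oppr_le0 pi_ge0.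
  - by rewrite /circle cr sr ger0_norm.
exists r, (- acos (x / r)); split => //.
- by rewrite lerN2 api/= (le_trans _ (pi_ge0 R))// oppr_le0.
- by rewrite /circle cosN sinN mulrN cr sr ltr0_norm// opprK.
Qed.

Lemma hp_dist_eq0 p u v : 0 < p < 1 -> hp p u -> hp p v ->
  hp_dist p u v = 0 -> u = v.
Proof.
move=> p01 hpu hpv duv; have p0 : 0 < p by case/andP: p01.
have [[hu _] [hv _]] := (hpu, hpv).
have s0 : hp_size p (u \- v) = 0%E.
  by rewrite -(fineK (hp_sizeB_fin p01 hpu hpv)) -/(hp_dist p u v) duv.
have on_circle r t : 0 < r < 1 -> - pi <= t <= pi ->
    u (circle r t) = v (circle r t).
  move=> /andP[r0 r1] tpi; apply/eqP; rewrite -subr_eq0; apply/eqP.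
  apply: (@circle_eq0 p (u \- v)) => //.
    by apply: continuous_circleB => //; rewrite ltW.
  apply/eqP; rewrite eq_le circle_mean_ge0 andbT -s0.
  by apply: circle_mean_le_size; rewrite r0.
have off0 z : z != 0 -> u z = v z.
  move=> z0; have [dz|ndz] := pselect (disc z); last first.
    by rewrite hu.2// hv.2.
  have [r [t [r0 tpi zE nz]]] := polar z0.
  rewrite zE; apply: on_circle => //; rewrite r0/=.
  by move: dz; rewrite /disc/= nz (_ : 1 = 1%:C)// ltcR.
apply/funext => z; have [->{z}|/off0//] := eqVneq z 0.
have d0 : disc ((0 : R) +i* 0).
  by rewrite /disc/= (_ : _ +i* _ = 0)// normr0 ltr01.
have lim w : harmonic_disc w ->
    plane w (s, 0) @[s --> (0 : R)^'+] --> w 0.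
  move=> hw; apply: cvg_at_right_filter.
  have G : {for 0, continuous (fun s : R => (s, 0 : R))}.
    exact: (@cvg_pair _ _ _ (nbhs (0 : R)) (nbhs (0 : R)) (nbhs (0 : R)) _ _ _
      id (cst 0) cvg_id (cvg_cst _)).
  exact: (continuous_comp G (@harmonic_disc_continuous w (0, 0) hw d0)).
apply: (cvg_unique _ (lim _ hu)) => //.
apply: cvg_trans (lim _ hv); apply: near_eq_cvg.
near=> s; apply/esym/off0; rewrite eq_complex/= eqxx andbT gt_eqF//.
Unshelve. all: by end_near. Qed.

Section series.
Variable p : nat -> R.
Hypothesis p01 : forall n, 0 < p n < 1.

Let term u v n : R :=
  2^-1 ^+ n.+1 * (hp_dist (p n) u v / (1 + hp_dist (p n) u v)).

Let term_ge0 u v n : 0 <= term u v n.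
Proof.
by rewrite mulr_ge0 ?exprn_ge0 ?invr_ge0// divr_ge0 ?addr_ge0 ?hp_dist_ge0.
Qed.

Lemma is_cvg_cap_dist u v : cvgn (series (term u v)).
Proof.
apply: (@series_le_cvg _ _ (geometric 2^-1 2^-1)) => //.
- by move=> n /=; rewrite mulr_ge0 ?exprn_ge0 ?invr_ge0.
- move=> n /=; rewrite -exprS -[leRHS]mulr1 ler_wpM2l ?exprn_ge0 ?invr_ge0//.
  have d0 := hp_dist_ge0 (p n) u v.
  by rewrite ler_pdivrMr ?mul1r ?lerDr// ltr_wpDr.
- apply: is_cvg_geometric_series.
  by rewrite ger0_norm ?invr_ge0// invf_lt1 ?ltr1n.
Qed.

Lemma cap_distC u v : cap_dist p u v = cap_dist p v u.
Proof.
have E : term u v = term v u.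
  by apply/funext => n; rewrite /term hp_distC.
exact: (congr1 (fun f => limn (series f)) E).
Qed.

Lemma cap_distxx u : cap_dist p u u = 0.
Proof.
rewrite /cap_dist (_ : series _ = cst 0) ?lim_cst//.
apply/funext => n; rewrite /series/= big1// => i _.
by rewrite hp_distxx ?mul0r ?mulr0//; case/andP: (p01 i).
Qed.

Let cap_hp_hp u n : cap_hp u -> hp (p n) u.
Proof. by apply; rewrite /= in_itv/=. Qed.

Lemma cap_dist_eq0 u v : cap_hp u -> cap_hp v -> cap_dist p u v = 0 -> u = v.
Proof.
move=> hu hv duv.
apply: (hp_dist_eq0 (p01 0) (cap_hp_hp 0 hu) (cap_hp_hp 0 hv)).
have nd : nondecreasing_seq (series (term u v)).
  by apply/nondecreasing_seqP => n; rewrite seriesSr lerDl.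
have := nondecreasing_cvgn_le nd (@is_cvg_cap_dist u v) 1.
rewrite -/(cap_dist p u v) duv /series/= big_nat1 => t0.
have /eqP : term u v 0 = 0 by apply/eqP; rewrite eq_le t0 term_ge0.
rewrite /term expr1 !mulf_eq0 !invr_eq0 pnatr_eq0/= => /orP[/eqP//|].
by rewrite gt_eqF// ltr_wpDr ?hp_dist_ge0.
Qed.

Lemma cap_dist_triangle v u w : cap_hp u -> cap_hp v -> cap_hp w ->
  cap_dist p u w <= cap_dist p u v + cap_dist p v w.
Proof.
move=> hu hv hw; rewrite /cap_dist -lim_seriesD; [|exact: is_cvg_cap_dist..].
apply: lim_series_le; first exact: is_cvg_cap_dist.
  by apply: is_cvg_seriesD; exact: is_cvg_cap_dist.
move=> n; change (term u w n <= term u v n + term v w n).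
rewrite /term -mulrDr ler_wpM2l ?exprn_ge0 ?invr_ge0//.
have := hp_dist_triangle (p01 n) (cap_hp_hp n hu) (cap_hp_hp n hv)
  (cap_hp_hp n hw).
move: (hp_dist_ge0 (p n) u w) (hp_dist_ge0 (p n) u v) (hp_dist_ge0 (p n) v w).
move: (hp_dist _ u w) (hp_dist _ u v) (hp_dist _ v w) => c a b c0 a0 b0 cab.
have P x : 0 <= x -> 0 < 1 + x by move=> x0; rewrite ltr_wpDr.
have ab0 := addr_ge0 a0 b0.
apply: (@le_trans _ _ ((a + b) / (1 + (a + b)))).
  move: (a + b) ab0 cab => s s0 cs.
  rewrite ler_pdivrMr ?P// mulrAC ler_pdivlMr ?P// !mulrDr !mulr1 lerD//.
  by rewrite mulrC.
rewrite mulrDl; apply: lerD; rewrite ler_wpM2l// lef_pV2 ?posrE ?P// lerD2l.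
  by rewrite lerDl.
by rewrite lerDr.
Qed.

End series.
End cap_hp_metric.

(* The carrier of the space, tagged with the exponents that define its metric:
   the alias keeps this metric apart from any topology on a function type. *)
Definition cap_hp_space (R : realType) (p : nat -> R)
  (p01 : forall n, 0 < p n < 1) : Type := {u : R[i] -> R | cap_hp u}.

Section cap_hp_space.
Variables (R : realType) (p : nat -> R) (p01 : forall n, 0 < p n < 1).

Let T := cap_hp_space p01.

HB.instance Definition _ := gen_eqMixin (cap_hp_space p01).
HB.instance Definition _ := gen_choiceMixin (cap_hp_space p01).

Let dist (u v : T) : R := cap_dist p (sval u) (sval v).

Let distxx u : dist u u = 0. Proof. exact: cap_distxx. Qed.

Let dist_eq0 u v : dist u v = 0 -> u = v.
Proof.
move: u v => [u hu] [v hv] /(cap_dist_eq0 p01 hu hv)/= uv.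
by case: v / uv hv => hv; congr exist; exact: Prop_irrelevance.
Qed.

Let distC u v : dist u v = dist v u. Proof. exact: cap_distC. Qed.

Let dist_triangle v u w : dist u w <= dist u v + dist v w.
Proof. by apply: cap_dist_triangle => //; exact: svalP. Qed.

HB.instance Definition _ :=
  isMetric.Build R (cap_hp_space p01) distxx dist_eq0 distC
    dist_triangle.

Lemma cap_hp_mdistE (u v : T) : mdist u v = cap_dist p (sval u) (sval v).
Proof. apply: erefl. Qed.

Definition conj_in_no_hp : set T :=
  [set u | forall q, 0 < q -> ~ hp q (harmonic_conj (sval u))].

End cap_hp_space.

Arguments conj_in_no_hp {R p} p01 _.

(* Main.v *)
Require Import Defs.
From HB Require Import structures.
From mathcomp Require Import all_boot all_order all_algebra.
From mathcomp Require Import complex.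
From mathcomp Require Import all_classical all_reals all_analysis.
From mathcomp Require Import borel_hierarchy.
From mathcomp Require Import ring lra measurable_realfun.

(** Call L the set of the theorem. Two facts are used throughout: the
    conjugate is linear, and a function of h^q lies in h^s for every s < q.

    Density. If u is not in L and v is in L, then u + x v is in L for every
    x <> 0: otherwise the conjugates of u and of u + x v would both lie in
    some h^q, hence so would the conjugate of v. Since u + x v tends to u as x
    tends to 0 (cap_dist_small), L is dense as soon as it is nonempty
    (dense_conj_in_no_hp).

    Countable intersection. L is the intersection over n of the sets of u
    whose conjugate has size greater than n in the exponent 1 / (n + 2). These
    sets are open because the conjugate depends continuously, uniformly on
    smaller discs, on the function in h^p (harmonic_conj_bound). That in turn
    combines three results: a harmonic function is the real part of a power
    series (harmonic_psum, by the Poisson integral and the maximum principle);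
    its conjugate is then obtained by multiplying the coefficients by - i
    (harmonic_conj_reps); and the means of order p < 1 control the function on
    smaller discs (hardy_littlewood).

    An element of L. Let g z = z / (1 - z^2) and, for signs eps_k, let f z be
    the sum over k of eps_k g (z^(2^k)). The mean of |Re g|^p over the circle
    of radius r is at most a constant times (1 - r^2)^(p (1 - p)), and 1 - r^2
    grows geometrically when r is replaced by r^2, as long as r > 1/2. Hence
    the means of |Re f|^p are bounded for every p < 1 and for all signs at
    once (dyadic_pmean_bounded). On the other hand |g w| is at least 1/4 when
    1/2 <= |w| < 1, so on the circle where |z|^(2^n) = 1/2 the first n terms
    of f have square sum at least n / 16, and averaging over the signs
    (sign_avg_powR_ge) shows that some choice of the signs makes the mean of
    |f|^q large, however small q is. Terms beyond the n-th contribute at most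
    4 there, so signs can be chosen in successive blocks which make the mean
    of |f|^(1 / (j + 2)) at least j on some circle, for every j
    (unbounded_signs). As Re f is in every h^p, its conjugate can be in no h^q
    (conj_in_no_hp_nonempty). *)

Set Implicit Arguments.
Unset Strict Implicit.
Unset Printing Implicit Defensive.

Import Order.TTheory GRing.Theory Num.Theory.
Import numFieldNormedType.Exports.
Import Normc.

Local Open Scope classical_set_scope.
Local Open Scope ring_scope.

(** * Complex modulus and dominated complex series *)

Section complex_modulus.
Context {R : realType}.
Implicit Types (z w : R[i]) (x y : R).

Lemma normc_ge0 z : 0 <= normc z.
Proof. by case: z => a b; exact: sqrtr_ge0. Qed.

Lemma normcD z w : normc (z + w) <= normc z + normc w.
Proof. exact: le_normcD. Qed.

Lemma normcNE z : normc (- z) = normc z.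
Proof. exact: normcN. Qed.

Lemma normc_dist z w : normc (z - w) = normc (w - z).
Proof. by rewrite -normcNE opprB. Qed.

Lemma normcX z n : normc (z ^+ n) = normc z ^+ n.
Proof.
elim: n => [|n IH]; first by rewrite !expr0 (normc1 R).
by rewrite !exprS normcM IH.
Qed.

Lemma normc_real x : normc (Complex x 0) = `|x|.
Proof. by rewrite /= expr0n addr0 sqrtr_sqr. Qed.

Lemma normc_nat n : normc (n%:R : R[i]) = n%:R.
Proof.
have -> : (n%:R : R[i]) = Complex n%:R 0.
  exact: (esym (rmorph_nat (real_complex R) n)).
by rewrite normc_real normr_nat.
Qed.

Lemma le_Re_normc z : `|complex.Re z| <= normc z.
Proof. by case: z => a b; rewrite -sqrtr_sqr ler_wsqrtr//= lerDl sqr_ge0. Qed.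

Lemma le_Im_normc z : `|complex.Im z| <= normc z.
Proof. by case: z => a b; rewrite -sqrtr_sqr ler_wsqrtr//= lerDr sqr_ge0. Qed.

Lemma normc_sqr z :
  normc z ^+ 2 = complex.Re z ^+ 2 + complex.Im z ^+ 2.
Proof. by case: z => a b; rewrite sqr_sqrtr// addr_ge0 ?sqr_ge0. Qed.

Lemma normc_le_ReIm z : normc z <= `|complex.Re z| + `|complex.Im z|.
Proof.
rewrite -(@ler_pXn2r _ 2) ?nnegrE ?normc_ge0 ?addr_ge0//.
rewrite normc_sqr sqrrD !real_normK ?num_real//.
by rewrite lerD2r lerDl mulrn_wge0 ?mulr_ge0.
Qed.

Lemma normr_normcE z : `|z| = Complex (normc z) 0.
Proof. by rewrite normc_def; case: z. Qed.

Lemma discE z : disc z = (normc z < 1) :> Prop.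
Proof. by rewrite /disc /= normr_normcE -[1]/(Complex 1 0) ltcR. Qed.

End complex_modulus.

Section complex_series.
Context {R : realType}.
Implicit Types (a b c : nat -> R[i]) (s M : R) (z : R[i]).

(** The real and imaginary parts are summed separately, which reduces
    convergence to that of real series. *)
Definition csum a : R[i] :=
  Complex (limn (series (fun n => complex.Re (a n))))
          (limn (series (fun n => complex.Im (a n)))).

Lemma Re_sum (I : Type) (r : seq I) (F : I -> R[i]) :
  complex.Re (\sum_(i <- r) F i) = \sum_(i <- r) complex.Re (F i).
Proof. by elim/big_rec2: _ => // i x z _ <-; case: (F i) => ? ?; case: z. Qed.

Lemma Im_sum (I : Type) (r : seq I) (F : I -> R[i]) :
  complex.Im (\sum_(i <- r) F i) = \sum_(i <- r) complex.Im (F i).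
Proof. by elim/big_rec2: _ => // i x z _ <-; case: (F i) => ? ?; case: z. Qed.

Lemma geo_cvg0 M s : 0 <= s < 1 -> M * s ^+ n @[n --> \oo] --> 0.
Proof. by case/andP=> s0 s1; apply: (@cvg_geometric _ M s); rewrite ger0_norm. Qed.

Lemma cvg_geo (u : nat -> R) (l : R) M s : 0 <= s < 1 ->
  (forall n, `|l - u n| <= M * s ^+ n) -> u n @[n --> \oo] --> l.
Proof.
move=> s01 H; apply/cvgrPdist_le => e e0.
have /cvgrPdist_le /(_ e e0) := geo_cvg0 M s01.
apply: filterS => n /=; rewrite sub0r normrN.
by apply: le_trans; rewrite (le_trans (H n))// ler_norm.
Qed.

(** Sums are identified by a geometric bound on their remainders; no limit
    of partial sums has to be handled afterwards. *)
Lemma csum_unique a z M s : 0 <= s < 1 ->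
  (forall n, normc (z - \sum_(i < n) a i) <= M * s ^+ n) -> csum a = z.
Proof.
move=> s01 H; rewrite [z]complexE /csum.
have -> : forall x y : R, (Complex x 0 + Complex 0 1 * Complex y 0) = Complex x y.
  by move=> x y; simpc.
congr Complex; apply: cvg_lim => //; apply: (@cvg_geo _ _ M s) => // n;
  rewrite /series/= big_mkord.
- rewrite -Re_sum -[X in `|X|]/(complex.Re z - complex.Re (\sum_(i < n) a i)).
  have -> x y : complex.Re x - complex.Re y = complex.Re (x - y) :> R.
    by case: x; case: y.
  exact: le_trans (le_Re_normc _) (H n).
- rewrite -Im_sum.
  have -> x y : complex.Im x - complex.Im y = complex.Im (x - y) :> R.
    by case: x; case: y.
  exact: le_trans (le_Im_normc _) (H n).
Qed.
End complex_series.

Section dominated_series.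
Context {R : realType}.
Implicit Types (a b c : nat -> R[i]) (s M : R) (z : R[i]).

Lemma sum_geo_le s N n : 0 <= s < 1 ->
  \sum_(i < n) s ^+ (N + i) <= s ^+ N / (1 - s).
Proof.
case/andP=> s0 s1; have h : 0 < 1 - s by rewrite subr_gt0.
under eq_bigr do rewrite exprD.
rewrite -mulr_sumr ler_wpM2l ?exprn_ge0// -[leRHS]mul1r ler_pdivlMr// mulrC.
by rewrite -[1 - s]opprB mulNr -subrX1 opprB gerBl exprn_ge0.
Qed.

Lemma real_series_geo (u : nat -> R) M s : 0 <= s < 1 ->
  (forall n, `|u n| <= M * s ^+ n) ->
  cvgn (series u) /\
  forall N, `|limn (series u) - \sum_(i < N) u i| <= M / (1 - s) * s ^+ N.
Proof.
move=> /andP[s0 s1] H; have s01 : 0 <= s < 1 by rewrite s0.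
have M0 : 0 <= M by have := le_trans (normr_ge0 _) (H 0%N); rewrite mulr1.
have cu : cvgn (series u).
  apply: normed_cvg; apply: (@series_le_cvg _ _ (geometric M s)).
  - by move=> n /=.
  - by move=> n /=; rewrite mulr_ge0 ?exprn_ge0.
  - exact: H.
  - by apply: is_cvg_geometric_series; rewrite ger0_norm.
split => // N.
have cN : `|series u n - \sum_(i < N) u i| @[n --> \oo] -->
    `|limn (series u) - \sum_(i < N) u i|.
  by apply: cvg_norm; apply: cvgB => //; exact: cvg_cst.
rewrite -(cvg_lim _ cN)//; apply: limr_le; first exact: cvgP cN.
exists N => // n /= Nn.
have -> : \sum_(i < N) u i = series u N by rewrite /series/= big_mkord.
rewrite sub_series_geq//; apply: (le_trans (ler_norm_sum _ _ _)).
apply: (@le_trans _ _ (\sum_(N <= k < n) M * s ^+ k)).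
  by apply: ler_sum => i _; exact: H.
rewrite -mulr_sumr -mulrA ler_wpM2l// [_^-1 * _]mulrC.
rewrite -{1}[N]add0n big_addn big_mkord.
under eq_bigr do rewrite addnC.
exact: sum_geo_le.
Qed.

Definition geo a M s := (0 <= s < 1) /\ forall n, normc (a n) <= M * s ^+ n.

Lemma geo_ge0 a M s : geo a M s -> 0 <= M.
Proof. by case=> _ /(_ 0%N); rewrite mulr1; exact/le_trans/normc_ge0. Qed.

(** The factor 2 comes from estimating the real and imaginary parts
    separately. *)
Lemma csum_tail a M s N : geo a M s ->
  normc (csum a - \sum_(i < N) a i) <= 2 * M / (1 - s) * s ^+ N.
Proof.
case=> s01 H.
have [_ HR] := @real_series_geo (fun n => complex.Re (a n)) M s s01
  (fun n => le_trans (le_Re_normc _) (H n)).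
have [_ HI] := @real_series_geo (fun n => complex.Im (a n)) M s s01
  (fun n => le_trans (le_Im_normc _) (H n)).
apply: (le_trans (normc_le_ReIm _)).
have -> : 2 * M / (1 - s) * s ^+ N =
  M / (1 - s) * s ^+ N + M / (1 - s) * s ^+ N by lra.
apply: lerD.
  have -> : complex.Re (csum a - \sum_(i < N) a i) =
    complex.Re (csum a) - complex.Re (\sum_(i < N) a i) by case: (\sum_(i < N) a i).
  by rewrite Re_sum; exact: HR.
have -> : complex.Im (csum a - \sum_(i < N) a i) =
  complex.Im (csum a) - complex.Im (\sum_(i < N) a i) by case: (\sum_(i < N) a i).
by rewrite Im_sum; exact: HI.
Qed.

Lemma normc_csum a M s : geo a M s -> normc (csum a) <= 2 * M / (1 - s).
Proof. by move=> /(csum_tail 0); rewrite big_ord0 subr0 expr0 mulr1. Qed.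

Lemma geo_weaken a M s t : geo a M s -> s <= t < 1 -> geo a M t.
Proof.
move=> ga /andP[st t1]; have M0 := geo_ge0 ga.
case: ga => /andP[s0 s1] H; split; first by rewrite t1 (le_trans s0).
move=> n; apply: (le_trans (H n)); rewrite ler_wpM2l//.
by apply: lerXn2r; rewrite ?nnegrE// (le_trans s0).
Qed.

Lemma csumD a b M N s t : geo a M s -> geo b N t ->
  csum (fun n => a n + b n) = csum a + csum b.
Proof.
move=> ga gb; pose r := Num.max s t.
have [/andP[s0 s1] _] := ga; have [/andP[t0 t1] _] := gb.
have r1 : r < 1 by rewrite /r gt_max s1 t1.
have ga' : geo a M r by apply: geo_weaken ga _; rewrite r1 /r le_max lexx.
have gb' : geo b N r by apply: geo_weaken gb _; rewrite r1 /r le_max lexx orbT.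
apply: (@csum_unique _ _ _ (2 * M / (1 - r) + 2 * N / (1 - r)) r).
  by rewrite r1 /r le_max s0.
move=> n; rewrite big_split /= opprD addrACA mulrDl.
by apply: (le_trans (normcD _ _)); apply: lerD; apply: csum_tail.
Qed.

Lemma csumZ a M s z : geo a M s -> csum (fun n => z * a n) = z * csum a.
Proof.
move=> ga; apply: (@csum_unique _ _ _ (normc z * (2 * M / (1 - s))) s).
  by case: ga.
move=> n; rewrite -mulr_sumr -mulrBr normcM -[leRHS]mulrA ler_wpM2l ?normc_ge0//.
exact: csum_tail.
Qed.

Lemma geoZ a M s z : geo a M s -> geo (fun n => z * a n) (normc z * M) s.
Proof.
case=> s01 H; split => // n.
by rewrite normcM -mulrA ler_wpM2l ?normc_ge0.
Qed.

Lemma geoD a b M N s : geo a M s -> geo b N s ->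
  geo (fun n => a n + b n) (M + N) s.
Proof.
case=> s01 H [_ K]; split => // n.
by apply: (le_trans (normcD _ _)); rewrite mulrDl lerD.
Qed.

Lemma csum_recl a M s : geo a M s -> csum a = a 0%N + csum (fun n => a n.+1).
Proof.
move=> ga; have M0 := geo_ge0 ga; have [s01 _] := ga; have /andP[s0 s1] := s01.
suff -> : csum (fun n => a n.+1) = csum a - a 0%N by rewrite addrC subrK.
apply: (@csum_unique _ _ _ (2 * M / (1 - s)) s) => // n.
have := csum_tail n.+1 ga; rewrite big_ord_recl/= opprD addrA.
move/le_trans; apply; rewrite ler_wpM2l//; last first.
  by rewrite exprS ler_piMl ?exprn_ge0// ltW.
by rewrite !mulr_ge0// invr_ge0 subr_ge0 ltW.
Qed.

End dominated_series.

(** * Power series *)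

Section power_series.
Context {R : realType}.
Implicit Types (c : nat -> R[i]) (r s M : R) (z w h : R[i]) (n : nat).

(** A lower bound r for the radius of convergence, expressed by the
    boundedness of the terms. *)
Definition ps r c :=
  forall s, 0 <= s < r -> exists M, forall n, normc (c n) * s ^+ n <= M.

Definition psum c z := csum (fun n => c n * z ^+ n).

Lemma eq_psum c d z : c =1 d -> psum c z = psum d z.
Proof. by move=> /funext ->. Qed.

(** Comparison with a radius t strictly between s and r, which makes the
    domination uniform on the closed disc of radius s. *)
Lemma ps_geo r c s : 0 <= s < r -> ps r c ->
  exists M t, forall z, normc z <= s -> geo (fun n => c n * z ^+ n) M t.
Proof.
case/andP=> s0 sr pc; pose t := (s + r) / 2.
have st : s < t by rewrite /t; lra.
have tr : t < r by rewrite /t; lra.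
have t0 : 0 < t by apply: le_lt_trans st.
have [|M HM] := pc t; first by rewrite tr (ltW t0).
exists M, (s / t) => z zs; split.
  by rewrite divr_ge0 ?(ltW t0)//= ltr_pdivrMr ?mul1r.
move=> n; rewrite normcM normcX.
apply: (@le_trans _ _ (normc (c n) * s ^+ n)).
  by rewrite ler_wpM2l ?normc_ge0// lerXn2r ?nnegrE ?normc_ge0.
have -> : s ^+ n = t ^+ n * (s / t) ^+ n.
  by rewrite -exprMn mulrC divfK ?gt_eqF.
by rewrite mulrA ler_wpM2r ?HM// exprn_ge0// divr_ge0// ltW.
Qed.

(** With s = t x and s < t < r, the bound n x^n <= 1 + x + ... + x^(n - 1)
    lets the gap between s and t absorb the factor n. *)
Lemma ps_muln r c : ps r c -> ps r (fun n => n%:R * c n).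
Proof.
move=> pc s /andP[s0 sr]; pose t := (s + r) / 2.
have st : s < t by rewrite /t; lra.
have tr : t < r by rewrite /t; lra.
have t0 : 0 < t by apply: le_lt_trans st.
have [|M HM] := pc t; first by rewrite tr (ltW t0).
have M0 : 0 <= M by apply: le_trans (HM 0%N); rewrite mulr1 normc_ge0.
pose x := s / t; have x0 : 0 <= x by rewrite divr_ge0// ltW.
have x1 : x < 1 by rewrite ltr_pdivrMr ?mul1r.
exists (M / (1 - x)) => n.
have nx : n%:R * x ^+ n <= (1 - x)^-1.
  apply: (@le_trans _ _ (\sum_(i < n) x ^+ (0 + i))).
    rewrite -[in leLHS](card_ord n) mulr_natl -sumr_const; apply: ler_sum => i _.
    rewrite add0n; apply: ler_wiXn2l; [exact: x0|exact: ltW|].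
    by rewrite card_ord ltnW.
  apply: le_trans (@sum_geo_le _ x 0 n _) _; first by rewrite x0.
  by rewrite expr0 mul1r.
rewrite normcM normc_nat (_ : s = t * x); last first.
  by rewrite mulrC divfK ?gt_eqF.
rewrite exprMn mulrCA mulrA [leLHS](_ : _ = normc (c n) * t ^+ n * (n%:R * x ^+ n)).
  by apply: ler_pM; rewrite ?mulr_ge0 ?exprn_ge0 ?normc_ge0 ?(ltW t0).
ring.
Qed.

Lemma psD r c d : ps r c -> ps r d -> ps r (fun n => c n + d n).
Proof.
move=> pc pd s /[dup] /pc [M HM] /[dup] /andP[s0 _] /pd [N HN].
exists (M + N) => n; apply: le_trans (lerD (HM n) (HN n)).
by rewrite -mulrDl ler_wpM2r ?exprn_ge0 ?normcD.
Qed.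

Lemma psZ r z c : ps r c -> ps r (fun n => z * c n).
Proof.
move=> pc s /[dup] /andP[s0 _] /pc [M HM]; exists (normc z * M) => n.
by rewrite normcM -mulrA ler_wpM2l ?normc_ge0.
Qed.

Lemma ps_shift r c : ps r c -> ps r (fun n => c n.+1).
Proof.
move=> pc s /andP[s0 sr]; pose t := (s + r) / 2.
have st : s < t by rewrite /t; lra.
have tr : t < r by rewrite /t; lra.
have t0 : 0 < t by apply: le_lt_trans st.
have [|M HM] := pc t; first by rewrite tr (ltW t0).
exists (M / t) => n; rewrite ler_pdivlMr//; apply: le_trans (HM n.+1).
rewrite -mulrA ler_wpM2l ?normc_ge0// exprSr ler_wpM2r ?(ltW t0)//.
by apply: lerXn2r; rewrite ?nnegrE ?(ltW st) ?(ltW t0).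
Qed.

Lemma psum_linear r (a b : R[i]) c d z : ps r c -> ps r d -> normc z < r ->
  psum (fun n => a * c n + b * d n) z = a * psum c z + b * psum d z.
Proof.
move=> pc pd zr; have zr' : 0 <= normc z < r by rewrite normc_ge0.
have [M [s /(_ z (lexx _)) gc]] := ps_geo zr' pc.
have [N [t /(_ z (lexx _)) gd]] := ps_geo zr' pd.
rewrite /psum -(csumZ _ gc) -(csumZ _ gd) -(csumD (geoZ a gc) (geoZ b gd)).
by congr csum; apply/funext => n; ring.
Qed.

Lemma psumB r c d z : ps r c -> ps r d -> normc z < r ->
  psum (fun n => c n - d n) z = psum c z - psum d z.
Proof.
move=> pc pd zr; have := psum_linear 1 (-1) pc pd zr; rewrite mul1r mulN1r => <-.
by apply: eq_psum => n; ring.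
Qed.

Lemma psum0E c : psum c 0 = c 0%N.
Proof.
apply: (@csum_unique _ _ _ (normc (c 0%N)) 0); first by rewrite lexx ltr01.
case=> [|n]; first by rewrite big_ord0 subr0 expr0 mulr1.
rewrite big_ord_recl/= expr0 mulr1 opprD addrA subrr sub0r.
rewrite big1 ?oppr0 ?normc0 ?mulr_ge0 ?normc_ge0 ?exprn_ge0//.
by move=> i _; rewrite expr0n/= mulr0.
Qed.

Definition psderiv c n := n.+1%:R * c n.+1.

Lemma ps_psderiv r c : ps r c -> ps r (psderiv c).
Proof. by move=> /ps_muln/ps_shift. Qed.

(** Induction on n, expanding one factor z + h at a time. The factor s ^+ 2
    on the left avoids the exponent n - 2. *)
Lemma pow_taylor z h s n : 0 < s -> normc z <= s -> normc (z + h) <= s ->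
  normc ((z + h) ^+ n - z ^+ n - n%:R * z ^+ n.-1 * h) * s ^+ 2 <=
  n%:R ^+ 2 * s ^+ n * normc h ^+ 2.
Proof.
move=> s0 zs zhs; elim: n => [|n IH].
  by rewrite !expr0 subrr !mul0r subrr normc0 mul0r expr0n !mul0r.
have -> : (z + h) ^+ n.+1 - z ^+ n.+1 - n.+1%:R * z ^+ n.+1.-1 * h =
  (z + h) * ((z + h) ^+ n - z ^+ n - n%:R * z ^+ n.-1 * h) +
  n%:R * z ^+ n.-1 * h ^+ 2.
  case: n {IH} => [|n]; first by rewrite /= !expr1 !expr0; ring.
  by rewrite /= -[n.+2%:R]natr1 !exprS; ring.
apply: (@le_trans _ _ (s * (n%:R ^+ 2 * s ^+ n * normc h ^+ 2) +
   n%:R * s ^+ n.+1 * normc h ^+ 2)).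
  apply: le_trans (ler_wpM2r _ (normcD _ _)) _; first by rewrite exprn_ge0// ltW.
  rewrite mulrDl; apply: lerD.
    rewrite normcM -[leLHS]mulrA; apply: ler_pM => //; first exact: normc_ge0.
    by rewrite mulr_ge0 ?normc_ge0// exprn_ge0// ltW.
  rewrite !normcM normc_nat !normcX mulrAC.
  rewrite ler_wpM2r ?mulr_ge0 ?normc_ge0// -!mulrA.
  case: n {IH} => [|n]; first by rewrite !mul0r.
  rewrite ler_wpM2l// -[n.+1.-1]/n -[n.+2]addn2 exprD ler_wpM2r ?mulr_ge0 ?(ltW s0)//.
  by apply: lerXn2r; rewrite ?nnegrE ?normc_ge0 ?(ltW s0).
rewrite -natr1 (exprS s n).
have P : 0 <= s * s ^+ n * normc h ^+ 2 * (n%:R + 1).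
  by rewrite !mulr_ge0 ?exprn_ge0 ?normc_ge0 ?(ltW s0)// natr1.
rewrite -subr_ge0; apply: le_trans P _; rewrite le_eqVlt; apply/orP; left.
by apply/eqP; ring.
Qed.

End power_series.

(** * Complex derivatives and their real counterparts *)

Section complex_derivative.
Context {R : realType}.
Implicit Types (c : nat -> R[i]) (r s M : R) (z w h d : R[i]) (f : R[i] -> R[i]).

(** A derivative with an error of order 2, which power series satisfy and
    which passes to real parts and to every other notion of derivative by
    inequalities alone. *)
Definition qderiv f z d := exists M, exists2 e, 0 < e &
  forall h, normc h < e ->
    normc (f (z + h) - f z - h * d) <= M * normc h ^+ 2.

(** Sum of the remainders of pow_taylor against the coefficients: the
    factor n^2 does not change the radius of convergence. *)
Lemma psum_qderiv r c z : ps r c -> normc z < r ->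
  qderiv (psum c) z (psum (psderiv c) z).
Proof.
move=> pc zr; pose s := (normc z + r) / 2.
have zs : normc z < s by rewrite /s; lra.
have sr : s < r by rewrite /s; lra.
have s0 : 0 < s by apply: le_lt_trans zs; exact: normc_ge0.
have s0r : 0 <= s < r by rewrite sr ltW.
have [M1 [t1 G1]] := ps_geo s0r pc.
have [M2 [t2 G2]] := ps_geo s0r (ps_muln (ps_muln pc)).
have [M3 [t3 G3]] := ps_geo s0r (ps_muln pc).
have ns : normc (Complex s 0) = s by rewrite normc_real gtr0_norm.
exists (2 * (M2 / s ^+ 2) / (1 - t2)), (s - normc z).
  by rewrite subr_gt0.
move=> h hs.
have zhs : normc (z + h) <= s.
  by apply: le_trans (normcD _ _) _; move: (normc h) (normc z) hs => x y; lra.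
pose a n := c n * ((z + h) ^+ n - z ^+ n - n%:R * z ^+ n.-1 * h).
pose b n := n%:R * c n * z ^+ n.-1 * h.
have ga : geo a (M2 / s ^+ 2 * normc h ^+ 2) t2.
  have [|t21 H] := G2 (Complex s 0); first by rewrite ns.
  split => // n; have := H n; rewrite normcM normcX ns 2!normcM normc_nat => Hn.
  have := pow_taylor n s0 (ltW zs) zhs.
  rewrite -ler_pdivlMr ?exprn_gt0// => Hp.
  rewrite /a normcM; apply: (le_trans (ler_wpM2l (normc_ge0 _) Hp)).
  have -> : normc (c n) * (n%:R ^+ 2 * s ^+ n * normc h ^+ 2 / s ^+ 2) =
    n%:R * (n%:R * normc (c n)) * s ^+ n * (normc h ^+ 2 / s ^+ 2) by ring.
  have -> : M2 / s ^+ 2 * normc h ^+ 2 * t2 ^+ n =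
     M2 * t2 ^+ n * (normc h ^+ 2 / s ^+ 2) by ring.
  by rewrite ler_wpM2r// divr_ge0 ?exprn_ge0 ?normc_ge0 ?(ltW s0).
have gb : geo b (M3 / s * normc h) t3.
  have [|t31 H] := G3 (Complex s 0); first by rewrite ns.
  split => // n; have := H n; rewrite normcM normcX ns normcM normc_nat => Hn.
  rewrite /b !normcM normcX normc_nat.
  have -> : M3 / s * normc h * t3 ^+ n = M3 * t3 ^+ n / s * normc h by ring.
  rewrite ler_wpM2r ?normc_ge0// ler_pdivlMr//; apply: le_trans Hn.
  case: n => [|n]; first by rewrite !mul0r.
  rewrite -[leLHS]mulrA ler_wpM2l ?mulr_ge0 ?normc_ge0// exprSr ler_wpM2r ?(ltW s0)//.
  by apply: lerXn2r; rewrite ?nnegrE ?normc_ge0 ?(ltW s0) ?(ltW zs).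
have E : psum c (z + h) - psum c z - h * psum (psderiv c) z = csum a.
  have E1 : h * psum (psderiv c) z = csum b.
    have [M4 [t4 G4]] := ps_geo s0r (ps_psderiv pc).
    rewrite (csum_recl gb) {1}/b !mul0r add0r /psum -(csumZ h (G4 z (ltW zs))).
    by congr csum; apply/funext => n; rewrite /b /psderiv /=; ring.
  have gz := G1 z (ltW zs); have gzh := G1 _ zhs.
  rewrite E1; apply/eqP; rewrite subr_eq subr_eq; apply/eqP.
  have [/andP[t10 t11] _] := gz; have [/andP[t20 t21] _] := ga.
  have [/andP[t30 t31] _] := gb; pose t := Num.max t2 t3.
  have t1' : t < 1 by rewrite /t gt_max t21 t31.
  have ga' : geo a (M2 / s ^+ 2 * normc h ^+ 2) t.
    by apply: geo_weaken ga _; rewrite t1' /t le_max lexx.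
  have gb' : geo b (M3 / s * normc h) t.
    by apply: geo_weaken gb _; rewrite t1' /t le_max lexx orbT.
  rewrite -(csumD ga' gb') -(csumD (geoD ga' gb') gz); congr csum.
  by apply/funext => n; rewrite /a /b; ring.
rewrite E; apply: le_trans (normc_csum ga) _.
by rewrite le_eqVlt; apply/orP; left; apply/eqP; ring.
Qed.

Implicit Types (U V : R * R -> R) (a : R * R) (p q : R).

(** The analogue of qderiv for real functions on the plane, with candidates
    p and q for the partial derivatives. *)
Definition rdiff U a p q := exists M, exists2 e, 0 < e &
  forall k : R * R, `|k| < e ->
    `|U (k + a) - U a - (k.1 * p + k.2 * q)| <= M * `|k| ^+ 2.

Lemma rdiff_near U V a p q : (\forall b \near a, U b = V b) ->
  rdiff U a p q -> rdiff V a p q.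
Proof.
move=> UV [M [e e0 H]]; have UVa := nbhs_singleton UV.
move/nbhs_ballP: UV => [d /= d0 UV].
exists M, (Num.min d e) => [|k]; first by rewrite lt_min d0.
rewrite lt_min => /andP[kd ke]; rewrite -UVa -UV; first exact: H.
by rewrite -ball_normE /= opprD addrCA subrr addr0 normrN.
Qed.

Let lin p q (k : R * R) : R := k.1 * p + k.2 * q.
Let lin_linear p q : linear (lin p q).
Proof. by move=> x [k1 k2] [l1 l2]; rewrite /lin /= /GRing.scale /=; ring. Qed.

Lemma rdiff_is_diff U a p q : rdiff U a p q ->
  differentiable U a /\ forall k, 'd U a k = k.1 * p + k.2 * q.
Proof.
move=> [M [e e0 H]].
pose pl := GRing.isLinear.Build _ _ _ _ _ (lin_linear p q).
pose L : {linear (R * R)%type -> R} := HB.pack (lin p q) pl.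
have cL : continuous L.
  move=> k; rewrite /L /= /lin.
  apply: (@cvgD _ _ _ _ _ (fun k : R * R => k.1 * p) (fun k : R * R => k.2 * q));
  by apply: cvgM; [exact: cvg_fst || exact: cvg_snd|exact: cvg_cst].
have HU eps : 0 < eps -> \forall k \near (0 : (R * R)%type),
    `|U (k + a) - (U a + L k)| <= eps * `|k|.
  move=> eps0; apply/nbhs_ballP.
  have M1 : 0 < `|M| + 1 by rewrite ltr_wpDl.
  exists (Num.min e (eps / (`|M| + 1))) => /=.
    by rewrite lt_min e0 divr_gt0.
  move=> k; rewrite -ball_normE /= sub0r normrN lt_min => /andP[ke kM].
  rewrite opprD addrA; apply: le_trans (H k ke) _.
  rewrite expr2 mulrA ler_wpM2r//.
  apply: (@le_trans _ _ ((`|M| + 1) * `|k|)).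
    by rewrite ler_wpM2r// (le_trans (ler_norm _))// lerDl.
  by move: kM; rewrite ltr_pdivlMr// mulrC => /ltW.
have E : 'd U a = L :> (R * R -> R).
  by apply: diff_unique => //; apply/eqaddoP => eps /HU.
split; last by move=> k; rewrite E.
apply/diff_locallyP; rewrite E; split => //.
by apply/eqaddoP => eps /HU.
Qed.

Lemma rdiff_derive U a p q : rdiff U a p q ->
  [/\ differentiable U a, 'D_(1, 0) U a = p & 'D_(0, 1) U a = q].
Proof.
move=> /rdiff_is_diff [dU E]; split => //; rewrite deriveE// E /=; ring.
Qed.

Definition cpt a : R[i] := Complex a.1 a.2.

Lemma normc_cpt a : normc (cpt a) <= 2 * `|a|.
Proof.
apply: le_trans (normc_le_ReIm _) _; rewrite /cpt /=.
have -> : 2 * `|a| = `|a| + `|a| by ring.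
by apply: lerD; rewrite /Num.norm/= le_max lexx ?orbT.
Qed.

(** The Cauchy-Riemann equations: the real part of (k.1 + i k.2) d is
    k.1 Re d - k.2 Im d. *)
Lemma qderiv_rdiff f a d : qderiv f (cpt a) d ->
  rdiff (plane (fun z => complex.Re (f z))) a (complex.Re d) (- complex.Im d).
Proof.
move=> [M [e e0 H]]; exists (4 * `|M|), (e / 2); first by rewrite divr_gt0.
move=> k ke; have ck := normc_cpt k.
have cke : normc (cpt k) < e.
  by apply: le_lt_trans ck _; rewrite mulrC -ltr_pdivlMr.
have := H _ cke; have -> : cpt a + cpt k = cpt (k + a).
  by rewrite /cpt addrC.
move=> Hk; rewrite /plane -/(cpt _) -/(cpt a).
have -> : complex.Re (f (cpt (k + a))) - complex.Re (f (cpt a)) -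
   (k.1 * complex.Re d + k.2 * - complex.Im d) =
   complex.Re (f (cpt (k + a)) - f (cpt a) - cpt k * d).
  by case: (f _) => ? ?; case: (f _) => ? ?; case: d {H Hk} => ? ? /=; ring.
apply: le_trans (le_Re_normc _) (le_trans Hk _).
apply: (@le_trans _ _ (`|M| * normc (cpt k) ^+ 2)).
  by rewrite ler_wpM2r ?exprn_ge0 ?normc_ge0 ?ler_norm.
have -> : 4 * `|M| * `|k| ^+ 2 = `|M| * (2 * `|k|) ^+ 2 by ring.
by rewrite ler_wpM2l// lerXn2r ?nnegrE ?normc_ge0 ?mulr_ge0.
Qed.

End complex_derivative.
Arguments cpt : simpl never.
Arguments normc : simpl never.

(** * Power series give harmonic functions and their conjugates *)

Section harmonic_power_series.
Context {R : realType}.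
Implicit Types (c : nat -> R[i]) (z d : R[i]) (U : R * R -> R) (a b : R * R).

(** The value 0 outside the disc agrees with the representation of harmonic
    functions on the disc. *)
Definition reps c : R[i] -> R :=
  fun z => if normc z < 1 then complex.Re (psum c z) else 0.

Lemma repsE c z : normc z < 1 -> reps c z = complex.Re (psum c z).
Proof. by rewrite /reps => ->. Qed.

Lemma psum_Z (r : R) (x : R[i]) c z : ps r c -> normc z < r ->
  psum (fun n => x * c n) z = x * psum c z.
Proof.
move=> pc z1; rewrite -[RHS]addr0 -[X in _ + X](mul0r (psum c z)).
rewrite -(psum_linear x 0 pc pc z1).
by apply: eq_psum => n; rewrite mul0r addr0.
Qed.

Definition ii : R[i] := Complex 0 1.

Lemma Re_ii z : complex.Re (ii * z) = - complex.Im z.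
Proof. by case: z => x y /=; ring. Qed.

Lemma near_disc a (r : R) : normc (cpt a) < r ->
  \forall b \near a, normc (cpt b) < r.
Proof.
move=> ar; apply/nbhs_ballP; exists ((r - normc (cpt a)) / 2) => /=.
  by rewrite divr_gt0// subr_gt0.
move=> b; rewrite -ball_normE /= ltr_pdivlMr// => ab.
have -> : cpt b = cpt a + cpt (b - a).
  by apply/eqP; rewrite eq_complex /= ![in X in _ + X]/= !subrKC !eqxx.
apply: le_lt_trans (normcD _ _) _; rewrite -ltrBrDl.
apply: le_lt_trans (normc_cpt _) _.
by rewrite distrC mulrC.
Qed.

Let D : set (R * R) := [set a | disc (Complex a.1 a.2)].

Let DE a : D a = (normc (cpt a) < 1).
Proof. exact: discE. Qed.

(** Both partial derivatives of Re F are again real parts of power series,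
    of F' and of i F'. Applying this to the derivatives in turn gives the
    second order statements. *)
Lemma psum_C1 U c : ps 1 c ->
  (forall a, D a -> U a = complex.Re (psum c (cpt a))) ->
  [/\ C1_on D U,
      forall a, D a -> 'D_(1, 0) U a = complex.Re (psum (psderiv c) (cpt a)) &
      forall a, D a -> 'D_(0, 1) U a =
        complex.Re (psum (fun n => ii * psderiv c n) (cpt a))].
Proof.
have key V e : ps 1 e ->
    (forall a, D a -> V a = complex.Re (psum e (cpt a))) -> forall a, D a ->
    rdiff V a (complex.Re (psum (psderiv e) (cpt a)))
      (- complex.Im (psum (psderiv e) (cpt a))).
  move=> pe Ve a; rewrite DE => Da.
  have := qderiv_rdiff (psum_qderiv pe Da); apply: rdiff_near.
  apply: filterS (near_disc Da) => b bD.
  by rewrite Ve ?DE.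
move=> pc Uc; have pd := ps_psderiv pc; have pi := psZ ii pd.
have D1 a : D a -> 'D_(1, 0) U a = complex.Re (psum (psderiv c) (cpt a)).
  by move=> Da; have [] := rdiff_derive (key _ _ pc Uc a Da).
have D2 a : D a -> 'D_(0, 1) U a =
    complex.Re (psum (fun n => ii * psderiv c n) (cpt a)).
  move=> Da; have [_ _ ->] := rdiff_derive (key _ _ pc Uc a Da).
  by rewrite (psum_Z ii pd) -?DE// Re_ii.
split => // a Da; split.
- by have [] := rdiff_derive (key _ _ pc Uc a Da).
- have [dU _ _] := rdiff_derive (key _ _ pd D1 a Da).
  exact: differentiable_continuous dU.
- have [dU _ _] := rdiff_derive (key _ _ pi D2 a Da).
  exact: differentiable_continuous dU.
Qed.

(** The Laplacian of Re F is the real part of (1 + i^2) F''. *)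
Lemma reps_harmonic c : ps 1 c -> harmonic_disc (reps c).
Proof.
move=> pc; split; last first.
  by move=> z; rewrite discE /reps => /negP/negbTE ->.
have pd := ps_psderiv pc; have pdd := ps_psderiv pd.
have E a : D a -> plane (reps c) a = complex.Re (psum c (cpt a)).
  by rewrite DE => Da; rewrite /plane repsE.
have [C0 D1 D2] := psum_C1 pc E.
have [C1 D11 _] := psum_C1 pd D1.
have [C2 _ D22] := psum_C1 (psZ ii pd) D2.
split; [exact: C0|exact: C1|exact: C2|].
move=> a Da; apply: (etrans (congr2 +%R (D11 a Da) (D22 a Da))).
have -> : psum (fun n => ii * psderiv (fun n => ii * psderiv c n) n) (cpt a) =
   psum (fun n => (- 1) * psderiv (psderiv c) n) (cpt a).
  apply: eq_psum => n; rewrite /psderiv.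
  have -> : ii * (n.+1%:R * (ii * (n.+2%:R * c n.+2))) =
    (ii * ii) * (n.+1%:R * (n.+2%:R * c n.+2)) by ring.
  by congr (_ * _); rewrite /ii; apply/eqP; rewrite eq_complex /=; apply/andP; split; apply/eqP; ring.
rewrite (psum_Z _ pdd) -?DE//.
by case: (psum _ _) => x y /=; ring.
Qed.

Lemma qderiv_derivable (f : R[i]^o -> R[i]^o) (z : R[i]) d : qderiv f z d ->
  derivable f z 1.
Proof.
move=> [M [e e0 H]]; apply: (cvgP (d : R[i]^o)); apply/cvgrPdist_le => /= eps.
case: eps => [eps ieps]; rewrite ltcE /= => /andP[/eqP -> eps0].
have M1 : 0 < `|M| + 1 by rewrite ltr_wpDl.
pose dl := Num.min e (eps / (`|M| + 1)).
have dl0 : 0 < dl by rewrite /dl lt_min e0 divr_gt0.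
near=> h.
have h0 : h != 0 by near: h; exact: withinT.
have hd : normc h < dl.
  have : `|h| < Complex dl 0.
    near: h; apply: (@dnbhs0_lt R[i] R[i]^o).
    by rewrite ltcE /= eqxx.
  by rewrite normr_normcE ltcE /= eqxx.
have := H h; move: hd; rewrite lt_min => /andP[he hM] /(_ he) Hh.
rewrite normr_normcE lecR.
have nh0 : 0 < normc h.
  by rewrite lt_neqAle normc_ge0 eq_sym andbT; apply: contra h0 => /eqP/eq0_normc ->.
have -> : d - h^-1 *: ((f \o shift z) (h *: 1) - f z) =
   - (h^-1 * (f (z + h) - f z - h * d)).
  rewrite /= /GRing.scale /= mulr1 [h + z]addrC !mulrBr mulrA mulVf// mul1r.
  by rewrite opprB; ring.
rewrite normcNE normcM normcV ler_pdivrMl//; apply: le_trans Hh _.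
rewrite expr2 mulrCA ler_wpM2l ?normc_ge0//.
apply: (@le_trans _ _ ((`|M| + 1) * normc h)).
  by rewrite ler_wpM2r ?normc_ge0// (le_trans (ler_norm _))// lerDl.
by move: hM; rewrite ltr_pdivlMr// mulrC => /ltW.
Unshelve. all: by end_near. Qed.

Lemma psum_reps c z : ps 1 c -> normc z < 1 ->
  psum c z = Complex (reps c z) (reps (fun n => - ii * c n) z).
Proof.
move=> pc z1; rewrite !repsE// (psum_Z _ pc)//; case: (psum c z) => x y /=.
by congr Complex; ring.
Qed.

(** The real part of - i F is the imaginary part of F; it vanishes at 0
    because c 0 is real. *)
Lemma reps_conjugate c : ps 1 c -> complex.Im (c 0%N) = 0 ->
  harmonic_conjugate (reps c) (reps (fun n => - ii * c n)).
Proof.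
move=> pc c0; split.
- exact/reps_harmonic/psZ.
- rewrite repsE ?normc0// psum0E mulNr.
  by rewrite -c0; case: (c 0%N) => x y /=; ring.
move=> z; rewrite discE => z1.
have := psum_qderiv pc z1 => -[M [e e0 H]].
apply: (@qderiv_derivable _ _ (psum (psderiv c) z)).
exists M, (Num.min e (1 - normc z)); first by rewrite lt_min e0 subr_gt0.
move=> h; rewrite lt_min => /andP[he hz].
have zh1 : normc (z + h) < 1.
  by apply: le_lt_trans (normcD _ _) _; rewrite -ltrBrDl.
have := H h he; rewrite (psum_reps pc z1) (psum_reps pc zh1); exact.
Qed.

End harmonic_power_series.

(** * Means over a period *)

Section mean.
Context {R : realType}.
Implicit Types (f g : R -> R) (r t x : R).

Let mu := @lebesgue_measure R.
Let I : set R := `[- pi, pi].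

Definition mean f : R :=
  (2 * pi)^-1 * \int[@lebesgue_measure R]_(t in `[- pi, pi]) f t.

Let mI : measurable (I : set (measurableTypeR R)). Proof. exact: measurable_itv. Qed.

Let ci f : continuous f -> mu.-integrable I (EFin \o f).
Proof.
move=> cf; apply: continuous_compact_integrable; first exact: segment_compact.
exact: continuous_subspaceT.
Qed.

Let c0 : 0 < (2 * pi)^-1 :> R.
Proof. by rewrite invr_gt0 mulr_gt0 ?pi_gt0. Qed.

Lemma meanD f g : continuous f -> continuous g ->
  mean (fun t => f t + g t) = mean f + mean g.
Proof. by move=> cf cg; rewrite /mean RintegralD ?mulrDr//; exact: ci. Qed.

Lemma meanB f g : continuous f -> continuous g ->
  mean (fun t => f t - g t) = mean f - mean g.
Proof. by move=> cf cg; rewrite /mean RintegralB ?mulrBr//; exact: ci. Qed.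

Lemma meanZ x f : continuous f -> mean (fun t => x * f t) = x * mean f.
Proof. by move=> cf; rewrite /mean (RintegralZl _ mI (ci cf)) mulrCA. Qed.

Lemma mean_cst x : mean (fun=> x) = x.
Proof.
rewrite /mean (Rintegral_cst _ mI).
have -> : fine (lebesgue_measure I) = pi - (- pi).
  by rewrite /I lebesgue_measure_itv/= lte_fin gtrN ?pi_gt0.
rewrite opprK.
have -> : (pi + pi = 2 * pi :> R) by ring.
by rewrite mulrCA mulVf ?mulr1// mulf_neq0// gt_eqF// pi_gt0.
Qed.

Lemma le_mean f g : continuous f -> continuous g ->
  (forall t, - pi <= t <= pi -> f t <= g t) -> mean f <= mean g.
Proof.
move=> cf cg fg; rewrite ler_pM2l//; apply: le_Rintegral => //; exact: ci.
Qed.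

Lemma mean_ge0 f : (forall t, 0 <= f t) -> 0 <= mean f.
Proof.
by move=> f0; rewrite mulr_ge0 ?(ltW c0)// Rintegral_ge0.
Qed.

Lemma le_norm_mean f : continuous f -> `|mean f| <= mean (fun t => `|f t|).
Proof.
move=> cf; rewrite normrM gtr0_norm// ler_pM2l//.
by apply: le_normr_Rintegral => //; exact: ci.
Qed.

(** The primitive is required beyond the period so that it is continuous at
    the end points. *)
Lemma mean_FTC f F : continuous f ->
  (forall t, - (2 * pi) < t < 2 * pi -> is_derive t 1 F (f t)) ->
  mean f = (2 * pi)^-1 * (F pi - F (- pi)).
Proof.
move=> cf dF; congr (_ * _); rewrite /Rintegral.
have pp := pi_gt0 R.
have dF' t : t \in `]- pi, pi[ -> is_derive t 1 F (f t).
  by rewrite in_itv/= => /andP[t1 t2]; apply: dF; apply/andP; split; lra.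
have cF t : - pi <= t <= pi -> {for t, continuous F}.
  move=> /andP[t1 t2]; apply: differentiable_continuous; apply/derivable1_diffP.
  by have [|] := dF t; first by apply/andP; split; lra.
rewrite (@continuous_FTC2 _ f F) -?EFinB//.
- by rewrite gtrN.
- exact: continuous_subspaceT.
- split; first by move=> t /dF' [].
  + by apply: cvg_at_right_filter; apply: cF; rewrite lexx ?andbT /=; lra.
  + by apply: cvg_at_left_filter; apply: cF; rewrite lexx ?andbT /=; lra.
- by move=> t /dF' [dt dE]; rewrite derive1E.
Qed.

Lemma eq_mean f g : f =1 g -> mean f = mean g.
Proof. by move=> /funext ->. Qed.

End mean.

Section complex_mean.
Context {R : realType}.
Implicit Types (f g : R -> R[i]) (z w : R[i]) (t : R).

(** Continuity of both components, which is what componentwise integration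
    uses. *)
Definition ccont f :=
  continuous (fun t => complex.Re (f t)) /\ continuous (fun t => complex.Im (f t)).

Definition cmean f : R[i] :=
  Complex (mean (fun t => complex.Re (f t))) (mean (fun t => complex.Im (f t))).

Definition cis t : R[i] := Complex (cos t) (sin t).

Lemma ccont_cst z : ccont (fun=> z).
Proof. by split; move=> t; exact: cvg_cst. Qed.

Lemma ccont_real (f : R -> R) : continuous f -> ccont (fun t => Complex (f t) 0).
Proof. by move=> cf; split => // t; exact: cvg_cst. Qed.

Lemma ccontD f g : ccont f -> ccont g -> ccont (fun t => f t + g t).
Proof.
move=> [f1 f2] [g1 g2]; split => t.
  have -> : (fun t => complex.Re (f t + g t)) =
     (fun t => complex.Re (f t) + complex.Re (g t)).
    by apply/funext => s; case: (f s) => ? ?; case: (g s).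
  by apply: cvgD; [exact: f1|exact: g1].
have -> : (fun t => complex.Im (f t + g t)) =
   (fun t => complex.Im (f t) + complex.Im (g t)).
  by apply/funext => s; case: (f s) => ? ?; case: (g s).
by apply: cvgD; [exact: f2|exact: g2].
Qed.

Lemma ccontM f g : ccont f -> ccont g -> ccont (fun t => f t * g t).
Proof.
move=> [f1 f2] [g1 g2]; split => t.
  have -> : (fun t => complex.Re (f t * g t)) =
     (fun t => complex.Re (f t) * complex.Re (g t) - complex.Im (f t) * complex.Im (g t)).
    by apply/funext => s; case: (f s) => ? ?; case: (g s).
  by apply: cvgB; apply: cvgM; (exact: f1||exact: g1||exact: f2||exact: g2).
have -> : (fun t => complex.Im (f t * g t)) =
   (fun t => complex.Re (f t) * complex.Im (g t) + complex.Im (f t) * complex.Re (g t)).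
  by apply/funext => s; case: (f s) => ? ?; case: (g s).
by apply: cvgD; apply: cvgM; (exact: f1||exact: g1||exact: f2||exact: g2).
Qed.

Lemma ccontX f n : ccont f -> ccont (fun t => f t ^+ n).
Proof.
move=> cf; elim: n => [|n IH]; first exact: ccont_cst.
have -> : (fun t => f t ^+ n.+1) = (fun t => f t * f t ^+ n).
  by apply/funext => t; rewrite exprS.
exact: ccontM.
Qed.

Lemma ccont_normc f : ccont f -> continuous (fun t => normc (f t)).
Proof.
move=> [f1 f2] t.
have -> : (fun t => normc (f t)) = (fun t => Num.sqrt
   (complex.Re (f t) * complex.Re (f t) + complex.Im (f t) * complex.Im (f t))).
  by apply/funext => s; case: (f s).
apply: (@continuous_comp _ _ _ (fun t => complex.Re (f t) * complex.Re (f t) +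
  complex.Im (f t) * complex.Im (f t)) Num.sqrt); last exact: sqrt_continuous.
by apply: cvgD; apply: cvgM; (exact: f1||exact: f2).
Qed.

Lemma ccontV f : (forall t, f t != 0) -> ccont f -> ccont (fun t => (f t)^-1).
Proof.
move=> f0 cf; have cn := ccont_normc cf; case: cf => f1 f2.
have n0 t : normc (f t) != 0.
  by apply: contra (f0 t) => /eqP/eq0_normc ->.
have E t : (f t)^-1 = Complex (complex.Re (f t) / (normc (f t) * normc (f t)))
      (- complex.Im (f t) / (normc (f t) * normc (f t))).
  have : normc (f t) * normc (f t) != 0 by rewrite mulf_neq0.
  rewrite -expr2 normc_sqr; have := f0 t; case: (f t) => x y /= xy0 nxy.
  apply: (mulIf xy0); rewrite mulVf//.
  apply/eqP; rewrite eq_complex /=; apply/andP; split; apply/eqP.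
    by rewrite /complex.Re; field.
  by rewrite /complex.Im; field.
have cV t : (normc (f s) * normc (f s))^-1 @[s --> t] --> (normc (f t) * normc (f t))^-1.
  by apply: cvgV; [rewrite mulf_neq0|apply: cvgM; exact: cn].
have -> : (fun t => (f t)^-1) = (fun t =>
    Complex (complex.Re (f t) / (normc (f t) * normc (f t)))
      (- complex.Im (f t) / (normc (f t) * normc (f t)))).
  exact/funext.
split => t /=; first by apply: cvgM; [exact: f1|exact: cV].
by apply: cvgM; [apply: cvgN; exact: f2|exact: cV].
Qed.

Lemma ccont_cis : ccont cis.
Proof. by split=> t; [exact: continuous_cos|exact: continuous_sin]. Qed.

Lemma normc_cis t : normc (cis t) = 1.
Proof. by rewrite /normc /cis cos2Dsin2 sqrtr1. Qed.

Lemma cmeanD f g : ccont f -> ccont g ->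
  cmean (fun t => f t + g t) = cmean f + cmean g.
Proof.
move=> [f1 f2] [g1 g2]; apply/eqP; rewrite eq_complex /=.
rewrite -!meanD//; apply/andP; split; apply/eqP/eq_mean => t;
  by case: (f t) => ? ?; case: (g t).
Qed.

Lemma cmeanZ z f : ccont f -> cmean (fun t => z * f t) = z * cmean f.
Proof.
case: z => x y [f1 f2]; apply/eqP; rewrite eq_complex /=.
have Z c (h : R -> R) : continuous h -> continuous (fun t => c * h t).
  by move=> ch t; apply: cvgM; [exact: cvg_cst|exact: ch].
rewrite -!meanZ// -meanD -?meanB//; try exact: Z.
by apply/andP; split; apply/eqP/eq_mean => t; case: (f t).
Qed.

Lemma cmean_conj f : ccont f -> cmean (fun t => (f t)^*%C) = ((cmean f)^*)%C.
Proof.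
move=> [_ f2]; rewrite /cmean /=; congr Complex.
  by apply: eq_mean => t; case: (f t).
rewrite -mulN1r -meanZ//; apply: eq_mean => t; rewrite mulN1r.
by case: (f t).
Qed.

Lemma cmean_cst z : cmean (fun=> z) = z.
Proof. by rewrite /cmean !mean_cst; case: z. Qed.

Lemma cmean0 : cmean (fun=> 0) = 0. Proof. exact: cmean_cst. Qed.

Lemma cmean_sum n (F : nat -> R -> R[i]) : (forall i, ccont (F i)) ->
  ccont (fun t => \sum_(i < n) F i t) /\
  cmean (fun t => \sum_(i < n) F i t) = \sum_(i < n) cmean (F i).
Proof.
move=> cF; elim: n => [|n [IH1 IH2]].
  have -> : (fun t => \sum_(i < 0) F i t) = (fun=> 0).
    by apply/funext => t; rewrite big_ord0.
  by split; [exact: ccont_cst|rewrite cmean0 big_ord0].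
have -> : (fun t => \sum_(i < n.+1) F i t) = (fun t => \sum_(i < n) F i t + F n t).
  by apply/funext => t; rewrite big_ord_recr.
by split; [exact: ccontD|rewrite cmeanD// IH2 big_ord_recr].
Qed.

(** The factor 2 comes from estimating the two components separately. *)
Lemma le_normc_cmean f : ccont f -> normc (cmean f) <= 2 * mean (fun t => normc (f t)).
Proof.
move=> cf; have [f1 f2] := cf; apply: (le_trans (normc_le_ReIm _)) => /=.
have cn := ccont_normc cf.
have ca (h : R -> R) : continuous h -> continuous (fun t => `|h t|).
  by move=> ch t; apply: cvg_norm; exact: ch.
have -> : forall x : R, 2 * x = x + x by move=> x; ring.
apply: lerD; apply: le_trans (le_norm_mean _) _ => //; apply: le_mean => //.
- exact: ca.
- by move=> t _; exact: le_Re_normc.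
- exact: ca.
- by move=> t _; exact: le_Im_normc.
Qed.

Lemma cisX t n : cis t ^+ n = cis (n%:R * t).
Proof.
elim: n => [|n IH]; first by rewrite expr0 mul0r /cis cos0 sin0.
rewrite exprS IH -natr1 mulrDl mul1r addrC /cis cosD sinD.
by apply/eqP; rewrite eq_complex /=; apply/andP; split; apply/eqP; ring.
Qed.

Lemma cmean_cisX n : (0 < n)%N -> cmean (fun t => cis t ^+ n) = 0.
Proof.
move=> n0; have n0' : n%:R != 0 :> R by rewrite pnatr_eq0 -lt0n.
have E : cis pi ^+ n = cis (- pi) ^+ n :> R[i].
  by congr (_ ^+ n); rewrite /cis cosN sinN sinpi oppr0.
move: E; rewrite !cisX => -[Ec Es].
have [C1 C2] := ccontX n ccont_cis.
have dl (t : R) : is_derive t 1 (fun t => n%:R * t) n%:R.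
  by apply: is_derive_eq; rewrite /GRing.scale /= ?(mulr1, mulr0, addr0).
have ds (t : R) : is_derive t 1 (fun t => sin (n%:R * t)) (n%:R * cos (n%:R * t)).
  have := is_derive1_comp (is_derive_sin (n%:R * t)) (dl t).
  by rewrite mulrC.
have dc (t : R) : is_derive t 1 (fun t => cos (n%:R * t)) (- (n%:R * sin (n%:R * t))).
  have := is_derive1_comp (is_derive_cos (n%:R * t)) (dl t).
  by rewrite mulNr mulrC.
have d1 (t : R) : is_derive t 1 (fun t => n%:R^-1 * sin (n%:R * t)) (complex.Re (cis t ^+ n)).
  apply: is_derive_eq; rewrite /GRing.scale /= cisX ?(mulr0, addr0) /=.
  by rewrite mulrA mulVf// mul1r.
have d2 (t : R) : is_derive t 1 (fun t => - n%:R^-1 * cos (n%:R * t)) (complex.Im (cis t ^+ n)).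
  apply: is_derive_eq; rewrite /GRing.scale /= cisX ?(mulr0, addr0) /=.
  by rewrite mulrN mulNr opprK mulrA mulVf// mul1r.
apply/eqP; rewrite eq_complex /=; apply/andP; split; apply/eqP.
  by rewrite (mean_FTC C1 (fun t _ => d1 t)) Es subrr mulr0.
by rewrite (mean_FTC C2 (fun t _ => d2 t)) Ec subrr mulr0.
Qed.

End complex_mean.

(** * Uniqueness of coefficients and the maximum principle *)

Section coefficient_uniqueness.
Context {R : realType}.
Implicit Types (c d : nat -> R[i]) (r : R) (z : R[i]).

(** Both partial derivatives of Re F vanish, so F' = 0 by the
    Cauchy-Riemann equations. *)
Lemma psderiv_eq0 r c : ps r c ->
  (forall z, normc z < r -> complex.Re (psum c z) = 0) ->
  forall z, normc z < r -> psum (psderiv c) z = 0.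
Proof.
move=> pc c0 [x y] zr; have az : cpt (x, y) = Complex x y by [].
have := qderiv_rdiff (psum_qderiv pc zr : qderiv _ (cpt (x, y)) _).
move=> /(@rdiff_near _ _ (cst 0)) H.
have [|_ H1 H2] := rdiff_derive (H _).
  have := @near_disc R (x, y) r zr; apply: filterS => b bD.
  by rewrite /plane c0.
rewrite !derive_cst in H1 H2; move: H1 H2; case: (psum _ _) => p q /= <-.
by move/eqP; rewrite eq_sym oppr_eq0 => /eqP ->.
Qed.

Lemma ps_eq0 r c n : 0 < r -> ps r c ->
  (forall z, normc z < r -> psum c z = 0) -> c n = 0.
Proof.
move=> r0; elim: n c => [|n IH] c pc c0.
  by rewrite -psum0E c0// normc0.
have : psderiv c n = 0.
  apply: IH; first exact: ps_psderiv.
  by apply: psderiv_eq0 => // z zr; rewrite c0.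
by move=> /eqP; rewrite mulf_eq0 pnatr_eq0/= => /eqP.
Qed.

Lemma ps_Re_eq0 r c n : 0 < r -> ps r c ->
  (forall z, normc z < r -> complex.Re (psum c z) = 0) -> c n.+1 = 0.
Proof.
move=> r0 pc c0; have := ps_eq0 n r0 (ps_psderiv pc) (psderiv_eq0 pc c0).
by move=> /eqP; rewrite mulf_eq0 pnatr_eq0/= => /eqP.
Qed.

Lemma psB r c d : ps r c -> ps r d -> ps r (fun n => c n - d n).
Proof.
move=> pc pd; have -> : (fun n => c n - d n) = (fun n => c n + (-1) * d n).
  by apply/funext => n; rewrite mulN1r.
exact/psD/psZ.
Qed.

(** The real part determines all coefficients but the imaginary part of the
    first one. *)
Lemma ps_coef_eq r c d : 0 < r -> ps r c -> ps r d ->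
  complex.Im (c 0%N) = 0 -> complex.Im (d 0%N) = 0 ->
  (forall z, normc z < r -> complex.Re (psum c z) = complex.Re (psum d z)) ->
  c = d.
Proof.
move=> r0 pc pd c0 d0 cd; apply/funext => -[|n].
  have := cd 0; rewrite normc0 !psum0E => /(_ r0).
  by move: c0 d0; case: (c 0%N) => ? ?; case: (d 0%N) => ? ? /= -> -> ->.
apply/eqP; rewrite -subr_eq0; apply/eqP.
apply: (ps_Re_eq0 (r := r) (c := fun n => c n - d n)) => //; first exact: psB.
move=> z zr; rewrite (psumB pc pd zr); have := cd z zr.
by case: (psum c z) => ? ?; case: (psum d z) => ? ? /= ->; rewrite subrr.
Qed.

End coefficient_uniqueness.

Section maximum_principle.
Context {R : realType}.
Implicit Types (U V : R * R -> R) (a v : R * R) (e : R).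

(** Reduces partial derivatives to derivatives of functions of one
    variable, to which the tests for a maximum apply. *)
Lemma is_derive_line U a v (t l : R) : is_derive (t *: v + a) v U l ->
  is_derive t (1 : R) (fun s => U (s *: v + a)) l.
Proof.
have E : (fun h : R => h^-1 *: (((fun s : R => U (s *: v + a)) \o shift t) (h *: 1) -
     (fun s => U (s *: v + a)) t)) =
   (fun h => h^-1 *: ((U \o shift (t *: v + a)) (h *: v) - U (t *: v + a))).
  apply/funext => h /=; rewrite [h *: 1]/GRing.scale /= mulr1 scalerDl.
  by rewrite addrA.
move=> [dU <-]; split; first by rewrite /derivable E.
by rewrite /derive E.
Qed.

(** If l were positive, the first derivative g1 would vanish at 0 and be
    positive just to the right of it, so that g would increase there. *)
Lemma second_derivative_le0 (g g1 : R -> R) (l e : R) : 0 < e ->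
  (forall t, `|t| < e -> is_derive t (1 : R) g (g1 t)) ->
  is_derive (0 : R) (1 : R) g1 l -> (forall t, `|t| < e -> g t <= g 0) -> l <= 0.
Proof.
move=> e0 dg dg1 gmax; rewrite leNgt; apply/negP => l0.
have g10 : g1 0 = 0.
  have [_ <-] : is_derive 0 (1 : R) g (g1 0) by apply: dg; rewrite normr0.
  have [] := @derive1_at_max R g (- e) e 0 => //.
  - by rewrite ge0_cp// ltW.
  - by move=> t; rewrite in_itv/= -ltr_norml => /dg [].
  - by rewrite in_itv/= oppr_lt0 e0.
  - by move=> t; rewrite in_itv/= -ltr_norml; exact: gmax.
have [d d0 pos] : exists2 d, 0 < d & forall t, 0 < t < d -> 0 < g1 t.
  have [dv El] := dg1.
  have : (fun h : R => h^-1 *: ((g1 \o shift 0) (h *: 1) - g1 0)) h @[h --> 0^'] --> l.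
    by rewrite -El; exact: dv.
  move/cvgrPdist_lt => /(_ l l0) /nbhs_ballP [d /= d0 H]; exists d => // t /andP[t0 td].
  have := H t; rewrite -ball_normE /= sub0r normrN gtr0_norm// => /(_ td (lt0r_neq0 t0)).
  rewrite g10 subr0 addr0 [t *: 1]/GRing.scale /= mulr1 [_ *: _]/GRing.scale /=.
  rewrite ltr_distl => /andP[_]; rewrite ltrDr.
  by rewrite pmulr_rgt0// invr_gt0.
pose t := Num.min d e / 2.
have de0 : 0 < Num.min d e by rewrite lt_min d0.
have t0 : 0 < t by rewrite divr_gt0.
have [td te] : t < d /\ t < e.
  have : t < Num.min d e by rewrite /t ltr_pdivrMr// ltr_pMr// ltr1n.
  by rewrite lt_min => /andP[].
have dgt s : s \in `]0, t[ -> is_derive s 1 g (g1 s).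
  rewrite in_itv/= => /andP[s0 st]; apply: dg.
  by rewrite gtr0_norm// (lt_trans st).
have cg : {within `[0, t], continuous g}.
  apply: derivable_within_continuous => s; rewrite in_itv/= => /andP[s0 st].
  by have [] : is_derive s 1 g (g1 s) by apply: dg; rewrite ger0_norm// (le_lt_trans st).
have [x] := @MVT R g g1 0 t t0 dgt cg.
rewrite in_itv/= => /andP[x0 xt] E.
have := gmax t; rewrite gtr0_norm// -subr_le0 E subr0 => /(_ te).
by rewrite leNgt mulr_gt0// pos// x0 (lt_trans xt).
Qed.

(** The partial derivatives are explicit witnesses here, so that the
    equation passes to differences and to functions which agree locally. *)
Definition laplace_eq0 (A : set (R * R)) U := exists U1 U2 U11 U22 : R * R -> R,
  forall a, A a -> [/\ is_derive a (1, 0) U (U1 a), is_derive a (0, 1) U (U2 a),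
    is_derive a (1, 0) U1 (U11 a), is_derive a (0, 1) U2 (U22 a) &
    U11 a + U22 a = 0].

Lemma laplace_eq0B A U V : laplace_eq0 A U -> laplace_eq0 A V ->
  laplace_eq0 A (fun a => U a - V a).
Proof.
move=> [U1 [U2 [U11 [U22 HU]]]] [V1 [V2 [V11 [V22 HV]]]].
exists (U1 - V1), (U2 - V2), (U11 - V11), (U22 - V22) => a Aa.
have [u1 u2 u11 u22 u0] := HU a Aa; have [v1 v2 v11 v22 v0] := HV a Aa.
split; try exact: is_deriveB.
have -> : (U11 - V11) a + (U22 - V22) a = (U11 a + U22 a) - (V11 a + V22 a).
  by rewrite opprD addrACA.
by rewrite u0 v0 subrr.
Qed.

Lemma normc_cpt_coord a r : normc (cpt a) < r -> `|a.1| < r /\ `|a.2| < r.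
Proof.
move=> ar; split; apply: le_lt_trans ar.
  exact: (le_Re_normc (cpt a)).
exact: (le_Im_normc (cpt a)).
Qed.

(** If U is positive at z, put e = U z / 2. The maximum of U + e x^2 over
    the square exceeds e, so it is attained where U is harmonic; there both
    second derivatives are nonpositive, while their sum is 2 e. *)
Lemma maximum_principle U (r : R) : r <= 1 -> continuous U ->
  (forall a, r <= normc (cpt a) -> U a = 0) ->
  laplace_eq0 [set a | normc (cpt a) < r] U -> forall a, U a <= 0.
Proof.
move=> r1 cU U0 [U1 [U2 [U11 [U22 HU]]]] z; rewrite leNgt; apply/negP => Uz.
pose e := U z / 2; have e0 : 0 < e by rewrite divr_gt0.
pose E a := U a + e * a.1 ^+ 2.
pose K : set (R * R) := `[-1, 1] `*` `[-1, 1].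
have inK a : normc (cpt a) < r -> K a.
  move=> /normc_cpt_coord [h1 h2]; split; rewrite /= in_itv/= -ler_norml;
  by apply: ltW; apply: lt_le_trans r1.
have zr : normc (cpt z) < r.
  by rewrite ltNge; apply/negP => /U0 z0; rewrite z0 ltxx in Uz.
have Kc : compact K by apply: compact_setX; exact: segment_compact.
have cE : continuous E.
  move=> a; apply: cvgD; first exact: cU.
  by apply: cvgM; [exact: cvg_cst|apply: cvgM; exact: cvg_fst].
have [a Ka amax] : exists2 a, K a & forall b, K b -> E b <= E a.
  have [|a aK H] := @compact_EVT_max _ R E K _ Kc (continuous_subspaceT cE).
    by exists z; exact: inK.
  by exists a => [|b Kb]; [exact: set_mem|apply: H; exact: mem_set].
have Ez : e < E z.
  apply: (@lt_le_trans _ _ (U z)); first by rewrite /e; lra.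
  by rewrite lerDl mulr_ge0 ?(ltW e0)// sqr_ge0.
have ar : normc (cpt a) < r.
  rewrite ltNge; apply/negP => /U0 a0.
  have := lt_le_trans Ez (amax z (inK _ zr)); rewrite /E a0 add0r ltNge.
  have [/= h _] := Ka; move: h; rewrite in_itv/= -ler_norml => h.
  by rewrite ler_piMr ?(ltW e0)// -real_normK ?num_real// expr_le1.
have [d d0 near_a] : exists2 d, 0 < d & forall b, `|b| < d -> normc (cpt (b + a)) < r.
  have /nbhs_ballP [d /= d0 H] := near_disc ar; exists d => // b bd.
  by apply: H; rewrite -ball_normE /= opprD addrCA subrr addr0 normrN.
have nv (t : R) : `|t *: ((1, 0) : R * R)| = `|t| /\ `|t *: ((0, 1) : R * R)| = `|t|.
  by split; rewrite normrZ prod_normE /= normr1 normr0 ?(max_l ler01) ?(max_r ler01) mulr1.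
have H0 v : (0 : R) *: v + a = a by rewrite scale0r add0r.
have sq (t : R) : is_derive t (1 : R)
    (fun t : R => e * (t *: ((1, 0) : R * R) + a).1 ^+ 2)
    (2 * e * (t *: ((1, 0) : R * R) + a).1).
  have -> : (fun t : R => e * (t *: ((1, 0) : R * R) + a).1 ^+ 2) =
      e *: ((id + cst a.1) ^+ 2) :> (R -> R).
    by apply/funext => s; rewrite /= [s *: 1]/GRing.scale /= mulr1.
  apply: is_derive_eq; rewrite /GRing.scale /= !expr1 addr0 !mulr1.
  rewrite mulrCA mulrA; congr (_ * _). by rewrite /= /GRing.scale /= mulr1.
have af (t : R) : is_derive t (1 : R)
    (fun t : R => 2 * e * (t *: ((1, 0) : R * R) + a).1) (2 * e).
  have -> : (fun t : R => 2 * e * (t *: ((1, 0) : R * R) + a).1) =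
      (2 * e) *: (id + cst a.1) :> (R -> R).
    by apply/funext => s; rewrite /= [s *: 1]/GRing.scale /= mulr1.
  by apply: is_derive_eq; rewrite /GRing.scale /= addr0 mulr1.
have L1 : U11 a + 2 * e <= 0.
  apply: (@second_derivative_le0 (fun t => E (t *: (1, 0) + a))
    (fun t => U1 (t *: (1, 0) + a) + 2 * e * (t *: (1, 0) + a).1) _ _ d0).
  - move=> t td; set b := _ + a.
    have br : normc (cpt b) < r by apply: near_a; rewrite (nv t).1.
    have [u1 _ _ _ _] := HU b br.
    exact: (is_deriveD (is_derive_line u1) (sq t)).
  - have [_ _ u11 _ _] := HU a ar.
    by apply: (is_deriveD _ (af 0)); apply: is_derive_line; rewrite H0.
  - by move=> t td; rewrite H0; apply/amax/inK/near_a; rewrite (nv t).1.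
have L2 : U22 a <= 0.
  apply: (@second_derivative_le0 (fun t => E (t *: (0, 1) + a))
    (fun t => U2 (t *: (0, 1) + a)) _ _ d0).
  - move=> t td; set b := _ + a.
    have br : normc (cpt b) < r by apply: near_a; rewrite (nv t).2.
    have [_ u2 _ _ _] := HU b br.
    have cst_x : (fun t : R => e * (t *: ((0, 1) : R * R) + a).1 ^+ 2) = cst (e * a.1 ^+ 2).
      by apply/funext => s; rewrite /= [s *: 0]/GRing.scale /= mulr0 add0r.
    have := is_deriveD (is_derive_line u2) (is_derive_cst (e * a.1 ^+ 2) t 1).
    by rewrite -cst_x addr0.
  - have [_ _ _ u22 _] := HU a ar.
    by apply: is_derive_line; rewrite H0.
  - by move=> t td; rewrite H0; apply/amax/inK/near_a; rewrite (nv t).2.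
have [_ _ _ _ u0] := HU a ar.
by move: L1 L2 e0 u0; lra.
Qed.

End maximum_principle.

(** * The Poisson integral *)

Section poisson.
Context {R : realType}.
Implicit Types (w z : R[i]) (t : R) (n : nat).

(** Taylor coefficients of (1 + w) / (1 - w). *)
Let e n : R[i] := if n is 0%N then 1 else 2.

Lemma herglotz_expand w n : normc w < 1 ->
  normc ((1 + w) / (1 - w) - \sum_(i < n) e i * w ^+ i) <=
  2 / (1 - normc w) * normc w ^+ n.
Proof.
move=> w1.
have w1' : 1 - w != 0.
  by rewrite subr_eq0; apply/eqP => E; rewrite -E normc1 ltxx in w1.
have n1 : 1 - normc w <= normc (1 - w).
  by rewrite lerBlDr -[leLHS](normc1 R) -{1}[1](subrK w) normcD.
have n0 : 0 < 1 - normc w by rewrite subr_gt0.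
have -> : (1 + w) / (1 - w) - \sum_(i < n) e i * w ^+ i =
    (if n is 0%N then 1 + w else 2) * w ^+ n / (1 - w).
  elim: n => [|n IH]; first by rewrite big_ord0 subr0 expr0 mulr1.
  rewrite big_ord_recr /= opprD addrA IH exprS.
  by case: n {IH} => [|n]; rewrite /e ?expr0; field.
rewrite normcM normcV normcM normcX.
have -> : 2 / (1 - normc w) * normc w ^+ n = 2 * normc w ^+ n / (1 - normc w) by ring.
apply: ler_pM; rewrite ?mulr_ge0 ?exprn_ge0 ?normc_ge0 ?invr_ge0 ?normc_ge0//.
  rewrite ler_wpM2r ?exprn_ge0 ?normc_ge0//.
  case: n => [|n]; last by rewrite normc_nat.
  by apply: le_trans (normcD _ _) _; rewrite (normc1 R) -[2]/(1 + 1) lerD2l ltW.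
by rewrite lef_pV2 ?posrE// (lt_le_trans n0).
Qed.

(** The Poisson kernel is the real part of this function of w. *)
Definition herglotz w t := (cis t + w) / (cis t - w).

Lemma cis_neq0 t : cis t != 0.
Proof.
by apply/eqP => E; have := normc_cis t; rewrite E normc0 => /eqP; rewrite eq_sym oner_eq0.
Qed.

Lemma cisB_neq0 w t : normc w < 1 -> cis t - w != 0.
Proof.
by move=> w1; rewrite subr_eq0; apply/eqP => E; rewrite -E normc_cis ltxx in w1.
Qed.

Lemma herglotzE w t : normc w < 1 -> herglotz w t = (1 + w / cis t) / (1 - w / cis t).
Proof.
move=> w1; have c0 := cis_neq0 t; have cw := cisB_neq0 t w1.
by rewrite /herglotz; field; rewrite c0 cw.
Qed.

Lemma ccont_herglotz w : normc w < 1 -> ccont (herglotz w).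
Proof.
move=> w1; apply: ccontM; first exact: (ccontD ccont_cis (ccont_cst w)).
apply: (@ccontV _ (fun t => cis t - w)); first by move=> t; exact: cisB_neq0.
exact: (ccontD ccont_cis (ccont_cst (- w))).
Qed.

Variable phi : R -> R.
Hypothesis cphi : continuous phi.

Let cP : ccont (fun t => Complex (phi t) 0). Proof. exact: ccont_real. Qed.

Let cI n : ccont (fun t => (cis t)^-1 ^+ n).
Proof. by apply/ccontX/ccontV; [exact: cis_neq0|exact: ccont_cis]. Qed.

Let normc_cisV t : normc (cis t)^-1 = 1.
Proof. by rewrite normcV normc_cis invr1. Qed.

(** Coefficients of the power series whose real part is the Poisson
    integral of phi. *)
Definition fourier n := e n * cmean (fun t => Complex (phi t) 0 * (cis t)^-1 ^+ n).

Definition mean_abs := mean (fun t => `|phi t|).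

Let cabs : continuous (fun t => `|phi t|).
Proof. by move=> t; apply: cvg_norm; exact: cphi. Qed.

Lemma mean_abs_ge0 : 0 <= mean_abs. Proof. exact: mean_ge0. Qed.

Let bound (f : R -> R[i]) K : ccont f -> (forall t, normc (f t) <= K) ->
  normc (cmean (fun t => Complex (phi t) 0 * f t)) <= 2 * (K * mean_abs).
Proof.
move=> cf fK; have cg := ccontM cP cf.
apply: (le_trans (le_normc_cmean cg)); rewrite ler_pM2l// /mean_abs -meanZ//.
apply: le_mean => [||t _].
- exact: ccont_normc.
- by move=> t; apply: cvgM; [exact: cvg_cst|exact: cabs].
- by rewrite normcM normc_real mulrC ler_wpM2r.
Qed.

Lemma normc_fourier n : normc (fourier n) <= 4 * mean_abs.
Proof.
have H : normc (cmean (fun t => Complex (phi t) 0 * (cis t)^-1 ^+ n)) <= 2 * (1 * mean_abs).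
  by apply: bound => // t; rewrite normcX normc_cisV expr1n.
rewrite normcM; have m0 := mean_abs_ge0.
have -> : 4 * mean_abs = 2 * (2 * (1 * mean_abs)) by ring.
apply: ler_pM => //; try exact: normc_ge0.
by rewrite /e; case: n {H} => [|n]; rewrite ?normc_nat// (normc1 R) ler1n.
Qed.

(** Term by term integration of the expansion of the kernel. The remainder
    after n terms is uniformly small on the circle, so only finite sums are
    integrated. *)
Lemma psum_fourier w : normc w < 1 ->
  psum fourier w = cmean (fun t => Complex (phi t) 0 * herglotz w t).
Proof.
move=> w1; apply: (@csum_unique _ _ _ (2 * (2 / (1 - normc w) * mean_abs)) (normc w)).
  by rewrite normc_ge0.
move=> n; pose F i t := fourier 0 * 0 + e i * w ^+ i * (Complex (phi t) 0 * (cis t)^-1 ^+ i).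
have cF i : ccont (F i).
  apply: ccontD (ccont_cst _) _; apply: ccontM (ccont_cst _) _.
  by apply: ccontM.
have [cS mS] := cmean_sum n cF.
have ch := ccontM cP (ccont_herglotz w1).
have -> : \sum_(i < n) fourier i * w ^+ i = cmean (fun t => \sum_(i < n) F i t).
  rewrite mS; apply: eq_bigr => i _; rewrite /F mulr0.
  have -> : (fun t => 0 + e i * w ^+ i * (Complex (phi t) 0 * (cis t)^-1 ^+ i)) =
    (fun t => e i * w ^+ i * (Complex (phi t) 0 * (cis t)^-1 ^+ i)).
    by apply/funext => t; rewrite add0r.
  rewrite cmeanZ; last by apply: ccontM.
  by rewrite /fourier mulrAC.
have cSN : ccont (fun t => (-1) * \sum_(i < n) F i t) by apply: ccontM (ccont_cst _) _.
rewrite -mulN1r -cmeanZ// -cmeanD//.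
have E t : Complex (phi t) 0 * herglotz w t + (-1) * \sum_(i < n) F i t =
    Complex (phi t) 0 * (herglotz w t - \sum_(i < n) e i * (w / cis t) ^+ i).
  rewrite mulN1r mulrBr mulr_sumr; congr (_ - _); apply: eq_bigr => i _.
  by rewrite /F exprMn; ring.
have -> : (fun t => Complex (phi t) 0 * herglotz w t + (-1) * \sum_(i < n) F i t) =
  (fun t => Complex (phi t) 0 * (herglotz w t - \sum_(i < n) e i * (w / cis t) ^+ i)).
  exact/funext.
have -> : 2 * (2 / (1 - normc w) * mean_abs) * normc w ^+ n =
  2 * (2 / (1 - normc w) * normc w ^+ n * mean_abs) by ring.
apply: bound.
  pose G i t := e i * (w / cis t) ^+ i.
  have cG i : ccont (G i).
    apply: ccontM (ccont_cst _) _; apply: ccontX; apply: ccontM (ccont_cst _) _.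
    by apply: ccontV; [exact: cis_neq0|exact: ccont_cis].
  have [cS' _] := cmean_sum n cG.
  have -> : (fun t => herglotz w t - \sum_(i < n) e i * (w / cis t) ^+ i) =
    (fun t => herglotz w t + (-1) * \sum_(i < n) G i t).
    by apply/funext => t; rewrite mulN1r.
  by apply: ccontD (ccont_herglotz w1) _; apply: ccontM (ccont_cst _) _.
move=> t; rewrite herglotzE//.
have nw : normc (w / cis t) = normc w by rewrite normcM normc_cisV mulr1.
by rewrite -nw; apply: herglotz_expand; rewrite nw.
Qed.

Lemma Re_psum_fourier w : normc w < 1 ->
  complex.Re (psum fourier w) = mean (fun t => phi t * complex.Re (herglotz w t)).
Proof.
move=> w1; rewrite psum_fourier//=; apply: eq_mean => t.
by case: (herglotz w t) => x y /=; rewrite mul0r subr0.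
Qed.

Lemma fourier0 : fourier 0 = Complex (mean phi) 0.
Proof.
have E : (fun t => Complex (phi t) 0 * (cis t)^-1 ^+ 0) = (fun t => Complex (phi t) 0).
  by apply/funext => t; rewrite expr0 mulr1.
by rewrite /fourier /e mul1r E /cmean /= mean_cst.
Qed.

End poisson.

Section poisson_kernel.
Context {R : realType}.
Implicit Types (w : R[i]) (t : R).

Lemma Re_herglotz w t : normc w < 1 ->
  complex.Re (herglotz w t) = (1 - normc w ^+ 2) / normc (cis t - w) ^+ 2.
Proof.
move=> w1; have := cisB_neq0 t w1; rewrite /herglotz !normc_sqr.
case: w w1 => x y _; rewrite /cis => nz.
have : (cos t - x) ^+ 2 + (sin t - y) ^+ 2 != 0.
  apply: contra nz; rewrite paddr_eq0 ?sqr_ge0// !sqrf_eq0 => /andP[/eqP h1 /eqP h2].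
  by rewrite eq_complex /= h1 h2 eqxx.
rewrite /= => nz'; have cs := cos2Dsin2 t.
have -> : 1 = cos t ^+ 2 + sin t ^+ 2 by [].
by field.
Qed.

Lemma Re_herglotz_ge0 w t : normc w < 1 -> 0 <= complex.Re (herglotz w t).
Proof.
move=> w1; rewrite Re_herglotz// divr_ge0 ?exprn_ge0 ?normc_ge0// subr_ge0.
by rewrite exprn_ile1 ?normc_ge0// ltW.
Qed.

Lemma cisV t : (cis t)^-1 = (cis t)^*%C :> R[i].
Proof.
apply: (mulfI (cis_neq0 t)); rewrite divff ?cis_neq0// /cis.
by apply/eqP; rewrite eq_complex /= -(cos2Dsin2 t); apply/andP; split; apply/eqP; ring.
Qed.

(** The Poisson integral of the constant 1: all coefficients but the first
    vanish. *)
Lemma mean_Re_herglotz w : normc w < 1 -> mean (fun t => complex.Re (herglotz w t)) = 1.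
Proof.
move=> w1; have c1 : continuous (fun _ : R => 1 : R) by move=> t; exact: cvg_cst.
have := Re_psum_fourier c1 w1.
under eq_mean do rewrite mul1r.
move=> <-; suff -> : psum (fourier (fun=> 1)) w = 1 by [].
apply: (@csum_unique _ _ _ 1 0); first by rewrite lexx ltr01.
case=> [|n]; first by rewrite big_ord0 subr0 expr0 mulr1 normc1.
rewrite big_ord_recl /= fourier0 mean_cst expr0 mulr1 big1 ?addr0 ?subrr.
  by rewrite normc0 mulr_ge0// exprn_ge0.
move=> i _; rewrite /fourier.
have E : (fun t => Complex 1 0 * (cis t)^-1 ^+ (bump 0 i)) =
    (fun t => (cis t ^+ i.+1)^*%C).
  apply/funext => t; have -> : Complex 1 0 = 1 :> R[i] by [].
  by rewrite mul1r cisV rmorphXn.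
rewrite E.
by rewrite cmean_conj ?cmean_cisX// ?conjc0 ?mulr0 ?mul0r//; exact/ccontX/ccont_cis.
Qed.

(** The kernel is nonnegative with mean 1, so the part of the circle near
    w0 contributes at most eps / 2; on the rest of the circle the kernel is
    at most Q, which is of order 1 - |w|^2. *)
Lemma poisson_boundary (phi : R -> R) w0 (l : R) : continuous phi -> normc w0 = 1 ->
  (forall eps, 0 < eps -> exists2 d, 0 < d &
     forall t, normc (cis t - w0) < d -> `|phi t - l| <= eps) ->
  forall eps, 0 < eps -> exists2 d, 0 < d &
     forall w, normc w < 1 -> normc (w - w0) < d ->
       `|complex.Re (psum (fourier phi) w) - l| <= eps.
Proof.
move=> cphi w01 H eps eps0; have e2 : 0 < eps / 2 by rewrite divr_gt0.
have [d d0 Hd] := H _ e2.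
pose K := mean (fun t => `|phi t - l|).
have K0 : 0 <= K by exact: mean_ge0.
pose B := 8 * K / d ^+ 2.
have B0 : 0 <= B by apply: divr_ge0; [exact: mulr_ge0|apply/exprn_ge0/ltW].
exists (Num.min (d / 2) (eps / 2 / (B + 1))).
  rewrite lt_min; apply/andP; split; first exact: divr_gt0.
  by apply: divr_gt0 => //; apply: ltr_wpDl.
move=> w w1; rewrite lt_min => /andP[wd wB].
have cp : continuous (fun t => phi t - l).
  by move=> t; apply: cvgB; [exact: cphi|exact: cvg_cst].
have ca : continuous (fun t => `|phi t - l|).
  by move=> t; apply: cvg_norm; exact: cp.
have ch : continuous (fun t => complex.Re (herglotz w t)) by case: (ccont_herglotz w1).
have cM (f g : R -> R) : continuous f -> continuous g -> continuous (fun t => f t * g t).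
  by move=> cf cg t; apply: cvgM; [exact: cf|exact: cg].
have cZ (x : R) (g : R -> R) : continuous g -> continuous (fun t => x * g t).
  by move=> cg t; apply: cvgM; [exact: cvg_cst|exact: cg].
have -> : complex.Re (psum (fourier phi) w) - l =
    mean (fun t => (phi t - l) * complex.Re (herglotz w t)).
  under eq_mean do rewrite mulrBl.
  by rewrite Re_psum_fourier// meanB ?meanZ ?mean_Re_herglotz ?mulr1//; [exact: cM|exact: cZ].
apply: (le_trans (le_norm_mean _)); first exact: cM.
pose Q := 4 * (1 - normc w ^+ 2) / d ^+ 2.
have Q0 : 0 <= Q.
  rewrite divr_ge0 ?exprn_ge0 ?(ltW d0)// mulr_ge0// subr_ge0.
  by rewrite exprn_ile1 ?normc_ge0// ltW.
apply: (@le_trans _ _ (mean (fun t => eps / 2 * complex.Re (herglotz w t) + Q * `|phi t - l|))).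
  apply: le_mean => [||t _].
  - by move=> t; apply: cvg_norm; exact: (cM _ _ cp ch).
  - by move=> t; apply: cvgD; [exact: (cZ _ _ ch)|exact: (cZ _ _ ca)].
  rewrite normrM (ger0_norm (Re_herglotz_ge0 t w1)).
  have [near|far] := ltP (normc (cis t - w0)) d.
    rewrite -[leLHS]addr0; apply: lerD; last by rewrite mulr_ge0.
    by rewrite ler_wpM2r ?Re_herglotz_ge0 ?Hd.
  rewrite -[leLHS]add0r; apply: lerD; first by rewrite mulr_ge0 ?Re_herglotz_ge0 ?(ltW e2).
  rewrite mulrC ler_wpM2r// Re_herglotz//.
  have dist : d / 2 <= normc (cis t - w).
    have : normc (cis t - w0) <= normc (cis t - w) + normc (w - w0).
      by have := normcD (cis t - w) (w - w0); rewrite addrA subrK.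
    by move: far wd; move: (normc _) (normc _) (normc _) => a b c; lra.
  have dp : 0 < d / 2 by rewrite divr_gt0.
  have -> : Q = (1 - normc w ^+ 2) / (d / 2) ^+ 2.
    by rewrite /Q; field; rewrite gt_eqF.
  rewrite ler_wpM2l ?subr_ge0 ?exprn_ile1 ?normc_ge0 ?(ltW w1)//.
  rewrite lef_pV2 ?posrE ?exprn_gt0// ?(lt_le_trans dp)//.
  by apply: lerXn2r; rewrite ?nnegrE ?(ltW dp) ?normc_ge0.
rewrite meanD ?meanZ ?mean_Re_herglotz ?mulr1//; try exact: cZ.
have -> : eps = eps / 2 + eps / 2 by lra.
rewrite -/K.
have w0w : 1 - normc w <= normc (w - w0).
  by rewrite normc_dist lerBlDr -w01 -{1}[w0](subrK w) normcD.
have QK : Q * K <= B * (1 - normc w).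
  have -> : Q * K = (1 - normc w) * (1 + normc w) * (4 * K / d ^+ 2).
    by rewrite /Q; ring.
  have -> : B * (1 - normc w) = (1 - normc w) * 2 * (4 * K / d ^+ 2).
    by rewrite /B; ring.
  apply: ler_wpM2r; first by apply: divr_ge0; [exact: mulr_ge0|apply/exprn_ge0/ltW].
  by rewrite ler_wpM2l ?subr_ge0 ?(ltW w1)// -[2]/(1 + 1) lerD2l ltW.
have Be : B * (1 - normc w) <= eps / 2.
  apply: (@le_trans _ _ ((B + 1) * normc (w - w0))).
    by apply: ler_pM; rewrite ?subr_ge0 ?(ltW w1) ?lerDl.
  by move: wB; rewrite ltr_pdivlMr ?ltr_wpDl// mulrC => /ltW.
by move: (le_trans QK Be); lra.
Qed.
End poisson_kernel.

(** * Harmonic functions as real parts of power series *)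

Section representation.
Context {R : realType}.
Implicit Types (u : R[i] -> R) (c : nat -> R[i]) (r : R) (z w : R[i]) (a b : R * R).

Lemma laplace_eq0_near (A : set (R * R)) (U V : R * R -> R) :
  (forall a, A a -> \forall b \near a, V b = U b) ->
  laplace_eq0 A V -> laplace_eq0 A U.
Proof.
move=> VU [V1 [V2 [V11 [V22 HV]]]]; exists V1, V2, V11, V22 => a Aa.
have [v1 v2 v11 v22 v0] := HV a Aa.
by split => //; [apply: near_eq_is_derive v1|apply: near_eq_is_derive v2]; exact: VU.
Qed.

Lemma differentiable_is_derive (U : R * R -> R) a v : differentiable U a ->
  is_derive a v U ('D_v U a).
Proof. by move=> dU; apply/derivableP/diff_derivable. Qed.

Lemma harmonic_laplace u : harmonic_disc u ->
  laplace_eq0 [set a | normc (cpt a) < 1] (plane u).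
Proof.
move=> [[C0 C1 C2 L] _].
exists ('D_(1, 0) (plane u)), ('D_(0, 1) (plane u)),
  ('D_(1, 0) ('D_(1, 0) (plane u))), ('D_(0, 1) ('D_(0, 1) (plane u))) => a Aa.
have Da : disc (Complex a.1 a.2) by rewrite discE.
have [d0 _ _] := C0 a Da; have [d1 _ _] := C1 a Da; have [d2 _ _] := C2 a Da.
by split; try exact: differentiable_is_derive; exact: L.
Qed.

Lemma psum_is_derive r c a : ps r c -> normc (cpt a) < r ->
  is_derive a (1, 0) (fun a => complex.Re (psum c (cpt a)))
    (complex.Re (psum (psderiv c) (cpt a))) /\
  is_derive a (0, 1) (fun a => complex.Re (psum c (cpt a)))
    (complex.Re (psum (fun n => ii * psderiv c n) (cpt a))).
Proof.
move=> pc ar; have := qderiv_rdiff (psum_qderiv pc ar).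
move=> /rdiff_derive [dU E1 E2].
have E3 := congr1 (@complex.Re R) (psum_Z ii (ps_psderiv pc) ar).
have E4 := etrans E2 (esym (etrans E3 (Re_ii _))).
split; first exact: is_derive_eq (differentiable_is_derive _ dU) E1.
exact: is_derive_eq (differentiable_is_derive _ dU) E4.
Qed.

Lemma psum_continuous r c a : ps r c -> normc (cpt a) < r ->
  {for a, continuous (fun a => complex.Re (psum c (cpt a)))}.
Proof.
move=> pc ar; have := qderiv_rdiff (psum_qderiv pc ar).
by move=> /rdiff_derive [dU _ _]; exact: differentiable_continuous dU.
Qed.

(** The computation of reps_harmonic, on a disc of arbitrary radius. *)
Lemma psum_laplace r c : ps r c ->
  laplace_eq0 [set a | normc (cpt a) < r] (fun a => complex.Re (psum c (cpt a))).
Proof.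
move=> pc; have pd := ps_psderiv pc; have pi := psZ ii pd.
have pdd := ps_psderiv pd; have pid := ps_psderiv pi.
exists (fun a => complex.Re (psum (psderiv c) (cpt a))),
  (fun a => complex.Re (psum (fun n => ii * psderiv c n) (cpt a))),
  (fun a => complex.Re (psum (psderiv (psderiv c)) (cpt a))),
  (fun a => complex.Re (psum (fun n => ii * psderiv (fun n => ii * psderiv c n) n) (cpt a))).
move=> a /= ar.
have [d1 d2] := psum_is_derive pc ar; have [d11 _] := psum_is_derive pd ar.
have [_ d22] := psum_is_derive pi ar.
split; [exact: d1|exact: d2|exact: d11|exact: d22|].
cbv beta; suff E : psum (fun n => ii * psderiv (fun n => ii * psderiv c n) n) (cpt a) =
   - psum (psderiv (psderiv c)) (cpt a).
  apply: (etrans (congr2 +%R (erefl _) (congr1 (@complex.Re R) E))).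
  change (complex.Re (psum (psderiv (psderiv c)) (cpt a)) +
    complex.Re (- psum (psderiv (psderiv c)) (cpt a)) = 0).
  by move: (psum (psderiv (psderiv c)) (cpt a)) => [x y] /=; rewrite subrr.
have i2 : ii * ii = -1 :> R[i].
    by apply/eqP; rewrite eq_complex /=; apply/andP; split; apply/eqP; ring.
rewrite -mulN1r; apply: (etrans _ (psum_Z (-1) pdd ar)).
rewrite /psum; congr csum; apply/funext => n; congr (_ * _).
by rewrite -i2 /psderiv; ring.
Qed.

Lemma le_norm_normc a : `|a| <= normc (cpt a).
Proof.
rewrite prod_normE ge_max; apply/andP; split.
  exact: (le_Re_normc (cpt a)).
exact: (le_Im_normc (cpt a)).
Qed.

Lemma cptB a b : cpt (a - b) = cpt a - cpt b.
Proof. by apply/eqP; rewrite eq_complex /= !eqxx. Qed.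

Lemma normc_cpt_continuous : continuous (fun a => normc (cpt a)).
Proof.
move=> a; apply/cvgrPdist_le => eps eps0; apply/(@nbhs_ballP R (R * R)%type).
exists (eps / 2) => /=; first by rewrite divr_gt0.
move=> b; rewrite -ball_normE /= ltr_pdivlMr// mulrC => ab.
apply: le_trans (ltW ab); apply: le_trans (normc_cpt _); rewrite cptB.
have h1 := normcD (cpt a - cpt b) (cpt b); rewrite subrK in h1.
have h2 := normcD (cpt b - cpt a) (cpt a); rewrite subrK in h2.
rewrite (normc_dist (cpt b)) in h2.
by rewrite ler_norml; apply/andP; split; lra.
Qed.

Lemma laplace_eq0_cst (A : set (R * R)) (x : R) : laplace_eq0 A (fun=> x).
Proof.
exists (cst 0), (cst 0), (cst 0), (cst 0) => a _.
by split; [exact: (is_derive_cst x a)|exact: (is_derive_cst x a)|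
  exact: (is_derive_cst 0 a)|exact: (is_derive_cst 0 a)|rewrite /cst addr0].
Qed.

Lemma circleE r t : circle r t = Complex r 0 * cis t.
Proof. by apply/eqP; rewrite eq_complex /= !mul0r subr0 addr0 !eqxx. Qed.

(** Let D be the difference between u and the Poisson integral of its
    values on the circle of radius r, extended by 0. It is continuous by
    poisson_boundary, so the maximum principle applies to D and to - D. *)
Lemma poisson_representation u r : harmonic_disc u -> 0 < r < 1 ->
  exists c, [/\ ps r c, complex.Im (c 0%N) = 0,
    forall z, normc z < r -> u z = complex.Re (psum c z) &
    forall n, normc (c n) * r ^+ n <= 4 * mean (fun t => `|u (circle r t)|)].
Proof.
move=> hu /andP[r0 r1]; pose phi t := u (circle r t).
have r01 : 0 <= r < 1 by rewrite r1 ltW.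
have cphi : continuous phi by exact: continuous_circle.
have rC0 : Complex r 0 != 0 :> R[i] by rewrite eq_complex /= eqxx andbT gt_eqF.
pose c n := fourier phi n * (Complex r 0)^-1 ^+ n.
have nrC : normc (Complex r 0) = r by rewrite normc_real gtr0_norm.
have bound n : normc (c n) * r ^+ n <= 4 * mean_abs phi.
  rewrite normcM normcX normcV nrC exprVn divfK ?expf_neq0 ?gt_eqF//.
  exact: normc_fourier.
have pc : ps r c.
  move=> s /andP[s0 sr]; exists (4 * mean_abs phi) => n; apply: le_trans (bound n).
  rewrite ler_wpM2l ?normc_ge0//.
  by apply: lerXn2r; rewrite ?nnegrE ?(ltW sr) ?(ltW r0).
have psumE z : psum c z = psum (fourier phi) (z / Complex r 0).
  by rewrite /psum; congr csum; apply/funext => n; rewrite /c exprMn; ring.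
have scale z : normc (z / Complex r 0) = normc z / r by rewrite normcM normcV nrC.
exists c; split => //.
  by rewrite /c expr0 mulr1 fourier0.
pose D a := if normc (cpt a) < r then u (cpt a) - complex.Re (psum c (cpt a)) else 0.
have Din a : normc (cpt a) < r -> \forall b \near a,
    plane u b - complex.Re (psum c (cpt b)) = D b.
  by move=> ar; apply: filterS (near_disc ar) => b br; rewrite /D br.
have LD : laplace_eq0 [set a | normc (cpt a) < r] D.
  apply: laplace_eq0_near Din _; apply: laplace_eq0B (psum_laplace pc).
  have [U1 [U2 [U11 [U22 H]]]] := harmonic_laplace hu.
  exists U1, U2, U11, U22 => a /= ar; apply: H => /=; exact: lt_trans r1.
have D0 a : r <= normc (cpt a) -> D a = 0 by rewrite /D leNgt => /negbTE ->.
have uC a : normc (cpt a) < 1 -> {for a, continuous (plane u)}.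
  by move=> a1; apply: harmonic_disc_continuous => //; rewrite discE.
have cD : continuous D.
  move=> a; have [ar|ar] := ltP (normc (cpt a)) r.
    apply: (@cvg_trans _ (D x @[x --> a])) => //.
    have E := nbhs_singleton (Din a ar); rewrite -E.
    apply: cvg_trans; first exact: (near_eq_cvg (Din a ar)).
    by apply: cvgB; [apply: uC; exact: lt_trans r1|exact: psum_continuous ar].
  apply/cvgrPdist_le => eps eps0; rewrite (D0 _ ar).
  have [eqr|ner] := eqVneq (normc (cpt a)) r; last first.
    have ra : r < normc (cpt a) by rewrite lt_neqAle eq_sym ner.
    near=> b; rewrite D0 ?subr0 ?normr0 ?(ltW eps0)// ltW//.
    by near: b; apply: cvgr_gt ra; exact: normc_cpt_continuous.
  have e2 : 0 < eps / 2 by rewrite divr_gt0.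
  have a1 : normc (cpt a) < 1 by rewrite eqr.
  have /cvgrPdist_le uca := uC a a1.
  pose w0 := cpt a / Complex r 0.
  have w01 : normc w0 = 1 by rewrite scale eqr divff// gt_eqF.
  have dE b : normc (cpt b / Complex r 0 - w0) = normc (cpt b - cpt a) / r.
    by rewrite -mulrBl scale.
  have cont e : 0 < e -> exists2 d, 0 < d &
      forall t, normc (cis t - w0) < d -> `|phi t - u (cpt a)| <= e.
    move=> e0; have /nbhs_ballP [d /= d0 Hd] := uca e e0; exists d => // t td.
    rewrite distrC; apply: (Hd (r * cos t, r * sin t)).
    rewrite -ball_normE /= distrC; apply: le_lt_trans (le_norm_normc _) _.
    apply: le_lt_trans td; rewrite cptB.
    have -> : cis t = cpt (r * cos t, r * sin t) / Complex r 0.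
      by rewrite -[cpt _]/(circle r t) circleE mulrAC divff// mul1r.
    by rewrite dE ler_pdivlMr// ler_piMr ?normc_ge0// ltW.
  have [d d0 Hd] := poisson_boundary cphi w01 cont e2.
  near=> b; rewrite sub0r normrN /D; case: ifPn => [br|_]; last by rewrite normr0 ltW.
  have -> : u (cpt b) - complex.Re (psum c (cpt b)) = (u (cpt b) - u (cpt a)) -
      (complex.Re (psum c (cpt b)) - u (cpt a)) by ring.
  apply: (le_trans (ler_normB _ _)); rewrite [leRHS]splitr; apply: lerD.
    rewrite distrC; near: b; exact: uca.
  rewrite psumE; apply: Hd; first by rewrite scale ltr_pdivrMr ?mul1r.
  rewrite dE ltr_pdivrMr//; apply: le_lt_trans (normc_cpt (b - a)) _.
  rewrite mulrC -ltr_pdivlMr// distrC; near: b; apply/(@nbhs_ballP R (R * R)%type).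
  exists (d * r / 2) => /=; first by rewrite divr_gt0// mulr_gt0.
  by move=> b; rewrite -ball_normE.
have key V : continuous V -> (forall a, r <= normc (cpt a) -> V a = 0) ->
    laplace_eq0 [set a | normc (cpt a) < r] V -> forall a, V a <= 0.
  by apply: maximum_principle; exact: ltW.
have LN : laplace_eq0 [set a | normc (cpt a) < r] (fun a => - D a).
  have -> : (fun a => - D a) = (fun a => 0 - D a) by apply/funext => a; rewrite sub0r.
  exact: laplace_eq0B (laplace_eq0_cst _ 0) LD.
move=> z zr.
have zE : z = cpt (complex.Re z, complex.Im z) by case: (z).
have h1 := key D cD D0 LD (complex.Re z, complex.Im z).
have h2 : - D (complex.Re z, complex.Im z) <= 0.
  apply: (key (fun a => - D a)) => //.
    by move=> a; apply: cvgN; exact: cD.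
  by move=> b br; rewrite D0 ?oppr0.
apply/eqP; rewrite -subr_eq0 eq_le; apply/andP; split.
  by move: h1; rewrite /D -zE zr.
by move: h2; rewrite /D -zE zr oppr_le0.
Unshelve. all: by end_near. Qed.

(** The series found on different circles agree near 0 and therefore have
    the same coefficients, which then satisfy the bounds of all circles. *)
Theorem harmonic_psum u : harmonic_disc u -> exists c,
  [/\ ps 1 c, complex.Im (c 0%N) = 0, u = reps c &
    forall r, 0 < r < 1 -> forall n,
      normc (c n) * r ^+ n <= 4 * mean (fun t => `|u (circle r t)|)].
Proof.
move=> hu.
have h2 : 0 < (2^-1 : R) < 1 by apply/andP; split; lra.
have [c [pc c0 uc _]] := poisson_representation hu h2.
(* Both series converge on the smaller of the two discs, where they have the
   same real part. *)
have same r (d : nat -> R[i]) : 0 < r -> ps r d -> complex.Im (d 0%N) = 0 ->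
    (forall z, normc z < r -> u z = complex.Re (psum d z)) -> d = c.
  move=> r0 pd d0 ud; pose s := Num.min r 2^-1.
  have s0 : 0 < s by rewrite lt_min r0; case/andP: h2.
  have mono t e : s <= t -> ps t e -> ps s e.
    move=> st pe x /andP[x0 xs]; apply: pe.
    by rewrite x0 (lt_le_trans xs).
  apply: (ps_coef_eq s0) => //.
  - by apply: mono pd; rewrite ge_min lexx.
  - by apply: mono pc; rewrite ge_min lexx orbT.
  - by move=> z; rewrite lt_min => /andP[zr z2]; rewrite -ud// -uc.
have all r : 0 < r < 1 -> [/\ ps r c,
    forall z, normc z < r -> u z = complex.Re (psum c z) &
    forall n, normc (c n) * r ^+ n <= 4 * mean (fun t => `|u (circle r t)|)].
  move=> r01; have [d [pd d0 ud bd]] := poisson_representation hu r01.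
  by have <- : d = c by apply: (same r) => //; case/andP: r01.
exists c; split => //.
- move=> s /andP[s0 s1]; pose t := (s + 1) / 2.
  have [|p _ _] := all t; first by rewrite /t; apply/andP; split; lra.
  by apply: p; rewrite s0 /t; lra.
- apply/funext => z; rewrite /reps; case: ifPn => [z1|z1].
    pose t := (normc z + 1) / 2; have z0 := normc_ge0 z.
    have [|_ uz _] := all t; first by rewrite /t; apply/andP; split; lra.
    by apply: uz; rewrite /t; lra.
  by have [_ ->] := hu; rewrite ?discE//; exact/negP.
- by move=> r r01; have [] := all r r01.
Qed.

Lemma psum_cst c z : (forall n, c n.+1 = 0) -> psum c z = c 0%N.
Proof.
move=> c0; apply: (@csum_unique _ _ _ (normc (c 0%N)) 0); first by rewrite lexx ltr01.
case=> [|n]; first by rewrite big_ord0 subr0 expr0 mulr1.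
rewrite big_ord_recl/= expr0 mulr1 big1 ?addr0 ?subrr ?normc0 ?mulr_ge0 ?normc_ge0 ?exprn_ge0//.
by move=> i _; rewrite c0 mul0r.
Qed.

Lemma repsB c d : ps 1 c -> ps 1 d ->
  reps (fun n => c n - d n) = (fun z => reps c z - reps d z).
Proof.
move=> pc pd; apply/funext => z; rewrite /reps; case: ifPn => [z1|_]; last by rewrite subr0.
by rewrite (psumB pc pd z1); case: (psum c z) => ? ?; case: (psum d z).
Qed.

(** Let F' be the derivative of the power series and L that of i Re F. The
    difference quotients of i Re F are imaginary along the real axis and
    real along the imaginary axis, so L = 0; but these quotients tend to
    i Re F' and to - Im F'. *)
Lemma imaginary_holomorphic_derivative w c : ps 1 c -> normc w < 1 ->
  derivable (fun z : R[i]^o => Complex 0 (reps c z) : R[i]^o) w 1 ->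
  psum (psderiv c) w = 0.
Proof.
move=> pc w1; rewrite /derivable.
set g := (X in cvg (X @ _)); set D := psum _ _ => /cvg_ex [/= L gL].
have gE h : g h = h^-1 * Complex 0 (reps c (w + h) - reps c w).
  rewrite /g /= /GRing.scale /= mulr1 [h + w]addrC.
  by congr (_ * _); apply/eqP; rewrite eq_complex /= subrr !eqxx.
have [M [e0 e0_gt0 H0]] := psum_qderiv pc w1.
have Dl h : normc h < e0 -> normc h < 1 - normc w ->
    `|reps c (w + h) - reps c w - complex.Re (h * D)| <= M * normc h ^+ 2.
  move=> he hw; rewrite !repsE//.
    apply: le_trans (H0 h he); apply: le_trans (le_Re_normc _).
    rewrite -/D; case: (psum c _) => ? ?; case: (psum c _) => ? ?.
    by case: (h * D).
  by apply: le_lt_trans (normcD _ _) _; rewrite -ltrBrDl.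
have small e : 0 < e -> exists s, [/\ 0 < s,
    normc (L - g (Complex s 0)) < e, normc (L - g (Complex 0 s)) < e,
    `|(reps c (w + Complex s 0) - reps c w) / s - complex.Re D| < e &
    `|(reps c (w + Complex 0 s) - reps c w) / s + complex.Im D| < e].
  move=> e_gt0.
  have /cvgrPdist_lt /(_ (Complex e 0)) := gL.
  rewrite ltcE /= eqxx => /(_ e_gt0) /nbhs_ballP [d /=].
  case: d => d id; rewrite ltcE /= => /andP[/eqP -> d0] Hd.
  have Hd' h : h != 0 -> normc h < d -> normc (L - g h) < e.
    move=> h0 hd; have := Hd h; rewrite -ball_normE /= sub0r normrN.
    by rewrite !normr_normcE !ltcE /= !eqxx /=; exact.
  have M1 : 0 < `|M| + 1 by rewrite ltr_wpDl.
  pose m := Num.min (Num.min d e0) (Num.min (1 - normc w) (e / (`|M| + 1))).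
  have m0 : 0 < m by rewrite !lt_min d0 e0_gt0 subr_gt0 w1 divr_gt0.
  pose s := m / 2; have s0 : 0 < s by rewrite divr_gt0.
  have : s < m by rewrite /s ltr_pdivrMr// ltr_pMr// ltr1n.
  rewrite !lt_min => /andP[/andP[sd se] /andP[sw sM]].
  have n1 : normc (Complex s 0) = s by rewrite normc_real gtr0_norm.
  have n2 : normc (Complex 0 s) = s by rewrite /normc expr0n add0r sqrtr_sqr gtr0_norm.
  have Ms : M * s ^+ 2 / s < e.
    rewrite expr2 mulrA mulfK ?gt_eqF//.
    apply: (@le_lt_trans _ _ ((`|M| + 1) * s)).
      by rewrite ler_wpM2r ?(ltW s0)// (le_trans (ler_norm _))// lerDl.
    by rewrite mulrC -ltr_pdivlMr.
  exists s; split => //.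
  - by apply: Hd'; rewrite ?n1// eq_complex /= eqxx andbT gt_eqF.
  - by apply: Hd'; rewrite ?n2// eq_complex /= eqxx /= gt_eqF.
  - apply: le_lt_trans Ms; rewrite ler_pdivlMr//.
    rewrite -[X in _ * X <= _](gtr0_norm s0) -normrM mulrBl divfK ?gt_eqF//.
    have := Dl (Complex s 0); rewrite n1 => /(_ se sw).
    have -> (q : R[i]) : complex.Re (Complex s 0 * q) = complex.Re q * s.
      by case: q => x y /=; ring.
    by [].
  - apply: le_lt_trans Ms; rewrite ler_pdivlMr//.
    rewrite -[X in _ * X <= _](gtr0_norm s0) -normrM mulrDl divfK ?gt_eqF//.
    have := Dl (Complex 0 s); rewrite n2 => /(_ se sw).
    have -> (q : R[i]) : complex.Re (Complex 0 s * q) = - (complex.Im q * s).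
      by case: q => x y /=; ring.
    by rewrite opprK.
have fin (e l1 l2 q1 q2 x y : R) : `|l1 - 0| < e -> `|l2 - q1| < e ->
    `|l1 - q2| < e -> `|l2 - 0| < e -> `|q1 - x| < e -> `|q2 + y| < e ->
    `|x| < 3 * e /\ `|y| < 3 * e.
  rewrite !subr0 !ltr_norml => /andP[? ?] /andP[? ?] /andP[? ?].
  by move=> /andP[? ?] /andP[? ?] /andP[? ?]; split; apply/andP; split; lra.
have ReD e : 0 < e -> `|complex.Re D| < 3 * e /\ `|complex.Im D| < 3 * e.
  move=> /small [s [s0 h1 h2 h3 h4]].
  have sn0 : s != 0 by rewrite gt_eqF.
  move: h1; rewrite gE; set y1 := reps c _ - _ in h3 *.
  have -> : (Complex s 0)^-1 * Complex 0 y1 = Complex 0 (y1 / s).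
    have s1 : Complex s 0 != 0 by rewrite eq_complex /= eqxx andbT.
    apply: (mulfI s1); rewrite mulrA divff// mul1r.
    by apply/eqP; rewrite eq_complex /=; apply/andP; split; apply/eqP; field.
  move: h2; rewrite gE; set y2 := reps c _ - _ in h4 *.
  have -> : (Complex 0 s)^-1 * Complex 0 y2 = Complex (y2 / s) 0.
    have s1 : Complex 0 s != 0 by rewrite eq_complex /= eqxx.
    apply: (mulfI s1); rewrite mulrA divff// mul1r.
    by apply/eqP; rewrite eq_complex /=; apply/andP; split; apply/eqP; field.
  case: (L) => l1 l2 H2 H1.
  have a1 : `|l1 - 0| < e := le_lt_trans (le_Re_normc _) H1.
  have a2 : `|l2 - y1 / s| < e := le_lt_trans (le_Im_normc _) H1.
  have b1 : `|l1 - y2 / s| < e := le_lt_trans (le_Re_normc _) H2.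
  have b2 : `|l2 - 0| < e := le_lt_trans (le_Im_normc _) H2.
  exact: fin a1 a2 b1 b2 h3 h4.
have z x : (forall e, 0 < e -> `|x| < 3 * e) -> x = 0 :> R.
  move=> xe; apply/eqP; rewrite -normr_le0 leNgt; apply/negP => x0.
  have := xe (`|x| / 4); rewrite divr_gt0// => /(_ isT); lra.
have := z (complex.Re D) (fun e e_gt0 => proj1 (ReD e e_gt0)).
have := z (complex.Im D) (fun e e_gt0 => proj2 (ReD e e_gt0)).
by case: (D) => x y /= -> ->.
Qed.

(** Uniqueness of the conjugate: if k is the series of the difference of
    two conjugates, then i Re k is holomorphic, so k is constant, and its
    real part vanishes at 0. *)
Theorem harmonic_conj_reps c : ps 1 c -> complex.Im (c 0%N) = 0 ->
  harmonic_conj (reps c) = reps (fun n => - ii * c n).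
Proof.
move=> pc c0; have H := reps_conjugate pc c0.
have := xgetPex (cst 0) (ex_intro (harmonic_conjugate (reps c)) _ H).
rewrite -/(harmonic_conj _); move: (harmonic_conj _) => v [hv v0 dv].
have [_ v10 dv1] := H.
have [d [pd _ vE _]] := harmonic_psum hv.
have pe := psZ (- ii) pc; set e := (fun n => _) in pe v10 dv1 *.
pose k n := d n - e n; have pk : ps 1 k by exact: psB.
have kz w : normc w < 1 -> psum (psderiv k) w = 0.
  move=> w1; apply: imaginary_holomorphic_derivative => //.
  have -> : (fun z : R[i]^o => Complex 0 (reps k z) : R[i]^o) =
     (fun z => Complex (reps c z) (v z)) - (fun z => Complex (reps c z) (reps e z)).
    apply/funext => z; rewrite /k repsB// vE; apply/eqP.
    by rewrite eq_complex /= subrr !eqxx.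
  by apply: derivableB; [apply: dv|apply: dv1]; rewrite discE.
have kS n : k n.+1 = 0.
  have /eqP := ps_eq0 n ltr01 (ps_psderiv pk) kz.
  by rewrite mulf_eq0 pnatr_eq0/= => /eqP.
apply/funext => z; apply/eqP; rewrite -subr_eq0 {1}vE; apply/eqP.
have E := congr1 (fun f => f z) (repsB pd pe); rewrite /= -/k in E.
have E0 := congr1 (fun f => f 0) (repsB pd pe); rewrite /= -/k in E0.
rewrite -E /reps; case: ifP => // _; rewrite psum_cst//.
rewrite -vE v0 v10 subrr repsE ?normc0 ?psum0E// in E0.
Qed.

End representation.

(** * Growth of functions with bounded means of order less than 1 *)

Section hardy_littlewood.
Context {R : realType}.
Implicit Types (u : R[i] -> R) (c : nat -> R[i]) (p q r s : R) (z w : R[i]).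

Lemma powR_dist p (x y : R) : 0 < p < 1 -> 0 <= x -> 0 <= y ->
  `|x `^ p - y `^ p| <= `|x - y| `^ p.
Proof.
move=> p01; wlog xy : x y / y <= x.
  move=> H x0 y0; have [yx|xy] := leP y x; first exact: H.
  by rewrite distrC [`|x - y|]distrC; apply: H => //; exact: ltW.
move=> x0 y0; case/andP: (p01) => p0 p1.
rewrite ger0_norm ?subr_ge0; last by apply: ge0_ler_powR => //; exact: ltW.
rewrite [in leRHS]ger0_norm ?subr_ge0// lerBlDr -{1}[x](subrK y).
by apply: powR_subadd => //; rewrite subr_ge0.
Qed.

Lemma powR_small p (e : R) : 0 < p -> 0 < e ->
  exists2 d, 0 < d & forall x, 0 <= x <= d -> x `^ p <= e.
Proof.
move=> p0 e0; exists (e `^ p^-1); first exact: powR_gt0.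
move=> x /andP[x0 xd]; have -> : e = (e `^ p^-1) `^ p.
  by rewrite -powRrM mulVf ?gt_eqF// powRr1 ?ltW.
by apply: ge0_ler_powR; rewrite ?nnegrE ?(ltW p0) ?powR_ge0.
Qed.

Lemma continuous_norm_powR p (f : R -> R) : 0 < p < 1 -> continuous f ->
  continuous (fun t => `|f t| `^ p).
Proof.
move=> p01 cf t; have p0 : 0 < p by case/andP: p01.
apply/cvgrPdist_le => e e0; have [d d0 H] := powR_small p0 e0.
have /cvgrPdist_le /(_ d d0) := cf t; apply: filterS => s fd.
apply: le_trans (powR_dist p01 (normr_ge0 _) (normr_ge0 _)) _; apply: H.
by rewrite normr_ge0 (le_trans (ler_dist_dist _ _)).
Qed.

Definition pmean p u r := mean (fun t => `|u (circle r t)| `^ p).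

Lemma circle_meanE p u r : 0 < p < 1 -> continuous (fun t => u (circle r t)) ->
  circle_mean p u r = (pmean p u r)%:E.
Proof.
move=> p01 cu; rewrite /circle_mean /pmean /mean EFinM; congr (_ * _)%E.
rewrite /Rintegral fineK//.
have := continuous_norm_powR p01 cu => cp.
apply: (@integrable_fin_num _ (measurableTypeR R) R (@lebesgue_measure R)) => //.
apply: continuous_compact_integrable; first exact: segment_compact.
exact: continuous_subspaceT.
Qed.

Lemma pmean_ge0 p u r : 0 <= pmean p u r.
Proof. by apply: mean_ge0 => t; exact: powR_ge0. Qed.

(** The bounds on the coefficients are summed as a geometric series of
    ratio |z| / r. *)
Lemma psum_mean_bound u c z r : u = reps c -> ps 1 c -> 0 < r < 1 ->
  (forall n, normc (c n) * r ^+ n <= 4 * mean (fun t => `|u (circle r t)|)) ->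
  normc z < r ->
  normc (psum c z) <= 8 * mean (fun t => `|u (circle r t)|) / (r - normc z).
Proof.
move=> uc pc /andP[r0 r1] H zr; set m := mean _ in H *.
have g : geo (fun n => c n * z ^+ n) (4 * m) (normc z / r).
  split; first by rewrite divr_ge0 ?normc_ge0 ?(ltW r0)//= ltr_pdivrMr ?mul1r.
  move=> n; rewrite normcM normcX.
  have -> : normc z ^+ n = r ^+ n * (normc z / r) ^+ n.
    by rewrite -exprMn mulrC divfK ?gt_eqF.
  rewrite mulrA ler_wpM2r ?H// exprn_ge0// divr_ge0 ?normc_ge0//.
  exact: ltW.
apply: le_trans (normc_csum g) _.
have m0 : 0 <= m by exact: mean_ge0.
have -> : 2 * (4 * m) / (1 - normc z / r) = r * (8 * m / (r - normc z)).
  by field; rewrite !gt_eqF ?subr_gt0.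
apply: ler_piMl; last exact: ltW.
by apply: divr_ge0; [exact: mulr_ge0|rewrite subr_ge0 ltW].
Qed.

(** Let A be the supremum of the left-hand sides, finite by psum_mean_bound
    on a larger circle. On the circle halfway between |z| and R0, writing
    |u| = |u|^(1 - p) |u|^p bounds the mean of |u| by a multiple of
    A^(1 - p) S, and then psum_mean_bound bounds u z. The exponent p^-1 of
    the distance is the one for which all powers of the distance cancel,
    leaving A <= C S A^(1 - p), that is A^p <= C S. *)
Lemma hardy_littlewood p u c (R0 S : R) : 0 < p < 1 -> harmonic_disc u ->
  u = reps c -> ps 1 c ->
  (forall r, 0 < r < 1 -> forall n,
      normc (c n) * r ^+ n <= 4 * mean (fun t => `|u (circle r t)|)) ->
  0 < R0 < 1 -> (forall r, 0 < r < 1 -> pmean p u r <= S) ->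
  forall z, normc z < R0 ->
    `|u z| * (R0 - normc z) `^ p^-1 <= (8 * 2 `^ p^-1 * S) `^ p^-1.
Proof.
move=> p01 hu uc pc bc /andP[R00 R01] HS.
have /andP[p0 p1] := p01; pose a := p^-1.
have a0 : 0 < a by rewrite invr_gt0.
have h2 : 0 < (2^-1 : R) < 1 by apply/andP; split; lra.
have S0 : 0 <= S by apply: le_trans (HS _ h2); exact: pmean_ge0.
pose r1 := (1 + R0) / 2.
have r1_01 : 0 < r1 < 1 by rewrite /r1; apply/andP; split; lra.
have R0r1 : R0 < r1 by rewrite /r1; lra.
pose B := 8 * mean (fun t => `|u (circle r1 t)|) / (r1 - R0).
have m0 r : 0 <= mean (fun t => `|u (circle r t)|) by exact: mean_ge0.
have ule z : normc z < 1 -> `|u z| <= normc (psum c z).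
  by move=> z1; rewrite uc repsE//; exact: le_Re_normc.
have dle z : normc z < R0 -> (R0 - normc z) `^ a <= 1.
  move=> zR; have -> : 1 = 1 `^ a :> R by rewrite powR1.
  have := normc_ge0 z => z0.
  by apply: ge0_ler_powR; rewrite ?nnegrE ?(ltW a0)//; lra.
pose X := [set `|u z| * (R0 - normc z) `^ a | z in [set z | normc z < R0]].
have X0 : X !=set0 by exists (`|u 0| * (R0 - normc (0 : R[i])) `^ a), 0 => //=; rewrite normc0.
have XB : ubound X B.
  move=> _ [z /= zR <-].
  apply: (@le_trans _ _ (`|u z|)); first by rewrite ler_piMr// dle.
  have zr1 : normc z < r1 by exact: lt_trans R0r1.
  have /andP[_ r11] := r1_01.
  apply: le_trans (ule z (lt_trans zr1 r11)) _.
  apply: le_trans (psum_mean_bound uc pc r1_01 (bc _ r1_01) zr1) _.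
  rewrite /B; apply: ler_wpM2l; first by apply: mulr_ge0.
  by rewrite lef_pV2 ?posrE ?subr_gt0// lerD2l lerN2 ltW.
have supX : has_sup X by split => //; exists B.
pose A := sup X.
have XA z : normc z < R0 -> `|u z| * (R0 - normc z) `^ a <= A.
  by move=> zR; apply: sup_ubound; [case: supX|exists z].
have A0 : 0 <= A.
  apply: le_trans (XA 0 _); first by rewrite mulr_ge0 ?powR_ge0.
  by rewrite normc0.
have main z : normc z < R0 ->
    `|u z| * (R0 - normc z) `^ a <= 8 * 2 `^ a * S * A `^ (1 - p).
  (* Half the distance, so that the distances from z to the circle of radius
     r and from that circle to R0 are the same. *)
  move=> zR; pose d := (R0 - normc z) / 2.
  have d0 : 0 < d by rewrite divr_gt0// subr_gt0.
  pose r := R0 - d; have z0 := normc_ge0 z.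
  have r01 : 0 < r < 1 by rewrite /r /d; apply/andP; split; lra.
  have rz : r - normc z = d by rewrite /r /d; lra.
  have zr : normc z < r by rewrite -subr_gt0 rz.
  have /andP[r0 r11] := r01.
  have bound : mean (fun t => `|u (circle r t)|) <= (A / d `^ a) `^ (1 - p) * S.
    have cu : continuous (fun t => u (circle r t)).
      by apply: continuous_circle => //; rewrite r11 ltW.
    have cp := continuous_norm_powR p01 cu.
    apply: (@le_trans _ _ (mean (fun t => (A / d `^ a) `^ (1 - p) * `|u (circle r t)| `^ p))).
      apply: le_mean.
      - by move=> t; apply: cvg_norm; exact: cu.
      - by move=> t; apply: cvgM; [exact: cvg_cst|exact: cp].
      move=> t _.
      have nc : normc (circle r t) = r.
        by rewrite circleE normcM normc_cis mulr1 normc_real gtr0_norm.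
      have uA : `|u (circle r t)| <= A / d `^ a.
        rewrite ler_pdivlMr ?powR_gt0//; apply: le_trans (XA (circle r t) _).
          by rewrite nc (_ : R0 - r = d)// /r opprB addrC subrK.
        by rewrite nc /r ltrBlDr ltrDl.
      apply: (@le_trans _ _ (`|u (circle r t)| `^ (1 - p) * `|u (circle r t)| `^ p)).
        have [->|un0] := eqVneq (u (circle r t)) 0.
          by rewrite normr0 mulr_ge0 ?powR_ge0.
        by rewrite -powRD ?subrK ?powRr1 ?oner_eq0.
      rewrite ler_wpM2r ?powR_ge0//; apply: ge0_ler_powR => //.
      - by rewrite subr_ge0 ltW.
      - by rewrite nnegrE divr_ge0 ?powR_ge0.
    rewrite meanZ// ler_wpM2l ?powR_ge0//; exact: HS.
  have zd : R0 - normc z = 2 * d by rewrite /d; lra.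
  have dn0 : d != 0 by rewrite gt_eqF.
  rewrite zd (powRM _ _ (ltW d0))//.
  apply: (@le_trans _ _ ((8 * ((A / d `^ a) `^ (1 - p) * S) / d) * (2 `^ a * d `^ a))).
    apply: ler_wpM2r; first by rewrite mulr_ge0 ?powR_ge0.
    apply: le_trans (ule z (lt_trans zr r11)) _.
    apply: le_trans (psum_mean_bound uc pc r01 (bc _ r01) zr) _.
    rewrite rz; apply: ler_wpM2r; first by rewrite invr_ge0 ltW.
    by apply: ler_wpM2l.
  rewrite powRM ?invr_ge0 ?powR_ge0// -powR_inv1 ?powR_ge0// -!powRrM.
  have -> : d^-1 = d `^ (-1) by rewrite powR_inv1// ltW.
  have -> : 8 * (A `^ (1 - p) * d `^ (a * (-1 * (1 - p))) * S) * d `^ (-1) *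
      (2 `^ a * d `^ a) = 8 * 2 `^ a * S * A `^ (1 - p) *
      (d `^ (a * (-1 * (1 - p))) * d `^ (-1) * d `^ a) by ring.
  rewrite -!powRD ?dn0 ?implybT//.
  have -> : a * (-1 * (1 - p)) + -1 + a = 0.
    by rewrite /a; field; rewrite gt_eqF.
  by rewrite powRr0 mulr1.
have AA : A <= 8 * 2 `^ a * S * A `^ (1 - p).
  by apply: ge_sup => // _ [z zR <-]; exact: main.
have fin : A <= (8 * 2 `^ a * S) `^ a.
  have [->|An0] := eqVneq A 0; first exact: powR_ge0.
  have Ap : 0 < A by rewrite lt_neqAle eq_sym An0.
  have E : A = A `^ p * A `^ (1 - p).
    by rewrite -powRD ?An0 ?implybT// subrKC powRr1.
  rewrite {1}E ler_pM2r ?powR_gt0// in AA.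
  have -> : A = (A `^ p) `^ a by rewrite -powRrM divff ?gt_eqF// powRr1.
  apply: ge0_ler_powR; rewrite ?nnegrE ?(ltW a0) ?powR_ge0//.
  by rewrite !mulr_ge0 ?powR_ge0.
by move=> z zR; apply: le_trans (XA z zR) fin.
Qed.

(** hardy_littlewood bounds u on an intermediate circle; this bounds the
    coefficients of its series, which are those of the conjugate up to the
    factor - i. So the conjugate depends continuously on u, from h^p to
    uniform convergence on smaller discs. *)
Theorem harmonic_conj_bound p r : 0 < p < 1 -> 0 < r < 1 -> exists2 K, 0 <= K &
  forall u S, harmonic_disc u -> (forall s, 0 < s < 1 -> pmean p u s <= S) ->
  forall z, normc z <= r -> `|harmonic_conj u z| <= K * S `^ p^-1.
Proof.
move=> p01 /andP[r0 r1]; pose r2 := (1 + r) / 2; pose R0 := (1 + r2) / 2.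
have rr2 : r < r2 by rewrite /r2; lra.
have r2R : r2 < R0 by rewrite /R0 /r2; lra.
have r2_01 : 0 < r2 < 1 by rewrite /r2; apply/andP; split; lra.
have R0_01 : 0 < R0 < 1 by rewrite /R0 /r2; apply/andP; split; lra.
pose K0 := (8 * 2 `^ p^-1) `^ p^-1 / (R0 - r2) `^ p^-1.
have K00 : 0 <= K0 by rewrite divr_ge0 ?powR_ge0.
exists (8 * K0 / (r2 - r)); first by apply: divr_ge0; [exact: mulr_ge0|rewrite subr_ge0 ltW].
move=> u S hu HS z zr.
have h2 : 0 < (2^-1 : R) < 1 by apply/andP; split; lra.
have S0 : 0 <= S by apply: le_trans (HS _ h2); exact: pmean_ge0.
have [c [pc c0 uc bc]] := harmonic_psum hu.
have HL := hardy_littlewood p01 hu uc pc bc R0_01 HS.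
have /andP[r20 r21] := r2_01.
have um : mean (fun t => `|u (circle r2 t)|) <= K0 * S `^ p^-1.
  rewrite -[leRHS]mean_cst; apply: le_mean.
  - move=> t; apply: cvg_norm; apply: continuous_circle => //.
    by rewrite r21 ltW.
  - by move=> t; exact: cvg_cst.
  move=> t _; have nc : normc (circle r2 t) = r2.
    by rewrite circleE normcM normc_cis mulr1 normc_real gtr0_norm.
  have := HL (circle r2 t); rewrite nc => /(_ r2R).
  rewrite -ler_pdivlMr ?powR_gt0 ?subr_gt0// => /le_trans; apply.
  by rewrite powRM ?mulr_ge0 ?powR_ge0// /K0 mulrAC.
rewrite uc harmonic_conj_reps//.
have zr2 : normc z < r2 by exact: le_lt_trans rr2.
have z1 : normc z < 1 by exact: lt_trans r21.
rewrite repsE//; apply: le_trans (le_Re_normc _) _.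
rewrite (psum_Z _ pc z1) normcM normcNE.
have -> : normc ii = 1 :> R by rewrite /ii /normc expr0n expr1n add0r sqrtr1.
rewrite mul1r; apply: le_trans (psum_mean_bound uc pc r2_01 (bc _ r2_01) zr2) _.
have mm : 0 <= mean (fun t => `|u (circle r2 t)|) by exact: mean_ge0.
apply: (@le_trans _ _ (8 * (K0 * S `^ p^-1) / (r2 - r))); last first.
  by rewrite le_eqVlt; apply/orP; left; apply/eqP; ring.
apply: ler_pM; first exact: mulr_ge0.
- by rewrite invr_ge0 subr_ge0 ltW.
- by rewrite ler_pM2l.
by rewrite lef_pV2 ?posrE ?subr_gt0// lerD2l lerN2.
Qed.

End hardy_littlewood.

(** * Linearity of the conjugate and of the Hardy spaces *)

Section hardy_spaces.
Context {R : realType}.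
Implicit Types (u v f : R[i] -> R) (c d : nat -> R[i]) (q r s e x S : R).

Lemma repsDZ c d x : ps 1 c -> ps 1 d ->
  reps (fun n => c n + Complex x 0 * d n) = (fun z => reps c z + x * reps d z).
Proof.
move=> pc pd; apply/funext => z; rewrite /reps; case: ifPn => [z1|_].
  have := psum_linear 1 (Complex x 0) pc pd z1.
  have -> : (fun n => 1 * c n + Complex x 0 * d n) = (fun n => c n + Complex x 0 * d n).
    by apply/funext => n; rewrite mul1r.
  move=> ->; case: (psum c z) => a b; case: (psum d z) => a' b' /=.
  by rewrite !(mul1r, mul0r, subr0, mulr0).
by rewrite mulr0 addr0.
Qed.

(** By harmonic_conj_reps this is the linearity of the coefficients. *)
Lemma harmonic_conjDZ u v x : harmonic_disc u -> harmonic_disc v ->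
  harmonic_disc (fun z => u z + x * v z) /\
  harmonic_conj (fun z => u z + x * v z) =
    (fun z => harmonic_conj u z + x * harmonic_conj v z).
Proof.
move=> hu hv; have [c [pc c0 uc _]] := harmonic_psum hu.
have [d [pd d0 vd _]] := harmonic_psum hv.
have pe := psD pc (psZ (Complex x 0) pd).
have E : (fun z => u z + x * v z) = reps (fun n => c n + Complex x 0 * d n).
  by rewrite repsDZ// uc vd.
rewrite E; split; first exact: reps_harmonic.
rewrite harmonic_conj_reps//; last first.
  move: c0 d0; case: (c 0%N) => a b; case: (d 0%N) => a' b' /= -> ->.
  by rewrite mulr0 mul0r !addr0.
rewrite uc vd !harmonic_conj_reps// -repsDZ; try exact: psZ.
by congr reps; apply/funext => n; ring.
Qed.

Lemma harmonic_conj_harmonic u : harmonic_disc u -> harmonic_disc (harmonic_conj u).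
Proof.
move=> hu; have [c [pc c0 -> _]] := harmonic_psum hu.
by rewrite harmonic_conj_reps//; apply/reps_harmonic/psZ.
Qed.

Lemma harmonicB u v : harmonic_disc u -> harmonic_disc v ->
  harmonic_disc (u \- v) /\
  harmonic_conj (u \- v) = harmonic_conj u \- harmonic_conj v.
Proof.
move=> hu hv; have [H1 H2] := harmonic_conjDZ (-1) hu hv.
have E : u \- v = (fun z => u z + (-1) * v z).
  by apply/funext => z; rewrite mulN1r.
by rewrite E; split => //; rewrite H2; apply/funext => z; rewrite mulN1r.
Qed.

Lemma circle_mean_pmean q u r : 0 < q < 1 -> harmonic_disc u -> 0 < r < 1 ->
  circle_mean q u r = (pmean q u r)%:E.
Proof.
move=> q01 hu /andP[r0 r1]; apply: circle_meanE => //.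
by apply: continuous_circle => //; rewrite r1 ltW.
Qed.

Lemma hp_size_leP q u S : 0 < q < 1 -> harmonic_disc u ->
  (hp_size q u <= S%:E)%E <-> (forall r, 0 < r < 1 -> pmean q u r <= S).
Proof.
move=> q01 hu; split => [H r r01|H].
  by rewrite -lee_fin -circle_mean_pmean// (le_trans _ H)// circle_mean_le_size.
apply: ge_ereal_sup => _ [r /= rr <-]; rewrite in_itv/= in rr.
by rewrite circle_mean_pmean// lee_fin H.
Qed.

Lemma hp_bounded q u : 0 < q < 1 ->
  hp q u <-> harmonic_disc u /\ exists S, forall r, 0 < r < 1 -> pmean q u r <= S.
Proof.
move=> q01; split=> [[hu su]|[hu [S HS]]]; (split; first exact: hu).
  exists (fine (hp_size q u)); apply/hp_size_leP => //.
  by rewrite fineK// ge0_fin_numE// hp_size_ge0.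
by apply: le_lt_trans (ltry S); apply/hp_size_leP.
Qed.

(** Because |x|^s <= 1 + |x|^q when 0 < s <= q. *)
Lemma circle_mean_le1D q s u r : harmonic_disc u -> 0 < r < 1 -> 0 < s -> s <= q ->
  (circle_mean s u r <= 1 + circle_mean q u r)%E.
Proof.
move=> hu /andP[r0 r1] s0 sq; have q0 := lt_le_trans s0 sq.
have cu : continuous (fun t => u (circle r t)).
  by apply: continuous_circle => //; rewrite r1 ltW.
have -> : 1%E = (((2 * pi)^-1)%R%:E *
    \int[@lebesgue_measure R]_(t in `[(- pi)%R, pi%R]) 1%:E)%E.
  rewrite integral_cst//= lebesgue_measure_itv/= lte_fin gtrN ?pi_gt0//.
  rewrite -EFinB -!EFinM mul1r opprK.
  have -> : pi + pi = 2 * pi :> R by ring.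
  by rewrite mulVf// mulf_neq0// gt_eqF// pi_gt0.
rewrite /circle_mean -ge0_muleDr; first last.
- by apply: integral_ge0 => t _; rewrite lee_fin powR_ge0.
- by apply: integral_ge0 => t _; rewrite lee_fin.
apply: lee_wpmul2l; first by rewrite lee_fin pi2_ge0.
rewrite -ge0_integralD//; last exact: measurable_circle.
apply: ge0_le_integral => //.
- by apply: measurable_circle.
- by apply: emeasurable_funD => //; apply: measurable_circle.
move=> t _; rewrite -EFinD lee_fin.
have [x1|x1] := leP `|u (circle r t)| 1.
  apply: (@le_trans _ _ 1); last by rewrite lerDl powR_ge0.
  have -> : 1 = 1 `^ s :> R by rewrite powR1.
  by apply: ge0_ler_powR; rewrite ?nnegrE// ltW.
apply: (@le_trans _ _ (`|u (circle r t)| `^ q)); last by rewrite lerDr.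
by apply: ler_powR => //; exact: ltW.
Qed.

Lemma hp_size_le1D q s u : harmonic_disc u -> 0 < s -> s <= q ->
  (hp_size s u <= 1 + hp_size q u)%E.
Proof.
move=> hu s0 sq; apply: ge_ereal_sup => _ [r /= rr <-]; rewrite in_itv/= in rr.
apply: le_trans (circle_mean_le1D hu rr s0 sq) _.
by rewrite leeD2l// circle_mean_le_size.
Qed.

Lemma hp_mono q s u : 0 < s -> s <= q -> hp q u -> hp s u.
Proof.
move=> s0 sq [hu su]; split; first exact: hu.
apply: le_lt_trans (hp_size_le1D hu s0 sq) _.
exact: (lte_add_pinfty (ltry _) su).
Qed.

Lemma pmeanD q u v f r : 0 < q < 1 -> harmonic_disc u -> harmonic_disc v ->
  harmonic_disc f -> 0 < r < 1 -> (forall z, `|f z| <= `|u z| + `|v z|) ->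
  pmean q f r <= pmean q u r + pmean q v r.
Proof.
move=> q01 hu hv hf r01 H.
have r01' : 0 <= r < 1 by case/andP: r01 => r0 ->; rewrite ltW.
have := @circle_mean_le R q u v f r q01 (continuous_circle hu r01')
  (continuous_circle hv r01') (continuous_circle hf r01') H.
by rewrite !circle_mean_pmean// -EFinD lee_fin.
Qed.

Lemma pmeanZ q x u r : 0 < q < 1 -> harmonic_disc u -> 0 < r < 1 ->
  pmean q (fun z => x * u z) r = `|x| `^ q * pmean q u r.
Proof.
move=> q01 hu /andP[r0 r1]; rewrite /pmean -meanZ.
  by apply: eq_mean => t; rewrite normrM powRM.
apply: continuous_norm_powR => //; apply: continuous_circle => //.
by rewrite r1 ltW.
Qed.

Lemma hp_linear q u v x : 0 < q < 1 -> hp q u -> hp q v ->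
  hp q (fun z => u z + x * v z).
Proof.
move=> q01 /(hp_bounded _ q01) [hu [S HS]] /(hp_bounded _ q01) [hv [S' HS']].
have [hw _] := harmonic_conjDZ x hu hv.
have [hxv _] := harmonic_conjDZ (x - 1) hv hv.
apply/(hp_bounded _ q01); split => //.
exists (S + `|x| `^ q * S') => r r01.
have E : (fun z => v z + (x - 1) * v z) = (fun z => x * v z).
  by apply/funext => z; ring.
rewrite E in hxv.
apply: le_trans (pmeanD q01 hu hxv hw r01 _) _; first by move=> z; exact: ler_normD.
by apply: lerD; [exact: HS|rewrite pmeanZ// ler_wpM2l ?powR_ge0 ?HS'].
Qed.

End hardy_spaces.

(** * The intersection space: the countable intersection and density *)

Section intersection_space.
Context {R : realType} (p : nat -> R) (p01 : forall n, 0 < p n < 1).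
Implicit Types (u v : R[i] -> R) (q r e S : R).

Let term u v n : R :=
  2^-1 ^+ n.+1 * (hp_dist (p n) u v / (1 + hp_dist (p n) u v)).

Let half01 : 0 <= (2^-1 : R) < 1.
Proof. by apply/andP; split; lra. Qed.

Let d1 u v n : 0 < 1 + hp_dist (p n) u v.
Proof. by rewrite ltr_wpDr ?hp_dist_ge0. Qed.

Let term_ge0 u v n : 0 <= term u v n.
Proof.
by rewrite mulr_ge0 ?exprn_ge0 ?invr_ge0// divr_ge0 ?hp_dist_ge0// ltW.
Qed.

Lemma term_le_cap_dist u v n : term u v n <= cap_dist p u v.
Proof.
have cv := @is_cvg_cap_dist R p u v.
have nd : nondecreasing_seq (series (term u v)).
  by apply/nondecreasing_seqP => k; rewrite seriesSr lerDl.
apply: le_trans (nondecreasing_cvgn_le nd cv n.+1).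
rewrite seriesSr lerDr sumr_ge0//.
Qed.

Lemma hp_dist_small n e : 0 < e -> exists2 d, 0 < d &
  forall u v, cap_dist p u v < d -> hp_dist (p n) u v < e.
Proof.
move=> e0; exists (2^-1 ^+ n.+1 * (e / (1 + e))).
  by rewrite mulr_gt0 ?exprn_gt0 ?invr_gt0// divr_gt0// ltr_wpDr// ltW.
move=> u v /(le_lt_trans (term_le_cap_dist u v n)).
rewrite /term ltr_pM2l ?exprn_gt0 ?invr_gt0//.
rewrite ltr_pdivrMr ?d1// mulrAC ltr_pdivlMr; last by rewrite ltr_wpDr// ltW.
by rewrite !mulrDr !mulr1 [e * _]mulrC ltrD2r.
Qed.

(** The tail of the defining series is at most 2^-N, whatever the distances
    are. *)
Lemma cap_dist_le_sum u v N :
  cap_dist p u v <= \sum_(n < N) hp_dist (p n) u v + 2^-1 ^+ N.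
Proof.
have cv := @is_cvg_cap_dist R p u v.
apply: limr_le; first exact: cv.
exists N => // M /= NM.
have H : series (term u v) M - series (term u v) N <= 2^-1 ^+ N.
  rewrite sub_series_geq//.
  apply: (@le_trans _ _ (\sum_(N <= k < M) 2^-1 ^+ k.+1)).
    apply: ler_sum => k _; rewrite /term ler_piMr ?exprn_ge0 ?invr_ge0//.
    by rewrite ler_pdivrMr ?d1// mul1r lerDr.
  rewrite -{1}[N]add0n big_addn big_mkord.
  under eq_bigr do rewrite exprS addnC.
  rewrite -mulr_sumr.
  have := @sum_geo_le R 2^-1 N (M - N); move=> /(_ half01).
  have -> : 1 - 2^-1 = 2^-1 :> R by lra.
  by rewrite invrK; move: (\sum_(_ < _) _) (2^-1 ^+ N) => x y; lra.
have H2 : series (term u v) N <= \sum_(n < N) hp_dist (p n) u v.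
  rewrite /series/= big_mkord; apply: ler_sum => k _.
  have h0 := hp_dist_ge0 (p k) u v.
  rewrite /term; apply: (@le_trans _ _ (hp_dist (p k) u v / (1 + hp_dist (p k) u v))).
    apply: ler_piMl; first by rewrite divr_ge0// ltW.
    by rewrite exprn_ile1 ?invr_ge0// invf_le1// ler1n.
  by rewrite ler_pdivrMr ?d1// ler_peMr// lerDl.
by move: H H2; rewrite -[series _ M]/(series (term u v) M);
  move: (series _ M) (series _ N) (\sum_(_ < _) _) => x y w; lra.
Qed.

Lemma cap_hp_harmonic u : cap_hp u -> harmonic_disc u.
Proof. by move=> /(_ (p 0%N)); rewrite /= in_itv/= => /(_ (p01 0)) []. Qed.

Lemma hp_dist_le q u v S : 0 < q < 1 -> hp q u -> hp q v ->
  (forall r, 0 < r < 1 -> pmean q (u \- v) r <= S) -> hp_dist q u v <= S.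
Proof.
move=> q01 hu hv H; have [h _] := harmonicB hu.1 hv.1.
rewrite -lee_fin /hp_dist fineK; last exact: hp_sizeB_fin.
exact/hp_size_leP.
Qed.

Lemma pmean_le_hp_dist q u v r : 0 < q < 1 -> hp q u -> hp q v -> 0 < r < 1 ->
  pmean q (u \- v) r <= hp_dist q u v.
Proof.
move=> q01 hu hv r01; have [h _] := harmonicB hu.1 hv.1.
have : (hp_size q (u \- v)%R <= (hp_dist q u v)%:E)%E.
  by rewrite /hp_dist fineK//; exact: hp_sizeB_fin.
by move/(hp_size_leP _ q01 h); exact.
Qed.

Lemma cap_hp_linear u v x : cap_hp u -> cap_hp v ->
  cap_hp (fun z => u z + x * v z).
Proof.
move=> hu hv q /[dup] q01; rewrite /= in_itv/= => q01'.
exact: (hp_linear x q01' (hu q q01) (hv q q01)).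
Qed.

(** By cap_dist_le_sum finitely many exponents matter, and for each of them
    the distance is x ^ (p n) times a size of v. *)
Lemma cap_dist_small v e : cap_hp v -> 0 < e -> exists2 x, 0 < x &
  forall u, cap_hp u -> cap_dist p u (fun z => u z + x * v z) < e.
Proof.
move=> hv e0.
have [N HN] : exists N, 2^-1 ^+ N < e / 2 :> R.
  have := @geo_cvg0 R 1 2^-1 half01.
  have e2 : 0 < e / 2 by rewrite divr_gt0.
  move=> /cvgrPdist_lt /(_ _ e2) [N _ H]; exists N.
  have := H N (leqnn N); rewrite /= sub0r normrN mul1r.
  exact/le_lt_trans/ler_norm.
have e2 : 0 < e / 2 by rewrite divr_gt0.
have main M f : 0 < f -> exists2 x0, 0 < x0 & forall x, 0 < x <= x0 ->
    forall u, cap_hp u ->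
    \sum_(n < M) hp_dist (p n) u (fun z => u z + x * v z) <= f.
  elim: M f => [|M IH] f f0.
    by exists 1 => // x _ u _; rewrite big_ord0 ltW.
  have f2 : 0 < f / 2 by rewrite divr_gt0.
  have [x0 x00 Hx] := IH _ f2.
  have pM := p01 M.
  have pMi : p M \in `]0, 1[ by rewrite in_itv.
  have hvM : hp (p M) v by exact: hv.
  have /(hp_bounded _ pM) [hdv [S HS]] := hvM.
  have S1 : 0 < `|S| + 1 by rewrite ltr_wpDl.
  have pM0 : 0 < p M by case/andP: pM.
  have fS : 0 < f / 2 / (`|S| + 1) by rewrite divr_gt0.
  have [y0 y00 Hy] := powR_small pM0 fS.
  exists (Num.min x0 y0); first by rewrite lt_min x00.
  move=> x /andP[xpos]; rewrite le_min => /andP[xx xy] u hu.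
  rewrite big_ord_recr/= [f]splitr; apply: lerD.
    by apply: Hx => //; rewrite xpos.
  have huM : hp (p M) u by exact: hu.
  apply: (hp_dist_le pM huM (hp_linear x pM huM hvM)).
  move=> r r01; have -> : u \- (fun z => u z + x * v z) = (fun z => - x * v z).
    by apply/funext => z /=; ring.
  rewrite (pmeanZ _ pM hdv r01) normrN (gtr0_norm xpos).
  have yx : x `^ p M <= f / 2 / (`|S| + 1) by apply: Hy; rewrite (ltW xpos).
  apply: (@le_trans _ _ (f / 2 / (`|S| + 1) * (`|S| + 1))); last by rewrite divfK// gt_eqF.
  apply: ler_pM => //; rewrite ?powR_ge0 ?pmean_ge0//.
  by apply: le_trans (HS r r01) _; rewrite (le_trans (ler_norm _))// lerDl.
have [x x0 Hx] := main N _ e2; exists x => // u hu.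
apply: le_lt_trans (cap_dist_le_sum _ _ N) _.
rewrite [e]splitr; apply: ler_ltD => //.
by apply: Hx => //; rewrite x0 lexx.
Qed.

Let T := cap_hp_space p01.

Lemma cap_nbhsP (u : T) (A : set T) : nbhs u A <->
  exists2 e, 0 < e & forall v : T, cap_dist p (sval u) (sval v) < e -> A v.
Proof.
split=> [/nbhs_ballP [e /= e0 H]|[e e0 H]].
  by exists e => // v uv; apply: H; rewrite ballEmdist.
by apply/nbhs_ballP; exists e => // v; rewrite ballEmdist; exact: H.
Qed.

(** The intersection of these sets is conj_in_no_hp: the exponents tend to
    0 and the bounds to infinity, so that by hp_size_le1D belonging to all
    of them excludes every exponent. *)
Let big_conj n : set T :=
  [set u | (n%:R%:E < hp_size n.+2%:R^-1 (harmonic_conj (sval u)))%E].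

Let q01 n : 0 < (n.+2%:R^-1 : R) < 1.
Proof. by rewrite invr_gt0 ltr0n invf_lt1 ?ltr1n// ltr0n. Qed.

Let half_gap (a b c x : R) : a <= b + c -> c <= (a - x) / 2 -> x < a -> x < b.
Proof. by move=> ? ? ?; lra. Qed.

(** If a mean of the conjugate of u over the circle of radius r exceeds n,
    then harmonic_conj_bound makes the conjugates of all v near u uniformly
    close to it on that circle, and their means exceed n as well. *)
Lemma open_big_conj n : open (big_conj n).
Proof.
rewrite openE => u; rewrite /big_conj /= => un.
have hu := cap_hp_harmonic (svalP u); have hcu := harmonic_conj_harmonic hu.
set q := n.+2%:R^-1 in un *; have qq := q01 n; rewrite -/q in qq.
have [r r01 rn] : exists2 r, 0 < r < 1 & n%:R < pmean q (harmonic_conj (sval u)) r.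
  apply: contrapT => H; move: un; rewrite ltNge => /negP; apply.
  apply/hp_size_leP => // r r01; rewrite leNgt; apply/negP => h.
  by apply: H; exists r.
have [K K0 HK] := harmonic_conj_bound (p01 0) r01.
pose eta := pmean q (harmonic_conj (sval u)) r - n%:R.
have eta0 : 0 < eta by rewrite subr_gt0.
have q0 : 0 < q by case/andP: qq.
have eta2 : 0 < eta / 2 by rewrite divr_gt0.
have [y y0 Hy] := powR_small q0 eta2.
have K1 : 0 < K + 1 by rewrite ltr_wpDl.
have a0 : 0 < (p 0)^-1 by rewrite invr_gt0; case/andP: (p01 0).
have yK : 0 < y / (K + 1) by rewrite divr_gt0.
have [w w0 Hw] := powR_small a0 yK.
have [d d0 Hd] := hp_dist_small 0 w0.
apply/cap_nbhsP; exists d; first exact: d0.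
move=> v uv; apply: contrapT => /negP; rewrite -leNgt => vn.
have hv := cap_hp_harmonic (svalP v); have hcv := harmonic_conj_harmonic hv.
have [hB cB] := harmonicB hu hv.
have p0i : p 0 \in `]0, 1[ by rewrite in_itv; exact: p01.
have hpu : hp (p 0) (sval u) by exact: (svalP u (p 0%N) p0i).
have hpv : hp (p 0) (sval v) by exact: (svalP v (p 0%N) p0i).
pose D := hp_dist (p 0) (sval u) (sval v).
have Dw : D < w by exact: Hd.
have D0 : 0 <= D by exact: hp_dist_ge0.
have HD z : normc z <= r -> `|harmonic_conj (sval u \- sval v) z| <= y.
  move=> zr; apply: le_trans (HK _ D hB _ _ zr) _.
    by move=> s s01; apply: pmean_le_hp_dist.
  have DK : D `^ (p 0)^-1 <= y / (K + 1) by apply: Hw; rewrite D0 ltW.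
  apply: (@le_trans _ _ ((K + 1) * (y / (K + 1)))).
    by apply: ler_pM; rewrite ?powR_ge0 ?lerDl.
  by rewrite mulrC divfK// gt_eqF.
have hcB := harmonic_conj_harmonic hB.
have diff : pmean q (harmonic_conj (sval u \- sval v)) r <= eta / 2.
  rewrite -[leRHS]mean_cst; apply: le_mean.
  - apply: continuous_norm_powR => //; apply: continuous_circle => //.
    by case/andP: r01 => r0 ->; rewrite ltW.
  - by move=> t; exact: cvg_cst.
  move=> t _; apply: Hy; rewrite normr_ge0 HD// circleE normcM normc_cis mulr1.
  by rewrite normc_real gtr0_norm//; case/andP: r01.
have := (hp_size_leP _ qq hcv).1 vn r r01.
apply/negP; rewrite -ltNge.
have tri : pmean q (harmonic_conj (sval u)) r <=
    pmean q (harmonic_conj (sval v)) r + pmean q (harmonic_conj (sval u \- sval v)) r.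
  apply: (pmeanD qq hcv hcB hcu r01) => z; rewrite cB /= -{1}[harmonic_conj (sval u) z](subrK (harmonic_conj (sval v) z)).
  by rewrite addrC ler_normD.
exact: half_gap tri diff rn.
Qed.

Theorem Gdelta_conj_in_no_hp : Gdelta (conj_in_no_hp p01).
Proof.
exists big_conj; first exact: open_big_conj.
apply/seteqP; split => u.
  move=> Lu n _; rewrite /big_conj /= ltNge; apply/negP => H.
  have hcu := harmonic_conj_harmonic (cap_hp_harmonic (svalP u)).
  have q0 : 0 < n.+2%:R^-1 :> R by case/andP: (q01 n).
  apply: (Lu _ q0); split; first exact: hcu.
  exact: le_lt_trans H (ltry _).
move=> H q q0 hq.
have hcu := harmonic_conj_harmonic (cap_hp_harmonic (svalP u)).
pose s := Num.min q 2^-1.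
pose S := fine (hp_size q (harmonic_conj (sval u))).
have SE : hp_size q (harmonic_conj (sval u)) = S%:E.
  by rewrite /S fineK// ge0_fin_numE ?hp_size_ge0//; case: hq.
pose n := (Num.truncn (`|S| + q^-1)).+1.
have nS : `|S| + q^-1 < n%:R by rewrite /n; exact: truncnS_gt.
have : (n.+1%:R%:E < hp_size n.+3%:R^-1 (harmonic_conj (sval u)))%E := H n.+1 I.
rewrite ltNge => /negP; apply.
have qn : n.+3%:R^-1 <= q.
  rewrite -[leRHS]invrK lef_pV2 ?posrE ?invr_gt0//.
  have qn : q^-1 <= n%:R by apply: le_trans (ltW nS); rewrite lerDr normr_ge0.
  by apply: (le_trans qn); rewrite ler_nat -addn3 leq_addr.
have n0 : 0 < n.+3%:R^-1 :> R by rewrite invr_gt0.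
apply: le_trans (hp_size_le1D hcu n0 qn) _.
rewrite SE -EFinD lee_fin -natr1 addrC lerD2r.
apply: le_trans (ler_norm _) (le_trans _ (ltW nS)).
by rewrite lerDl invr_ge0 ltW.
Qed.

Let scalar_recover (a b x : R) : 0 < x ->
  a + x * b + -1 * a + (x^-1 - 1) * (a + x * b + -1 * a) = b.
Proof. by move=> x0; field; rewrite gt_eqF. Qed.

(** If the conjugates of u and of u + x v were both in some h^q, then so
    would be that of v, by linearity. *)
Theorem dense_conj_in_no_hp : conj_in_no_hp p01 !=set0 -> dense (conj_in_no_hp p01).
Proof.
move=> [v Lv] O [u Ou] Oo.
have [Lu|nLu] := pselect (conj_in_no_hp p01 u); first by exists u.
have /cap_nbhsP [e e0 He] : nbhs u O by exact: (open_nbhs_nbhs (conj Oo Ou)).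
have [x x0 Hx] := cap_dist_small (svalP v) e0.
have hw := cap_hp_linear x (svalP u) (svalP v).
pose w : T := exist _ _ hw.
exists w; split; first by apply: He; apply: Hx; exact: svalP.
move=> q q0 hq; apply: nLu => q' q'0 hq'.
pose s := Num.min (Num.min q q') 2^-1.
have s0 : 0 < s by rewrite !lt_min q0 q'0 invr_gt0 ltr0n.
have s01 : 0 < s < 1.
  by rewrite s0 /= /s gt_min invf_lt1 ?ltr1n ?orbT.
have sq : s <= q by rewrite /s !ge_min lexx.
have sq' : s <= q' by rewrite /s !ge_min lexx orbT.
have hu := cap_hp_harmonic (svalP u); have hv := cap_hp_harmonic (svalP v).
have [_ E] := harmonic_conjDZ x hu hv.
apply: (Lv _ s0).
have h := hp_linear (- 1) s01 (hp_mono s0 sq hq) (hp_mono s0 sq' hq').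
(* The difference h of the two conjugates is x times the conjugate of v;
   adding x^-1 - 1 times h to it divides it by x. *)
have h' := hp_linear (x^-1 - 1) s01 h h.
suff F : (fun z => harmonic_conj (sval w) z + -1 * harmonic_conj (sval u) z +
    (x^-1 - 1) * (harmonic_conj (sval w) z + -1 * harmonic_conj (sval u) z)) =
    harmonic_conj (sval v) by exact: (eq_ind _ (hp s) h' _ F).
apply/funext => z; have -> : harmonic_conj (sval w) z =
  harmonic_conj (sval u) z + x * harmonic_conj (sval v) z.
  exact: (congr1 (fun f => f z) E).
exact: scalar_recover.
Qed.

End intersection_space.

(** * Two integrals over a period *)

Section doubling.
Context {R : realType}.
Implicit Types (f : R -> R) (t : R).

(** The interval starts at - 4 pi to leave room for the doubled angle and
    for shifts by a period. *)
Lemma antiderivative f : continuous f -> exists F : R -> R,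
  forall t, - (4 * pi) < t -> is_derive t 1 F (f t).
Proof.
move=> cf; exists (fun x => \int[@lebesgue_measure R]_(t in `[- (4 * pi), x]) f t) => t ta.
have tt : t < t + 1 by rewrite ltrDl.
have fi : (@lebesgue_measure R).-integrable `[- (4 * pi), t + 1] (EFin \o f).
  apply: continuous_compact_integrable; first exact: segment_compact.
  exact: continuous_subspaceT.
have [dF <-] := continuous_FTC1_closed tt fi ta (cf t).
by rewrite derive1E; exact: derivableP.
Qed.

(** Substitution followed by periodicity, both read off a primitive of f. *)
Lemma mean_double f : continuous f -> (forall t, f (t + 2 * pi) = f t) ->
  mean (fun t => f (2 * t)) = mean f.
Proof.
move=> cf per; have [F dF] := antiderivative cf; have pp := pi_gt0 R.
have c2 : continuous (fun t : R => f (2 * t)).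
  move=> t; apply: (@continuous_comp _ _ _ (fun t : R => 2 * t) f); last exact: cf.
  by apply: cvgM; [exact: cvg_cst|exact: cvg_id].
have d2 t : - (2 * pi) < t < 2 * pi ->
    is_derive t 1 (fun t : R => 2^-1 * F (2 * t)) (f (2 * t)).
  move=> /andP[t1 t2].
  have dl : is_derive t 1 (fun t : R => 2 * t) 2.
    by apply: is_derive_eq; rewrite /GRing.scale /= ?(mulr1, mulr0, addr0).
  have dF2 : is_derive (2 * t) 1 F (f (2 * t)) by apply: dF; lra.
  have dFc := is_derive1_comp dF2 dl.
  have h : 2^-1 *: (f (2 * t) * 2) = f (2 * t) by rewrite /GRing.scale /= mulrC mulfK.
  exact: (is_derive_eq (is_deriveZ 2^-1 dFc) h).
have shift_const x y : - (2 * pi) <= x -> x < y ->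
    F (x + 2 * pi) - F x = F (y + 2 * pi) - F y.
  move=> x2 xy.
  have dG t : - (4 * pi) < t -> is_derive t 1 (fun t => F (t + 2 * pi) - F t) 0.
    move=> t4.
    have ds : is_derive t 1 (fun t : R => t + 2 * pi) 1.
      by apply: is_derive_eq; rewrite ?addr0.
    have dF1 : is_derive (t + 2 * pi) 1 F (f (t + 2 * pi)) by apply: dF; lra.
    have dFc := @is_derive1_comp R F (fun t => t + 2 * pi) t _ _ dF1 ds.
    have h : f (t + 2 * pi) * 1 - f t = 0 by rewrite mulr1 per subrr.
    exact: (is_derive_eq (is_deriveB dFc (dF t t4)) h).
  have [z||c _] := @MVT R (fun t => F (t + 2 * pi) - F t) (fun=> 0) x y xy.
  - by rewrite in_itv/= => /andP[xz _]; apply: dG; lra.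
  - apply: derivable_within_continuous => z; rewrite in_itv/= => /andP[xz _].
    by have [] : is_derive z 1 (fun t => F (t + 2 * pi) - F t) 0 by apply: dG; lra.
  - by rewrite mul0r => /eqP; rewrite subr_eq0 => /eqP.
have e1 : F (- (2 * pi) + 2 * pi) - F (- (2 * pi)) = F (- pi + 2 * pi) - F (- pi).
  by apply: shift_const; lra.
have e2 : F (- (2 * pi) + 2 * pi) - F (- (2 * pi)) = F (0 + 2 * pi) - F 0.
  by apply: shift_const; lra.
have d1 t : - (2 * pi) < t < 2 * pi -> is_derive t 1 F (f t).
  by move=> /andP[t1 _]; apply: dF; lra.
rewrite (mean_FTC c2 d2) (mean_FTC cf d1).
congr (_ * _); move: e1 e2.
have -> : - (2 * pi) + 2 * pi = 0 :> R by ring.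
have -> : - pi + 2 * pi = pi :> R by ring.
by rewrite add0r mulrN => e1 e2; lra.
Qed.

(** The bound does not depend on d. Let Y be the integrand and
    F s = sin (s / 2) Y s. On the interval
    1 <= cos (s / 2) + sin (s / 2)^2; the second term times Y is at most 1,
    and the first times Y is at most 2 / (1 - b) times the derivative of F,
    whose mean is known from the end points. *)
Lemma mean_regularized_power (d b : R) : 0 < d -> 0 < b < 1 ->
  mean (fun s => (d ^+ 2 + (1 - cos s) / 2) `^ (- (b / 2))) <= 2 / (1 - b) + 1.
Proof.
move=> d0 /andP[b0 b1].
pose X s : R := d ^+ 2 + sin (s / 2) ^+ 2.
have X0 s : 0 < X s by rewrite ltr_wpDr ?sqr_ge0 ?exprn_gt0.
pose Y s : R := X s `^ (- (b / 2)).
have Y0 s : 0 <= Y s by exact: powR_ge0.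
have E s : d ^+ 2 + (1 - cos s) / 2 = X s.
  have {1}-> : s = (s / 2) *+ 2 by rewrite mulr2n -splitr.
  rewrite cos_mulr2n cos2sin2 /X; congr (_ + _); rewrite mulr2n; lra.
pose F s : R := sin (s / 2) * Y s.
pose F1 s : R := 2^-1 * cos (s / 2) * Y s * (1 - b * (sin (s / 2) ^+ 2 / X s)).
have dhalf (s : R) : is_derive s 1 (fun s : R => s / 2) 2^-1.
  have -> : (fun s : R => s / 2) = (fun s => 2^-1 * s) by apply/funext => t; rewrite mulrC.
  by apply: is_derive_eq; rewrite /GRing.scale /= ?(mulr1, mulr0, addr0).
have dsin (s : R) : is_derive s 1 (fun s : R => sin (s / 2)) (cos (s / 2) * 2^-1).
  exact: (@is_derive1_comp R (@sin R) (fun s : R => s / 2) s _ _ (is_derive_sin (s / 2)) (dhalf s)).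
have dX (s : R) : is_derive s 1 X (2 * sin (s / 2) * (cos (s / 2) * 2^-1)).
  have -> : X = cst (d ^+ 2) + (fun s : R => sin (s / 2)) ^+ 2.
    by apply/funext => t.
  have dsq := is_deriveX 2 (dsin s).
  apply: (is_derive_eq (is_deriveD (is_derive_cst (d ^+ 2 : R) s 1) dsq)).
  by rewrite /GRing.scale /= add0r expr1.
have dY (s : R) : is_derive s 1 Y (- (b / 2) * X s `^ (- (b / 2) - 1) *
    (2 * sin (s / 2) * (cos (s / 2) * 2^-1))).
  exact: (@is_derive1_comp R (@powR R ^~ (- (b / 2))) X s _ _
    (is_derive1_powR (- (b / 2)) (X0 s)) (dX s)).
have dF (s : R) : is_derive s 1 F (F1 s).
  have Xn0 : X s != 0 by rewrite gt_eqF.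
  have P : X s `^ (- (b / 2) - 1) = Y s / X s.
    by rewrite powRB ?Xn0 ?implybT// powRr1// ltW.
  apply: is_derive_eq (is_deriveM (dsin s) (dY s)) _.
  by rewrite P /GRing.scale /= /F1; field.
have cY : continuous Y.
  move=> s; apply: differentiable_continuous; apply/derivable1_diffP.
  by case: (dY s).
have cc : continuous (fun s : R => cos (s / 2)).
  move=> s; apply: (@continuous_comp _ _ _ (fun s : R => s / 2) cos).
    by apply: cvgM; [exact: cvg_id|exact: cvg_cst].
  exact: continuous_cos.
have csin : continuous (fun s : R => sin (s / 2)).
  by move=> s; apply: differentiable_continuous; apply/derivable1_diffP; case: (dsin s).
have cX : continuous X.
  by move=> s; apply: differentiable_continuous; apply/derivable1_diffP; case: (dX s).
have cF1 : continuous F1.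
  move=> s; apply: cvgM.
    by apply: cvgM; [apply: cvgM; [exact: cvg_cst|exact: cc]|exact: cY].
  apply: cvgB; first exact: cvg_cst.
  apply: cvgM; first exact: cvg_cst.
  apply: cvgM; first by apply: cvgM; exact: csin.
  by apply: cvgV; [rewrite gt_eqF|exact: cX].
have Y1 s : 1 <= X s -> Y s <= 1.
  move=> X1; rewrite -[leRHS](powRr0 (X s)); apply: ler_powR => //.
  by rewrite oppr_le0 divr_ge0// ltW.
have mF1 : mean F1 <= 1.
  rewrite (mean_FTC cF1 (fun s _ => dF s)) /F mulNr sinN sin_pihalf.
  have pi2 : 2 <= pi :> R by have := pihalf_ge1 R; lra.
  have Ypi : Y pi <= 1 by apply: Y1; rewrite /X sin_pihalf expr1n lerDr sqr_ge0.
  have YNpi : Y (- pi) <= 1.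
    by apply: Y1; rewrite /X mulNr sinN sin_pihalf sqrrN expr1n lerDr sqr_ge0.
  have p2 : 0 < 2 * pi :> R by lra.
  by rewrite mulrC ler_pdivrMr// mul1r mulN1r opprK mul1r; lra.
have main s : - pi <= s <= pi -> Y s <= 2 / (1 - b) * F1 s + 1.
  move=> spi.
  have c0 : 0 <= cos (s / 2).
    by apply: cos_ge0_pihalf; case/andP: spi => h1 h2; apply/andP; split; lra.
  have sq : cos (s / 2) ^+ 2 + sin (s / 2) ^+ 2 = 1 := cos2Dsin2 _.
  have c1 : cos (s / 2) <= 1 by exact: cos_le1.
  have le1 : 1 <= cos (s / 2) + sin (s / 2) ^+ 2.
    by rewrite -[leLHS]sq lerD2r expr2 ler_piMl.
  have XsY : sin (s / 2) ^+ 2 * Y s <= 1.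
    have [Xle|Xgt] := leP (X s) 1.
      apply: (@le_trans _ _ (X s * Y s)).
        by rewrite ler_wpM2r// /X lerDr sqr_ge0.
      have -> : X s * Y s = X s `^ (1 - b / 2).
        by rewrite powRD ?(gt_eqF (X0 s)) ?implybT// powRr1// ltW.
      rewrite -[leRHS](powRr0 (X s)); apply: ger_powR; first by rewrite X0.
      by lra.
    rewrite -[leRHS]mulr1; apply: ler_pM; rewrite ?sqr_ge0//; last exact/Y1/ltW.
  have F1Y : (1 - b) / 2 * (cos (s / 2) * Y s) <= F1 s.
    have -> : (1 - b) / 2 * (cos (s / 2) * Y s) = 2^-1 * cos (s / 2) * Y s * (1 - b) by ring.
    rewrite /F1 ler_wpM2l ?mulr_ge0// lerD2l lerN2 ler_piMr ?(ltW b0)//.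
    by rewrite ler_pdivrMr// mul1r /X lerDr sqr_ge0.
  apply: (@le_trans _ _ (cos (s / 2) * Y s + sin (s / 2) ^+ 2 * Y s)).
    by rewrite -mulrDl ler_peMl.
  apply: lerD => //.
  have -> : cos (s / 2) * Y s = 2 / (1 - b) * ((1 - b) / 2 * (cos (s / 2) * Y s)).
    by field; rewrite gt_eqF// subr_gt0.
  by rewrite ler_wpM2l// divr_ge0// subr_ge0 ltW.
rewrite (eq_mean (g := Y)); last by move=> s; rewrite E.
apply: (@le_trans _ _ (mean (fun s => 2 / (1 - b) * F1 s + 1))).
  apply: le_mean => //.
  move=> s; apply: cvgD; last exact: cvg_cst.
  by apply: cvgM; [exact: cvg_cst|exact: cF1].
rewrite meanD; [|by move=> s; apply: cvgM; [exact: cvg_cst|exact: cF1]|by move=> s; exact: cvg_cst].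
rewrite mean_cst lerD2r meanZ// ler_piMr// divr_ge0// subr_ge0; exact: ltW.
Qed.
End doubling.

(** * Power series with signs depending on the 2-adic valuation *)

Section dyadic_series.
Context {R : realType}.
Implicit Types (eps : nat -> bool) (z w : R[i]) (n k : nat) (r t p : R).

Definition sgc (b : bool) : R[i] := if b then 1 else -1.

Lemma normc_sgc b : normc (sgc b) = 1.
Proof. by case: b; rewrite /sgc ?normcNE normc1. Qed.

(** Since the sign depends on the 2-adic valuation of n, the sum of the
    series is the sum over k of sgc (eps k) * koebe_odd (z ^+ (2 ^ k)). *)
Definition dyadic eps n : R[i] := if n is 0%N then 0 else sgc (eps (logn 2 n)).

Lemma normc_dyadic eps n : normc (dyadic eps n) <= 1.
Proof. by case: n => [|n]; rewrite /dyadic ?normc0// normc_sgc. Qed.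

Lemma ps_dyadic eps : ps 1 (dyadic eps).
Proof.
move=> s /andP[s0 s1]; exists 1 => n; apply: mulr_ile1.
- exact: normc_ge0.
- exact: exprn_ge0.
- exact: normc_dyadic.
- by apply: exprn_ile1 => //; exact: ltW.
Qed.

Lemma geo_dyadic eps z : normc z < 1 -> geo (fun n => dyadic eps n * z ^+ n) 1 (normc z).
Proof.
move=> z1; split; first by rewrite normc_ge0.
move=> n; rewrite normcM normcX ler_wpM2r ?exprn_ge0 ?normc_ge0//.
exact: normc_dyadic.
Qed.

Lemma csum_even_odd (a : nat -> R[i]) M s : geo a M s ->
  csum a = csum (fun n => a n.*2) + csum (fun n => a n.*2.+1).
Proof.
move=> ga; have M0 := geo_ge0 ga; have [/andP[s0 s1] H] := ga.
have s01 : 0 <= s < 1 by rewrite s0.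
have le2 n m : (n <= m)%N -> M * s ^+ m <= M * s ^+ n.
  by move=> nm; rewrite ler_wpM2l// ler_wiXn2l// ltW.
have nn n : (n <= n.*2)%N by rewrite -addnn leq_addr.
have ge : geo (fun n => a n.*2) M s.
  by split => // n; apply: le_trans (H _) (le2 _ _ (nn n)).
have go : geo (fun n => a n.*2.+1) M s.
  by split => // n; apply: le_trans (H _) (le2 _ _ (leqW (nn n))).
rewrite -(csumD ge go); apply/esym.
apply: (@csum_unique _ _ _ (2 * M / (1 - s)) s) => // n.
have -> : \sum_(i < n) (a i.*2 + a i.*2.+1) = \sum_(i < n.*2) a i.
  elim: n => [|n IH]; first by rewrite !big_ord0.
  by rewrite big_ord_recr/= IH doubleS 2!big_ord_recr/= addrA.
apply: le_trans (csum_tail n.*2 ga) _.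
rewrite ler_wpM2l ?ler_wiXn2l ?(ltW s1)//.
by rewrite divr_ge0 ?mulr_ge0// subr_ge0 ltW.
Qed.

Lemma csum_geometric w : normc w < 1 -> csum (fun n => w ^+ n) = (1 - w)^-1.
Proof.
move=> w1; have w1' : 1 - w != 0.
  by rewrite subr_eq0; apply/eqP => E; rewrite -E normc1 ltxx in w1.
apply: (@csum_unique _ _ _ (normc (1 - w)^-1) (normc w)); first by rewrite normc_ge0.
move=> n; have -> : (1 - w)^-1 - \sum_(i < n) w ^+ i = (1 - w)^-1 * w ^+ n.
  elim: n => [|n IH]; first by rewrite big_ord0 subr0 expr0 mulr1.
  by rewrite big_ord_recr /= opprD addrA IH exprS; field.
by rewrite normcM normcX.
Qed.

(** The sum of the odd powers of z, and the square root transform of the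
    Koebe function. *)
Definition koebe_odd z : R[i] := z / (1 - z ^+ 2).

Definition shift_signs eps k := eps k.+1.

Lemma normc_sqr_lt1 z : normc z < 1 -> normc (z ^+ 2) < 1.
Proof. by move=> z1; rewrite normcX expr_lt1// normc_ge0. Qed.

(** Odd exponents have valuation 0, and halving an even exponent lowers its
    valuation by 1. *)
Lemma dyadic_step eps z : normc z < 1 ->
  psum (dyadic eps) z =
  sgc (eps 0%N) * koebe_odd z + psum (dyadic (shift_signs eps)) (z ^+ 2).
Proof.
move=> z1; have z21 := normc_sqr_lt1 z1.
rewrite /psum (csum_even_odd (geo_dyadic eps z1)) addrC; congr (_ + _).
  have -> : (fun n => dyadic eps n.*2.+1 * z ^+ n.*2.+1) =
      (fun n => sgc (eps 0%N) * z * (z ^+ 2) ^+ n).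
    apply/funext => n; rewrite /dyadic lognE /= dvdn2 /= odd_double /= exprS.
    by rewrite -exprM mul2n mulrA.
  rewrite (csumZ (M := 1) (s := normc (z ^+ 2))).
    by rewrite csum_geometric// /koebe_odd mulrA.
  split; first by rewrite normc_ge0.
  by move=> n; rewrite normcX mul1r.
congr csum; apply/funext => -[|n]; first by rewrite /= !mul0r.
rewrite -exprM mul2n; congr (_ * _).
rewrite /dyadic doubleS /shift_signs; congr sgc; congr eps.
by rewrite -doubleS -mul2n lognM// logn_prime.
Qed.

Lemma normc_dyadic_le eps z : normc z <= 2^-1 -> normc (psum (dyadic eps) z) <= 4.
Proof.
move=> z2; have z1 : normc z < 1 by apply: le_lt_trans z2 _; lra.
apply: le_trans (normc_csum (geo_dyadic eps z1)) _; rewrite mulr1.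
rewrite ler_pdivrMr ?subr_gt0//; lra.
Qed.

Lemma circle_sqr r t : circle r t ^+ 2 = circle (r ^+ 2) (2 * t).
Proof. by rewrite !circleE exprMn cisX; congr (_ * _); rewrite !expr2; simpc. Qed.

Lemma normc_circle r t : 0 <= r -> normc (circle r t) = r.
Proof. by move=> r0; rewrite circleE normcM normc_cis mulr1 normc_real ger0_norm. Qed.

Lemma circle_periodic r t : circle r (t + 2 * pi) = circle r t.
Proof.
by rewrite /circle mulrDl mul1r addrA !(cosDpi, sinDpi) !opprK.
Qed.

Lemma normc_koebe_denom z :
  normc (1 - z ^+ 2) ^+ 2 = (1 - normc z ^+ 2) ^+ 2 + 4 * complex.Im z ^+ 2.
Proof.
rewrite !normc_sqr; case: z => x y /=; ring.
Qed.

Lemma Re_koebe_odd z : normc z < 1 ->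
  complex.Re (koebe_odd z) =
  complex.Re z * (1 - normc z ^+ 2) / normc (1 - z ^+ 2) ^+ 2.
Proof.
move=> z1; have : 1 - z ^+ 2 != 0.
  by rewrite subr_eq0; apply/eqP => E; have := normc_sqr_lt1 z1; rewrite -E normc1 ltxx.
rewrite /koebe_odd !normc_sqr; case: z z1 => x y _ nz.
have : (1 - (x * x - y * y)) ^+ 2 + (x * y + y * x) ^+ 2 != 0.
  apply: contra nz; rewrite paddr_eq0 ?sqr_ge0// !sqrf_eq0 => /andP[/eqP h1 /eqP h2].
  by rewrite expr2 eq_complex /= h1 h2 ?(sub0r, oppr0) !eqxx.
rewrite expr2 /= add0r sqrrN => nz'.
by field.
Qed.

End dyadic_series.

(** * Uniform bounds for all choices of signs *)

Section dyadic_upper_bound.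
Context {R : realType}.
Implicit Types (eps : nat -> bool) (z w : R[i]) (n k : nat) (r t p d : R).

Lemma ccont_circle r : ccont (circle r).
Proof.
have -> : circle r = (fun t => Complex r 0 * cis t) by apply/funext => t; rewrite circleE.
by apply: ccontM; [exact: ccont_cst|exact: ccont_cis].
Qed.

Lemma koebe_denom z : normc z < 1 -> 1 - z ^+ 2 != 0.
Proof.
move=> z1; rewrite subr_eq0; apply/eqP => E.
by have := normc_sqr_lt1 z1; rewrite -E normc1 ltxx.
Qed.

Lemma ccont_koebe (f : R -> R[i]) : ccont f -> (forall t, normc (f t) < 1) ->
  ccont (fun t => koebe_odd (f t)).
Proof.
move=> cf f1; apply: ccontM => //; apply: ccontV.
  by move=> t; exact: koebe_denom.
have -> : (fun t => 1 - f t ^+ 2) = (fun t => 1 + (-1) * (f t) ^+ 2).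
  by apply/funext => t; rewrite mulN1r.
by apply: ccontD (ccont_cst _) _; apply: ccontM (ccont_cst _) _; exact: ccontX.
Qed.

Lemma continuous_regularized d (b : R) : 0 < d ->
  continuous (fun s : R => (d ^+ 2 + (1 - cos s) / 2) `^ b).
Proof.
move=> d0 s.
have X0 : 0 < d ^+ 2 + (1 - cos s) / 2.
  by rewrite ltr_wpDr ?exprn_gt0// divr_ge0// subr_ge0 cos_le1.
apply: (@continuous_comp _ _ _ (fun s : R => d ^+ 2 + (1 - cos s) / 2) (@powR R ^~ b)).
  apply: cvgD; first exact: cvg_cst.
  apply: cvgM; last exact: cvg_cst.
  by apply: cvgB; [exact: cvg_cst|exact: continuous_cos].
apply: differentiable_continuous; apply/derivable1_diffP.
by have [] := is_derive1_powR b X0.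
Qed.

(** With d = 1 - r^2 and X = d^2 + sin (t)^2, one has |Re g| <= d / X on
    the circle. Since X >= d^2, the power X^-p is at most
    d^(b - 2 p) X^(- b / 2); the choice b = p (2 - p) < 1 makes
    mean_regularized_power applicable and leaves a positive power of d. *)
Lemma koebe_mean p r : 0 < p < 1 -> 2^-1 < r < 1 ->
  mean (fun t => `|complex.Re (koebe_odd (circle r t))| `^ p) <=
  (2 / (1 - p * (2 - p)) + 1) * (1 - r ^+ 2) `^ (p * (1 - p)).
Proof.
move=> p01 /andP[r2 r1]; have /andP[p0 p1] := p01.
have r0 : 0 < r by lra.
pose d := 1 - r ^+ 2; pose b := p * (2 - p).
have rr1 : r ^+ 2 < 1 by rewrite expr_lt1// ltW.
have d0 : 0 < d by rewrite subr_gt0.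
have b0 : 0 < b by rewrite mulr_gt0// subr_gt0; lra.
have b1 : b < 1.
  have -> : b = 1 - (1 - p) ^+ 2 by rewrite /b; ring.
  by rewrite ltrBlDr ltrDl exprn_gt0// subr_gt0.
pose phi (s : R) := (d ^+ 2 + (1 - cos s) / 2) `^ (- (b / 2)).
have cphi : continuous phi by exact: continuous_regularized.
have mphi : mean (fun t => phi (2 * t)) <= 2 / (1 - b) + 1.
  rewrite mean_double//.
    by apply: mean_regularized_power => //; rewrite b0.
  by move=> t; rewrite /phi (_ : t + 2 * pi = t + pi + pi) ?cosDpi ?opprK//; ring.
have nc t : normc (circle r t) = r by rewrite normc_circle// ltW.
have c1 : continuous (fun t => complex.Re (koebe_odd (circle r t))).
  have [] // := @ccont_koebe (circle r) (ccont_circle r).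
  by move=> t; rewrite nc.
have c2 : continuous (fun t => phi (2 * t)).
  move=> t; apply: (@continuous_comp _ _ _ (fun t : R => 2 * t) phi); last exact: cphi.
  by apply: cvgM; [exact: cvg_cst|exact: cvg_id].
apply: (@le_trans _ _ (mean (fun t => d `^ (p * (1 - p)) * phi (2 * t)))); last first.
  by rewrite meanZ// mulrC ler_wpM2r// powR_ge0.
apply: le_mean.
- exact: continuous_norm_powR.
- by move=> t; apply: cvgM; [exact: cvg_cst|exact: c2].
move=> t _; set z := circle r t.
have z1 : normc z < 1 by rewrite nc.
pose X := d ^+ 2 + sin t ^+ 2.
have dX : d ^+ 2 <= X by rewrite lerDl sqr_ge0.
have d20 : 0 < d ^+ 2 by rewrite exprn_gt0.
have X0 : 0 < X by exact: lt_le_trans dX.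
have XE : d ^+ 2 + (1 - cos (2 * t)) / 2 = X.
  have -> : 2 * t = t *+ 2 by rewrite mulr2n; ring.
  by rewrite cos_mulr2n cos2sin2 /X mulr2n; lra.
have NX : X <= normc (1 - z ^+ 2) ^+ 2.
  rewrite normc_koebe_denom nc lerD2l /=.
  rewrite exprMn mulrA -[leLHS]mul1r ler_wpM2r ?sqr_ge0//.
  have -> : 4 * r ^+ 2 = (2 * r) ^+ 2 by ring.
  by rewrite expr_ge1//; lra.
have gX : `|complex.Re (koebe_odd z)| <= d / X.
  rewrite Re_koebe_odd// nc !normrM normfV !(ger0_norm (ltW d0)).
  rewrite [X in _ / X](ger0_norm (sqr_ge0 _)).
  apply: (@le_trans _ _ (1 * d / normc (1 - z ^+ 2) ^+ 2)).
    apply: ler_wpM2r; first by rewrite invr_ge0 sqr_ge0.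
    apply: ler_wpM2r; first exact: ltW.
    rewrite -normrM; apply: le_trans (le_Re_normc z) _; by rewrite nc ltW.
  rewrite mul1r; apply: ler_wpM2l; first exact: ltW.
  by rewrite lef_pV2// posrE (lt_le_trans X0).
apply: (@le_trans _ _ ((d / X) `^ p)).
  by apply: ge0_ler_powR; rewrite ?nnegrE ?(ltW p0) ?divr_ge0 ?(ltW d0) ?(ltW X0).
rewrite /phi XE powRM ?invr_ge0 ?(ltW d0) ?(ltW X0)//.
have Xn0 : X != 0 by rewrite gt_eqF.
have dn0 : d != 0 by rewrite gt_eqF.
have -> : (X^-1) `^ p = X `^ (- (p - b / 2)) * X `^ (- (b / 2)).
  rewrite -powRD ?Xn0 ?implybT// -powR_inv1 ?(ltW X0)// -powRrM.
  by congr (_ `^ _); lra.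
rewrite mulrA ler_wpM2r ?powR_ge0//.
have pp : 0 <= p * p by rewrite mulr_ge0// ltW.
have e0 : 0 <= p - b / 2 by rewrite /b; lra.
have -> : d `^ (p * (1 - p)) = d `^ p * (d ^+ 2) `^ (- (p - b / 2)).
  rewrite -powR_mulrn ?(ltW d0)// -powRrM -powRD ?dn0 ?implybT//.
  by congr (_ `^ _); rewrite /b; lra.
rewrite ler_wpM2l ?powR_ge0// !powRN lef_pV2 ?posrE ?powR_gt0//.
by apply: ge0_ler_powR; rewrite ?nnegrE ?(ltW d20) ?(ltW X0).
Qed.

(** Each dyadic_step costs C (1 - r^2)^de. As long as r > 1/2, passing from
    r to r^2 multiplies 1 - r^2 by at least 5/4, so these costs telescope
    against C' (1 - (1 - r^2)^de). *)
Lemma dyadic_pmean_bounded p : 0 < p < 1 -> exists B : R,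
  forall eps r, 0 < r < 1 -> pmean p (reps (dyadic eps)) r <= B.
Proof.
move=> p01; have /andP[p0 p1] := p01.
pose de := p * (1 - p); have de0 : 0 < de by rewrite mulr_gt0// subr_gt0.
pose C : R := 2 / (1 - p * (2 - p)) + 1.
have C0 : 0 <= C.
  have -> : C = 2 / (1 - p) ^+ 2 + 1 by rewrite /C; congr (2 / _ + 1); ring.
  by rewrite addr_ge0// divr_ge0// sqr_ge0.
have k1 : 1 < (5 / 4) `^ de.
  have h : 1 < 5 / 4 :> R by lra.
  rewrite -[ltLHS](_ : 1 `^ de = 1); last by rewrite powR1.
  by apply: gt0_ltr_powR; rewrite ?nnegrE ?divr_ge0.
have k0 : 0 < (5 / 4) `^ de - 1 by rewrite subr_gt0.
pose C' := C / ((5 / 4) `^ de - 1).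
have C'0 : 0 <= C' by rewrite divr_ge0// ltW.
have psi r : 0 < r < 1 -> 0 < 1 - r ^+ 2 <= 1.
  move=> /andP[r0 r1]; rewrite subr_gt0 expr_lt1 ?(ltW r0)// r1 /=.
  by rewrite lerBlDr lerDl sqr_ge0.
have psi1 r : 0 < r < 1 -> (1 - r ^+ 2) `^ de <= 1.
  move=> /psi /andP[x0 x1]; rewrite -[leRHS](_ : 1 `^ de = 1); last by rewrite powR1.
  by apply: ge0_ler_powR; rewrite ?nnegrE ?(ltW de0) ?(ltW x0).
have small eps r : 0 < r < 1 -> r <= 2^-1 -> pmean p (reps (dyadic eps)) r <= 4.
  move=> /andP[r0 r1] r2; rewrite -[leRHS]mean_cst; apply: le_mean.
  - apply: continuous_norm_powR => //; apply: continuous_circle.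
      exact/reps_harmonic/ps_dyadic.
    by rewrite r1 ltW.
  - by move=> t; exact: cvg_cst.
  move=> t _; have nc : normc (circle r t) = r by rewrite normc_circle// ltW.
  apply: (@le_trans _ _ (4 `^ p)); last by apply: ler1_powR; [rewrite ler1n|exact: ltW].
  apply: ge0_ler_powR; rewrite ?nnegrE ?(ltW p0)// repsE ?nc//.
  by apply: le_trans (le_Re_normc _) _; rewrite normc_dyadic_le// nc.
have step eps r : 2^-1 < r < 1 -> pmean p (reps (dyadic eps)) r <=
    C * (1 - r ^+ 2) `^ de + pmean p (reps (dyadic (shift_signs eps))) (r ^+ 2).
  move=> r21; have /andP[r2 r1] := r21; have r0 : 0 < r by lra.
  have rr01 : 0 <= r ^+ 2 < 1 by rewrite sqr_ge0 expr_lt1// ltW.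
  have nc t : normc (circle r t) = r by rewrite normc_circle// ltW.
  have cu : continuous (fun t => reps (dyadic eps) (circle r t)).
    by apply: continuous_circle; [exact/reps_harmonic/ps_dyadic|rewrite r1 ltW].
  have cs : continuous (fun t => reps (dyadic (shift_signs eps)) (circle (r ^+ 2) t)).
    by apply: continuous_circle => //; exact/reps_harmonic/ps_dyadic.
  have cg : continuous (fun t => complex.Re (koebe_odd (circle r t))).
    by have [] // := @ccont_koebe (circle r) (ccont_circle r); move=> t; rewrite nc.
  pose psi2 t := `|reps (dyadic (shift_signs eps)) (circle (r ^+ 2) t)| `^ p.
  have cpsi : continuous psi2 by exact: (continuous_norm_powR p01 cs).
  have c2 : continuous (fun t => psi2 (2 * t)).
    move=> t; apply: (@continuous_comp _ _ _ (fun t : R => 2 * t) psi2); last exact: cpsi.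
    by apply: cvgM; [exact: cvg_cst|exact: cvg_id].
  have per t : psi2 (t + 2 * pi) = psi2 t by rewrite /psi2 circle_periodic.
  have -> : pmean p (reps (dyadic (shift_signs eps))) (r ^+ 2) =
      mean (fun t => psi2 (2 * t)).
    by rewrite (mean_double cpsi per).
  have cgp := continuous_norm_powR p01 cg.
  apply: le_trans (lerD (koebe_mean p01 r21) (lexx _)); rewrite -meanD//.
  apply: le_mean.
  - exact: (continuous_norm_powR p01 cu).
  - by move=> t; apply: cvgD; [exact: cgp|exact: c2].
  move=> t _; apply: le_trans (powR_subadd p01 (normr_ge0 _) (normr_ge0 _)).
  apply: ge0_ler_powR; rewrite ?nnegrE ?(ltW p0) ?addr_ge0//.
  have z1 : normc (circle r t) < 1 by rewrite nc.
  rewrite -circle_sqr !repsE ?normc_sqr_lt1// dyadic_step//.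
  set g := koebe_odd _; set h := psum _ _.
  have -> : complex.Re (sgc (eps 0%N) * g + h) =
     (if eps 0%N then 1 else -1) * complex.Re g + complex.Re h.
    by rewrite /sgc; case: (eps 0%N); case: (g) => x y; case: (h) => x' y' /=; ring.
  apply: le_trans (ler_normD _ _) _; rewrite normrM.
  by case: (eps 0%N); rewrite ?normrN normr1 mul1r.
have key K : forall eps r, 0 < r < 1 -> r ^+ (2 ^ K) <= 2^-1 ->
    pmean p (reps (dyadic eps)) r <= 4 + C' * (1 - (1 - r ^+ 2) `^ de).
  elim: K => [|K IH] eps r r01 rK; have /andP[r0 r1] := r01.
    rewrite expn0 expr1 in rK; apply: le_trans (small eps r r01 rK) _.
    by rewrite lerDl mulr_ge0// subr_ge0 psi1.
  have [r2|r2] := leP r 2^-1.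
    apply: le_trans (small eps r r01 r2) _.
    by rewrite lerDl mulr_ge0// subr_ge0 psi1.
  have r21 : 0 < r ^+ 2 < 1 by rewrite exprn_gt0// expr_lt1// ltW.
  have := IH (shift_signs eps) (r ^+ 2) r21; rewrite -exprM -expnS => /(_ rK) ih.
  have st : 2^-1 < r < 1 by rewrite r2.
  apply: le_trans (step eps r st) (le_trans (lerD (lexx _) ih) _).
  set x := 1 - r ^+ 2; have /andP[x0 x1] := psi r r01.
  have yx : x `^ de * (5 / 4) `^ de <= (1 - r ^+ 2 ^+ 2) `^ de.
    rewrite -powRM ?(ltW x0)//; apply: ge0_ler_powR; rewrite ?nnegrE ?(ltW de0)//.
    - by rewrite mulr_ge0 ?(ltW x0).
    - by rewrite subr_ge0 exprn_ile1 ?sqr_ge0// ltW//; case/andP: r21.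
    have -> : 1 - r ^+ 2 ^+ 2 = x * (1 + r ^+ 2) by rewrite /x; ring.
    rewrite ler_pM2l//; have r24 : 2^-1 ^+ 2 <= r ^+ 2.
      by apply: lerXn2r; rewrite ?nnegrE ?(ltW r0) ?(ltW r2)// invr_ge0.
    by move: r24; rewrite expr2; lra.
  have CE : C = C' * ((5 / 4) `^ de - 1) by rewrite /C' divfK// gt_eqF.
  have fin (a b c k : R) : 0 <= c -> a * k <= b ->
      c * (k - 1) * a + (4 + c * (1 - b)) <= 4 + c * (1 - a).
    move=> c0 ab; have := ler_wpM2l c0 ab; rewrite -subr_ge0 => h.
    rewrite -subr_ge0; apply: le_trans h _; rewrite le_eqVlt; apply/orP; left.
    by apply/eqP; ring.
  by rewrite CE; apply: fin.
exists (4 + C') => eps r r01; have /andP[r0 r1] := r01.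
have [K rK] : exists K, r ^+ (2 ^ K) <= 2^-1.
  have r01' : 0 <= r < 1 by rewrite r1 ltW.
  have h2 : 0 < 2^-1 :> R by rewrite invr_gt0.
  have /cvgrPdist_le /(_ _ h2) [N _ H] := geo_cvg0 1 r01'; exists N.
  have := H N (leqnn N); rewrite /= sub0r normrN mul1r => rN.
  apply: le_trans (le_trans (ler_norm _) rN).
  by apply: ler_wiXn2l; rewrite ?(ltW r0) ?(ltW r1)// ltnW// ltn_expl.
apply: le_trans (key K eps r r01 rK) _.
by rewrite lerD2l ler_piMr// lerBlDr lerDl powR_ge0.
Qed.

End dyadic_upper_bound.

(** * Averages over signs *)

Section sign_average.
Context {R : realType}.
Implicit Types (c z s : R[i]) (cs : seq R[i]) (Phi Psi : R[i] -> R) (q : R).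

(** The mean over all choices of signs is taken one sign at a time, the
    recursion that good_signs follows. *)
Fixpoint sign_avg cs Phi s : R :=
  if cs is c :: cs' then (sign_avg cs' Phi (s + c) + sign_avg cs' Phi (s - c)) / 2 else Phi s.

Lemma le_sign_avg cs Phi Psi s : (forall z, Phi z <= Psi z) -> sign_avg cs Phi s <= sign_avg cs Psi s.
Proof.
move=> H; elim: cs s => [|c cs IH] s /=; first exact: H.
by rewrite ler_wpM2r ?invr_ge0// lerD.
Qed.

Lemma sign_avg_linear cs Phi Psi (a b : R) s :
  sign_avg cs (fun z => a * Phi z + b * Psi z) s = a * sign_avg cs Phi s + b * sign_avg cs Psi s.
Proof. by elim: cs s => [|c cs IH] s //=; rewrite !IH; ring. Qed.

Definition energy cs : R := \sum_(c <- cs) normc c ^+ 2.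

Lemma energy_ge0 cs : 0 <= energy cs.
Proof. by apply: sumr_ge0 => c _; rewrite sqr_ge0. Qed.

Lemma energy_cons c cs : energy (c :: cs) = normc c ^+ 2 + energy cs.
Proof. by rewrite /energy big_cons. Qed.

Let dot s c : R := complex.Re s * complex.Re c + complex.Im s * complex.Im c.

Lemma normc_sqrD s c : normc (s + c) ^+ 2 = normc s ^+ 2 + normc c ^+ 2 + 2 * dot s c.
Proof. by rewrite !normc_sqr /dot; case: s => ? ?; case: c => ? ? /=; ring. Qed.

Lemma normc_sqrB s c : normc (s - c) ^+ 2 = normc s ^+ 2 + normc c ^+ 2 - 2 * dot s c.
Proof. by rewrite !normc_sqr /dot; case: s => ? ?; case: c => ? ? /=; ring. Qed.

Lemma dot_le s c : dot s c ^+ 2 <= normc s ^+ 2 * normc c ^+ 2.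
Proof.
rewrite !normc_sqr /dot; case: s => x y; case: c => x' y' /=.
rewrite -subr_ge0 [leRHS](_ : _ = (x * y' - y * x') ^+ 2) ?sqr_ge0//; ring.
Qed.

Lemma sign_avg_square cs s : sign_avg cs (fun z => normc z ^+ 2) s = normc s ^+ 2 + energy cs.
Proof.
elim: cs s => [|c cs IH] s /=; first by rewrite /energy big_nil addr0.
by rewrite !IH normc_sqrD normc_sqrB energy_cons; field.
Qed.

(** Adding a term c raises the right-hand side at least as much as the
    fourth moment, by the Cauchy-Schwarz inequality dot_le. *)
Lemma sign_avg_fourth cs s : sign_avg cs (fun z => (normc z ^+ 2) ^+ 2) s <=
  (normc s ^+ 2) ^+ 2 + 6 * normc s ^+ 2 * energy cs + 3 * energy cs ^+ 2.
Proof.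
elim: cs s => [|c cs IH] s /=.
  by rewrite /energy big_nil expr0n !mulr0 !addr0.
rewrite ler_pdivrMr//; apply: le_trans (lerD (IH _) (IH _)) _.
rewrite normc_sqrD normc_sqrB energy_cons.
have D := dot_le s c; have W0 := energy_ge0 cs.
have n0 := sqr_ge0 (normc s); have m0 := sqr_ge0 (normc c).
move: (normc s ^+ 2) (normc c ^+ 2) (dot s c) (energy cs) D W0 n0 m0.
move=> S C d W D W0 S0 C0.
rewrite -subr_ge0.
have -> : (S ^+ 2 + 6 * S * (C + W) + 3 * (C + W) ^+ 2) * 2 -
   ((S + C + 2 * d) ^+ 2 + 6 * (S + C + 2 * d) * W + 3 * W ^+ 2 +
    ((S + C - 2 * d) ^+ 2 + 6 * (S + C - 2 * d) * W + 3 * W ^+ 2)) =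
   8 * (S * C - d ^+ 2) + 4 * C ^+ 2 by ring.
by rewrite addr_ge0// mulr_ge0// ?subr_ge0 ?sqr_ge0.
Qed.

(** For y = |z| / A one has y^q >= y^2 - y^4. Averaging with A^2 = 6 W, the
    second moment W and the bound 3 W^2 on the fourth moment leave
    1/6 - 1/12 = 1/12. *)
Lemma sign_avg_powR_ge cs s q (V : R) : 0 < q < 1 -> 0 < V ->
  V <= normc s ^+ 2 + energy cs ->
  (6 * V) `^ (q / 2) / 12 <= sign_avg cs (fun z => normc z `^ q) s.
Proof.
move=> /andP[q0 q1] V0; set W := _ + energy cs => VW.
have W0 : 0 < W by exact: lt_le_trans VW.
pose A := Num.sqrt (6 * W).
have W6 : 0 < 6 * W by rewrite mulr_gt0.
have A0 : 0 < A by rewrite sqrtr_gt0.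
have A2 : A ^+ 2 = 6 * W by rewrite sqr_sqrtr// ltW.
have pt z : A `^ q * (A ^- 2 * normc z ^+ 2 + - (A ^- 2) ^+ 2 * (normc z ^+ 2) ^+ 2) <=
    normc z `^ q.
  pose y := normc z / A.
  have y0 : 0 <= y by rewrite divr_ge0 ?normc_ge0 ?ltW.
  have -> : normc z = A * y by rewrite /y mulrC divfK// gt_eqF.
  rewrite powRM ?(ltW A0)//.
  have -> : A ^- 2 * (A * y) ^+ 2 + - A ^- 2 ^+ 2 * ((A * y) ^+ 2) ^+ 2 =
      y ^+ 2 - y ^+ 4 by field; rewrite gt_eqF.
  rewrite ler_wpM2l ?powR_ge0//.
  have [->|yn0] := eqVneq y 0; first by rewrite !expr0n subr0 powR_ge0.
  have yp : 0 < y by rewrite lt_neqAle eq_sym yn0.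
  have [y1|y1] := leP y 1.
    apply: (@le_trans _ _ (y ^+ 2)); first by rewrite gerBl exprn_ge0.
    rewrite -powR_mulrn//; apply: ger_powR; first by rewrite yp.
    by apply: ltW; apply: lt_trans q1 _; rewrite ltr1n.
  apply: le_trans (powR_ge0 _ _); rewrite subr_le0.
  by apply: ler_weXn2l => //; exact: ltW.
have := le_sign_avg cs s pt; apply: le_trans.
have -> : (fun z => A `^ q * (A ^- 2 * normc z ^+ 2 + - (A ^- 2) ^+ 2 * (normc z ^+ 2) ^+ 2)) =
    (fun z => (A `^ q * A ^- 2) * normc z ^+ 2 + (- (A `^ q * (A ^- 2) ^+ 2)) * (normc z ^+ 2) ^+ 2).
  by apply/funext => z; ring.
rewrite sign_avg_linear sign_avg_square -/W.
have F : sign_avg cs (fun z => (normc z ^+ 2) ^+ 2) s <= 3 * W ^+ 2.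
  apply: le_trans (sign_avg_fourth cs s) _.
  have S0 := sqr_ge0 (normc s); rewrite /W.
  move: (normc s ^+ 2) (energy cs) S0 => S e S0; rewrite -subr_ge0.
  have -> : 3 * (S + e) ^+ 2 - (S ^+ 2 + 6 * S * e + 3 * e ^+ 2) = 2 * S ^+ 2 by ring.
  by rewrite mulr_ge0// sqr_ge0.
rewrite A2; move: (sign_avg _ _ _) F => f F.
have E : (6 * V) `^ (q / 2) <= A `^ q.
  have -> : A `^ q = (6 * W) `^ (q / 2).
    by rewrite -A2 -powR_mulrn ?(ltW A0)// -powRrM; congr (_ `^ _); field.
  apply: ge0_ler_powR; rewrite ?nnegrE ?(ltW W6) ?divr_ge0 ?(ltW q0) ?mulr_ge0 ?(ltW V0)//.
  by rewrite ler_pM2l.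
apply: (@le_trans _ _ (A `^ q / 12)); first by rewrite ler_wpM2r.
have -> : A `^ q / 12 = A `^ q * (6 * W)^-1 * W + - (A `^ q * (6 * W)^-1 ^+ 2) * (3 * W ^+ 2).
  by field; rewrite gt_eqF.
rewrite lerD2l !mulNr lerN2; apply: ler_wpM2l => //.
by rewrite mulr_ge0 ?powR_ge0// sqr_ge0.
Qed.

Fixpoint signed_sum (e : seq bool) cs s : R[i] :=
  if cs is c :: cs' then
    signed_sum (behead e) cs' (s + sgc (head true e) * c) else s.

Implicit Types (Cs : seq (R -> R[i])) (S : R -> R[i]) (t : R).

Definition eval_at Cs t := [seq (C t : R[i]) | C <- Cs].

Lemma continuous_normc_powR q S : 0 < q < 1 -> ccont S ->
  continuous (fun t => normc (S t) `^ q).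
Proof.
move=> q01 cS; have := continuous_norm_powR q01 (ccont_normc cS).
have -> : (fun t => `|normc (S t)| `^ q) = (fun t => normc (S t) `^ q).
  by apply/funext => t; rewrite ger0_norm ?normc_ge0.
by [].
Qed.

Definition all_ccont Cs := forall i, (i < size Cs)%N -> ccont (nth (fun=> 0) Cs i).

Lemma ccontB f g : @ccont R f -> ccont g -> ccont (fun t => f t - g t).
Proof.
move=> cf cg; have -> : (fun t => f t - g t) = (fun t => f t + (-1) * g t).
  by apply/funext => t; rewrite mulN1r.
by apply: ccontD => //; apply: ccontM => //; exact: ccont_cst.
Qed.

Lemma continuous_sign_avg q Cs S : 0 < q < 1 -> all_ccont Cs -> ccont S ->
  continuous (fun t => sign_avg (eval_at Cs t) (fun z => normc z `^ q) (S t)).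
Proof.
move=> q01; elim: Cs S => [|C Cs IH] S aC cS; first exact: continuous_normc_powR.
have aC' : all_ccont Cs by move=> i; exact: (aC i.+1).
have cC : ccont C by exact: (aC 0%N).
move=> t /=; apply: cvgM; last exact: cvg_cst.
by apply: cvgD; [exact: (IH _ aC' (ccontD cS cC))|exact: (IH _ aC' (ccontB cS cC))].
Qed.

(** At each step, the better of the two signs does at least as well as
    their average. *)
Lemma good_signs q Cs S (B : R) : 0 < q < 1 -> all_ccont Cs -> ccont S ->
  B <= mean (fun t => sign_avg (eval_at Cs t) (fun z => normc z `^ q) (S t)) ->
  exists2 e, size e = size Cs & B <= mean (fun t => normc (signed_sum e (eval_at Cs t) (S t)) `^ q).
Proof.
move=> q01; elim: Cs S => [|C Cs IH] S aC cS HB; first by exists [::].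
have aC' : all_ccont Cs by move=> i; exact: (aC i.+1).
have cC : ccont C by exact: (aC 0%N).
pose X t := sign_avg (eval_at Cs t) (fun z => normc z `^ q) (S t + C t).
pose Y t := sign_avg (eval_at Cs t) (fun z => normc z `^ q) (S t - C t).
have cX : continuous X by exact: (continuous_sign_avg q01 aC' (ccontD cS cC)).
have cY : continuous Y by exact: (continuous_sign_avg q01 aC' (ccontB cS cC)).
have E : mean (fun t => sign_avg (eval_at (C :: Cs) t) (fun z => normc z `^ q) (S t)) =
    2^-1 * (mean X + mean Y).
  rewrite -meanD// -meanZ; last by move=> t; apply: cvgD; [exact: cX|exact: cY].
  by apply: eq_mean => t; rewrite mulrC.
rewrite E in HB; have [XY|YX] := leP (mean Y) (mean X).
  have [|e se He] := IH _ aC' (ccontD cS cC).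
    by apply: le_trans HB _; rewrite -/X; move: XY; move: (mean X) (mean Y) => x y; lra.
  exists (true :: e); first by rewrite /= se.
  by under eq_mean do rewrite /= mul1r.
have [|e se He] := IH _ aC' (ccontB cS cC).
  by apply: le_trans HB _; rewrite -/Y; move: YX; move: (mean X) (mean Y) => x y; lra.
exists (false :: e); first by rewrite /= se.
by under eq_mean do rewrite /= mulN1r.
Qed.

End sign_average.

(** * A choice of signs with unbounded means of all small orders *)

Section unbounded_example.
Context {R : realType}.
Implicit Types (eps : nat -> bool) (e : seq bool) (z w : R[i]) (n k : nat) (r t q : R).

Lemma dyadic_iter eps z n : normc z < 1 ->
  psum (dyadic eps) z =
  \sum_(k < n) sgc (eps k) * koebe_odd (z ^+ (2 ^ k)) +
  psum (dyadic (fun k => eps (n + k)%N)) (z ^+ (2 ^ n)).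
Proof.
move=> z1; elim: n => [|n IH].
  by rewrite big_ord0 add0r expn0 expr1; congr (psum (dyadic _) _).
have zn : normc (z ^+ (2 ^ n)) < 1.
  by rewrite normcX exprn_ilt1// ?normc_ge0// expn_eq0.
have es : shift_signs (fun k => eps (n + k)%N) = (fun k => eps (n.+1 + k)%N).
  by apply/funext => k; rewrite /shift_signs addnS addSn.
have zE : (z ^+ (2 ^ n)) ^+ 2 = z ^+ (2 ^ n.+1) by rewrite -exprM -expnSr.
have e0 : sgc (eps (n + 0)%N) = sgc (eps n) :> R[i] by rewrite addn0.
rewrite IH (dyadic_step _ zn) es zE e0 addrA; congr (_ + _).
by rewrite big_ord_recr.
Qed.

Lemma signed_sumE e (cs : seq R[i]) s :
  signed_sum e cs s = s + \sum_(i < size cs) sgc (nth true e i) * nth 0 cs i.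
Proof.
elim: cs e s => [|c cs IH] e s /=; first by rewrite big_ord0 addr0.
rewrite IH big_ord_recl /= addrA; rewrite -nth0; congr (_ + _).
by apply: eq_bigr => i _; rewrite nth_behead.
Qed.

Lemma normc_koebe_ge w : 2^-1 <= normc w < 1 -> 4^-1 <= normc (koebe_odd w).
Proof.
move=> /andP[w2 w1]; have d0 := koebe_denom w1.
have dp : 0 < normc (1 - w ^+ 2).
  rewrite lt_neqAle normc_ge0 andbT eq_sym.
  by apply: contra d0 => /eqP/eq0_normc ->.
rewrite /koebe_odd normcM normcV ler_pdivlMr//.
have d2 : normc (1 - w ^+ 2) <= 2.
  apply: le_trans (normcD _ _) _; rewrite normcNE (normc1 R).
  by have := ltW (normc_sqr_lt1 w1); lra.
by lra.
Qed.

Lemma root_half n : exists2 r : R, 0 < r < 1 & r ^+ (2 ^ n) = 2^-1.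
Proof.
have N0 : (2 ^ n)%:R != 0 :> R by rewrite pnatr_eq0 -lt0n expn_gt0.
exists (2^-1 `^ (2 ^ n)%:R^-1).
  rewrite powR_gt0 ?invr_gt0//=.
  rewrite -[ltRHS](_ : 1 `^ (2 ^ n)%:R^-1 = 1); last by rewrite powR1.
  apply: gt0_ltr_powR; rewrite ?nnegrE ?invr_ge0 ?invr_gt0 ?ltr0n ?expn_gt0//.
  by rewrite invf_lt1// ltr1n.
by rewrite -powR_mulrn ?powR_ge0// -powRrM mulVf// powRr1// invr_ge0.
Qed.

Lemma large_moment q (J : R) : 0 < q ->
  exists L : nat, J <= (6 * (L.+1%:R / 16)) `^ (q / 2) / 12.
Proof.
move=> q0; pose Y := (`|J| * 12) `^ (2 / q).
have Y0 : 0 <= Y by exact: powR_ge0.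
exists (Num.truncn (Y * 16)); set L := Num.truncn _.
have LY : Y * 16 <= L.+1%:R by apply: ltW; exact: truncnS_gt.
rewrite ler_pdivlMr//; apply: (@le_trans _ _ (`|J| * 12)).
  by rewrite ler_pM2r// ler_norm.
have -> : `|J| * 12 = Y `^ (q / 2).
  rewrite /Y -powRrM [2 / q * _](_ : _ = 1) ?powRr1 ?mulr_ge0//.
  by field; rewrite gt_eqF.
by apply: ge0_ler_powR; rewrite ?nnegrE ?divr_ge0 ?(ltW q0) ?mulr_ge0//; lra.
Qed.

Lemma ccont_signed_sum e Cs S : all_ccont Cs -> ccont S ->
  ccont (fun t => signed_sum e (eval_at Cs t) (S t)).
Proof.
elim: Cs e S => [|C Cs IH] e S aC cS //.
apply: (IH (behead e) (fun t => S t + sgc (head true e) * C t)).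
  by move=> i; exact: (aC i.+1).
apply: ccontD cS _; apply: ccontM (ccont_cst _) _; exact: (aC 0%N).
Qed.

Lemma ccont_psum c r : ps 1 c -> 0 <= r < 1 ->
  ccont (fun t => psum c (circle r t)).
Proof.
move=> pc r01; have /andP[r0 r1] := r01.
have c1 := continuous_circle (reps_harmonic pc) r01.
have c2 := continuous_circle (reps_harmonic (psZ (- ii) pc)) r01.
have -> : (fun t => psum c (circle r t)) = (fun t => Complex (reps c (circle r t))
    (reps (fun n => - ii * c n) (circle r t))).
  by apply/funext => t; rewrite -psum_reps// normc_circle.
split; [exact: c1|exact: c2].
Qed.

(** On the circle where r^(2^n) = 1/2, the terms with k < n have modulus at
    least 1/4, so good_signs provides L new signs which make the mean
    large. The signs from n on contribute at most 4 by normc_dyadic_le,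
    which is why J + 4 is aimed at. *)
Lemma extend_signs q (J : R) e0 : 0 < q < 1 -> exists e1, (0 < size e1)%N /\
  exists2 r, 0 < r < 1 & forall eps,
    (forall k, (k < size (e0 ++ e1))%N -> eps k = nth true (e0 ++ e1) k) ->
    J <= mean (fun t => normc (psum (dyadic eps) (circle r t)) `^ q).
Proof.
move=> q01; have /andP[q0 q1] := q01.
have [L' HL] := large_moment (J + 4) q0; set L := L'.+1 in HL.
pose n0 := size e0; pose n := (n0 + L)%N.
have [r r01 rn] := root_half n; have /andP[r0 r1] := r01.
have nc t : normc (circle r t) = r by rewrite normc_circle// ltW.
have zk t k : (k <= n)%N -> 2^-1 <= normc (circle r t ^+ (2 ^ k)) < 1.
  move=> kn; rewrite normcX nc exprn_ilt1 ?(ltW r0)// ?expn_eq0// andbT -rn.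
  by rewrite ler_wiXn2l ?(ltW r0) ?(ltW r1)// leq_pexp2l.
pose g k t := koebe_odd (circle r t ^+ (2 ^ k)) : R[i].
have cg k : ccont (g k).
  apply: ccont_koebe; first exact/ccontX/ccont_circle.
  by move=> t; rewrite normcX nc exprn_ilt1 ?(ltW r0)// expn_eq0.
pose Cs := [seq g (n0 + i)%N | i <- iota 0 L].
have sCs : size Cs = L by rewrite size_map size_iota.
have nthCs i : (i < L)%N -> nth (fun=> 0) Cs i = g (n0 + i)%N.
  by move=> iL; rewrite (nth_map 0%N) ?size_iota// nth_iota.
have aCs : all_ccont Cs by move=> i; rewrite sCs => iL; rewrite nthCs.
pose F k t := sgc (nth true e0 k) * g k t.
have cF k : ccont (F k) by apply: ccontM => //; exact: ccont_cst.
pose S t := \sum_(k < n0) F k t.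
have [cS _] := cmean_sum n0 cF.
have L0 : 0 < L%:R / 16 :> R by rewrite divr_gt0// ltr0n.
have en t : L%:R / 16 <= normc (S t) ^+ 2 + energy (eval_at Cs t).
  rewrite -[leLHS]add0r; apply: lerD; first exact: sqr_ge0.
  rewrite /energy /eval_at /Cs -map_comp big_map big_seq.
  have -> : L%:R / 16 = \sum_(i <- iota 0 L) (16^-1 : R).
    by rewrite big_const_seq count_predT size_iota iter_addr_0 mulr_natl.
  rewrite [leLHS]big_seq; apply: ler_sum => i; rewrite mem_iota add0n => /= iL.
  have h : 4^-1 <= normc (g (n0 + i)%N t).
    by apply: normc_koebe_ge; apply: zk; rewrite leq_add2l ltnW.
  have -> : 16^-1 = 4^-1 ^+ 2 :> R by field.
  by apply: lerXn2r; rewrite ?nnegrE ?normc_ge0 ?invr_ge0.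
have av : J + 4 <= mean (fun t => sign_avg (eval_at Cs t) (fun z => normc z `^ q) (S t)).
  rewrite -[leLHS]mean_cst; apply: le_mean.
  - by move=> t; exact: cvg_cst.
  - exact: (continuous_sign_avg q01 aCs cS).
  by move=> t _; apply: le_trans HL (sign_avg_powR_ge q01 L0 (en t)).
have [e1 se1 He1] := good_signs q01 aCs cS av; rewrite sCs in se1.
exists e1; split; first by rewrite se1.
exists r; first exact: r01.
move=> eps Heps.
have E t : signed_sum e1 (eval_at Cs t) (S t) = psum (dyadic eps) (circle r t) -
    psum (dyadic (fun k => eps (n + k)%N)) (circle r t ^+ (2 ^ n)).
  rewrite (@dyadic_iter eps (circle r t) n) ?nc// addrK signed_sumE size_map sCs.
  rewrite /n big_split_ord /=; congr (_ + _).
    apply: eq_bigr => k _; rewrite /F Heps.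
      by rewrite nth_cat (ltn_ord k).
    by rewrite size_cat ltn_addr.
  apply: eq_bigr => i _; rewrite Heps; last by rewrite size_cat se1 ltn_add2l.
  rewrite nth_cat ltnNge leq_addr /= addKn; congr (_ * _).
  change (nth 0 (eval_at Cs t) i = koebe_odd (circle r t ^+ (2 ^ (n0 + i)))).
  rewrite /eval_at (nth_map (fun=> 0)) ?sCs ?ltn_ord//.
  by rewrite nthCs ?ltn_ord.
have cf : ccont (fun t => psum (dyadic eps) (circle r t)).
  by apply: ccont_psum; [exact: ps_dyadic|rewrite (ltW r0)].
have cc : ccont (fun t => signed_sum e1 (eval_at Cs t) (S t)) by exact: ccont_signed_sum.
have cq := continuous_normc_powR q01 cf.
have c4 : continuous (fun _ : R => 4 : R) := @cst_continuous R R 4.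
have le4 : mean (fun t => normc (signed_sum e1 (eval_at Cs t) (S t)) `^ q) <=
    mean (fun t => normc (psum (dyadic eps) (circle r t)) `^ q + 4).
  apply: le_mean.
  - exact: continuous_normc_powR.
  - by move=> t; apply: cvgD; [exact: cq|exact: c4].
  move=> t _; rewrite E.
  set f := psum _ _; set h := psum _ _.
  have h4 : normc h <= 4 by apply: normc_dyadic_le; rewrite normcX nc rn.
  apply: (@le_trans _ _ ((normc f + normc h) `^ q)).
    apply: ge0_ler_powR; rewrite ?nnegrE ?(ltW q0) ?addr_ge0 ?normc_ge0//.
    by have := normcD f (- h); rewrite normcNE.
  apply: le_trans (powR_subadd q01 (normc_ge0 _) (normc_ge0 _)) _.
  rewrite lerD2l; apply: (@le_trans _ _ (4 `^ q)).
    by apply: ge0_ler_powR; rewrite ?nnegrE ?(ltW q0) ?normc_ge0.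
  by apply: ler1_powR; [rewrite ler1n|exact: ltW].
have := le_trans He1 le4.
by rewrite (meanD cq c4) mean_cst lerD2r.
Qed.

(** Successive extensions, with the exponents 1 / (j + 2) and the bounds j. *)
Lemma unbounded_signs : exists eps, forall j, exists2 r, 0 < r < 1 &
  j%:R <= mean (fun t => normc (psum (dyadic eps) (circle r t)) `^ j.+2%:R^-1).
Proof.
have q01 j : 0 < (j.+2%:R^-1 : R) < 1 by rewrite invr_gt0 ltr0n invf_lt1 ?ltr1n// ltr0n.
have [F HF] := choice (fun je : nat * seq bool => @extend_signs _ je.1%:R je.2 (q01 je.1)).
pose pref := fix pref j : seq bool :=
  if j is j'.+1 then pref j' ++ F (j', pref j') else [::].
have prefS j : pref j.+1 = pref j ++ F (j, pref j) by [].
have size_pref j : (j <= size (pref j))%N.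
  elim: j => // j IH; rewrite prefS size_cat -addn1; apply: leq_add => //.
  by have [] := HF (j, pref j).
have pref_cat j m : exists s, pref (j + m)%N = pref j ++ s.
  elim: m => [|m [s Hs]]; first by exists [::]; rewrite addn0 cats0.
  by exists (s ++ F ((j + m)%N, pref (j + m)%N)); rewrite addnS prefS {1}Hs catA.
have nth_pref i j k : (i <= j)%N -> (k < size (pref i))%N ->
    nth true (pref j) k = nth true (pref i) k.
  move=> ij ki; have [s] := pref_cat i (j - i)%N; rewrite subnKC// => ->.
  by rewrite nth_cat ki.
pose eps k := nth true (pref k.+1) k.
exists eps => j; have [_ [r r01 Hr]] := HF (j, pref j); exists r => //.
apply: Hr => k kj; rewrite /eps -prefS in kj *.
have [le|le] := leqP j.+1 k.+1.
  exact: nth_pref le kj.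
by rewrite (nth_pref _ _ _ (ltnW le)).
Qed.

End unbounded_example.

(** * Conclusion *)

Section nonempty.
Context {R : realType}.
Implicit Types (u v : R[i] -> R) (a s q r : R).

Lemma dyadic_cap_hp eps : cap_hp (reps (dyadic eps) : R[i] -> R).
Proof.
move=> q; rewrite /= in_itv /= => q01.
apply/(hp_bounded _ q01); split; first exact/reps_harmonic/ps_dyadic.
by have [B HB] := dyadic_pmean_bounded q01; exists B => r; exact: HB.
Qed.

Lemma pmean_le1D a s u r : 0 < a -> a <= s -> 0 < s < 1 -> harmonic_disc u ->
  0 < r < 1 -> pmean a u r <= 1 + pmean s u r.
Proof.
move=> a0 as' /andP[s0 s1] hu r01; have := circle_mean_le1D hu r01 a0 as'.
have a01 : 0 < a < 1 by rewrite a0 (le_lt_trans as').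
have s01 : 0 < s < 1 by rewrite s0.
by rewrite (circle_mean_pmean a01 hu r01) (circle_mean_pmean s01 hu r01) -EFinD lee_fin.
Qed.

Lemma mean_psum_le c a r : ps 1 c -> 0 < a < 1 -> 0 < r < 1 ->
  mean (fun t => normc (psum c (circle r t)) `^ a) <=
  pmean a (reps c) r + pmean a (reps (fun n => - ii * c n)) r.
Proof.
move=> pc a01 /andP[r0 r1]; have /andP[a0 _] := a01.
have r01 : 0 <= r < 1 by rewrite ltW.
have c1 := continuous_norm_powR a01 (continuous_circle (reps_harmonic pc) r01).
have c2 := continuous_norm_powR a01
  (continuous_circle (reps_harmonic (psZ (- ii) pc)) r01).
rewrite /pmean -(meanD c1 c2); apply: le_mean.
- exact: (continuous_normc_powR a01 (ccont_psum pc r01)).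
- by move=> t; apply: cvgD; [exact: c1|exact: c2].
move=> t _; rewrite psum_reps ?normc_circle ?(ltW r0)//.
set x := reps c _; set y := reps _ _.
apply: le_trans (powR_subadd a01 (normr_ge0 _) (normr_ge0 _)).
apply: ge0_ler_powR; rewrite ?nnegrE ?(ltW a0) ?normc_ge0 ?addr_ge0//.
exact: (normc_le_ReIm (Complex x y)).
Qed.

(** Re f has bounded means of every order less than 1. If its conjugate
    were in h^q, the means of |f|^s would be bounded for s = min q (1/2),
    hence bounded by one constant for all smaller exponents, contrary to
    the choice of the signs. *)
Lemma conj_in_no_hp_nonempty (p : nat -> R) (p01 : forall n, 0 < p n < 1) :
  conj_in_no_hp p01 !=set0.
Proof.
have [eps Heps] := @unbounded_signs R.
exists (exist _ _ (dyadic_cap_hp eps)) => q q0 /=.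
have pd := @ps_dyadic R eps.
have E : harmonic_conj (reps (dyadic eps)) = @reps R (fun n => - ii * dyadic eps n).
  exact (@harmonic_conj_reps R (dyadic eps) pd erefl).
move=> h; have {}h : hp q (@reps R (fun n => - ii * dyadic eps n)) := eq_ind _ (hp q) h _ E.
pose s := Num.min q 2^-1.
have s01 : 0 < s < 1.
  by rewrite /s lt_min q0 invr_gt0 ltr0n /= gt_min invf_lt1 ?ltr1n ?orbT.
have /andP[s0 _] := s01.
have sq : s <= q by rewrite /s ge_min lexx.
have [hv [S HS]] := (hp_bounded _ s01).1 (hp_mono s0 sq h).
have [B HB] := dyadic_pmean_bounded s01.
have hu := reps_harmonic pd.
pose j := maxn (Num.truncn s^-1) (Num.truncn (2 + B + S)).+1.
have aj : j.+2%:R^-1 <= s.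
  rewrite -[leRHS]invrK lef_pV2 ?posrE ?invr_gt0 ?ltr0n//.
  apply: le_trans (ltW (truncnS_gt _)) _; rewrite ler_nat.
  by rewrite ltnS; apply: leq_trans (leq_maxl _ _) (leqnSn _).
have a0 : 0 < j.+2%:R^-1 :> R by rewrite invr_gt0 ltr0n.
have a01 : 0 < (j.+2%:R^-1 : R) < 1 by rewrite a0 invf_lt1 ?ltr1n ?ltr0n.
have [r r01 Hr] := Heps j.
have M := mean_psum_le pd a01 r01.
have M1 := pmean_le1D a0 aj s01 hu r01.
have M2 := pmean_le1D a0 aj s01 hv r01.
have M3 := HB eps r r01; have M4 := HS r r01.
have jl : 2 + B + S < j%:R.
  apply: lt_le_trans (truncnS_gt _) _; rewrite ler_nat.
  exact: leq_maxr.
have jle := le_trans Hr (le_trans M (lerD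
  (le_trans M1 (lerD (lexx 1) M3)) (le_trans M2 (lerD (lexx 1) M4)))).
have e2 : 2 + B + S = 1 + B + (1 + S) by ring.
by rewrite e2 in jl; have := le_lt_trans jle jl; rewrite ltxx.
Qed.

End nonempty.

Theorem theorem3p7 (R : realType) (p : nat -> R)
    (p01 : forall n, 0 < p n < 1)
    (pinc : forall m n, (m < n)%N -> p m < p n)
    (pcvg : p n @[n --> \oo] --> (1 : R)) :
  Gdelta (conj_in_no_hp p01) /\ dense (conj_in_no_hp p01).
Proof.
split; first exact: Gdelta_conj_in_no_hp.
exact: dense_conj_in_no_hp (conj_in_no_hp_nonempty p01).
Qed.
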